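(* Let $e>1$ be an integer, $k\in[0,e-1]$, and $\mathbf k$ a field. Let $\Gamma$ be the cyclic quiver of length $e$ and $\overline\Gamma$ the cyclic quiver of length $e+1$. Let $\alpha=\sum_{i=0}^{e-1}d_i\alpha_i$ ($d_i\in\mathbb N$) be a dimension vector of $\Gamma$ and put $$\overline\alpha=\sum_{i=0}^{k}d_i\alpha_i+\sum_{i=k+1}^{e}d_{i-1}\alpha_i,$$ a dimension vector of $\overline\Gamma$. Let $\mathbf e=\sum_{\mathbf i\in\overline I^{\overline\alpha}_{\rm ord}}e(\mathbf i)\in R_{\overline\alpha}(\overline\Gamma)$ and $$S_{\overline\alpha}(\overline\Gamma)=\mathbf eR_{\overline\alpha}(\overline\Gamma)\mathbf e\Big/\sum_{\mathbf i\in\overline I^{\overline\alpha}_{\rm un}}\mathbf eR_{\overline\alpha}(\overline\Gamma)e(\mathbf i)R_{\overline\alpha}(\overline\Gamma)\mathbf e .$$ Then there is an algebra isomorphism $R_\alpha(\Gamma)\simeq S_{\overline\alpha}(\overline\Gamma)$.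
   Context: The cyclic quiver of length $m$ has vertex set $\mathbb Z/m\mathbb Z$ (identified with $[0,m-1]$) and arrows $i\to i+1$. **KLR algebra.** For a quiver with vertex set $I$ and no 1-loops let $h_{i,j}$ be the number of arrows from $i$ to $j$. For $\alpha=\sum_{i}d_i\alpha_i$ put $|\alpha|=\sum d_i$ and $I^\alpha=\{\mathbf i\in I^{|\alpha|}:\sum_r\alpha_{i_r}=\alpha\}$. Put $Q_{i,j}(u,v)=0$ if $i=j$ and $(v-u)^{h_{i,j}}(u-v)^{h_{j,i}}$ if $i\neq j$. Let $s_r(\mathbf i)$ be $\mathbf i$ with $i_r,i_{r+1}$ exchanged. With $d=|\alpha|$, the KLR algebra $R_\alpha$ is the $\mathbf k$-algebra generated by $e(\mathbf i)$ ($\mathbf i\in I^\alpha$), $x_1,\dots,x_d$, $\tau_1,\dots,\tau_{d-1}$ with relations: $e(\mathbf i)e(\mathbf j)=\delta_{\mathbf i,\mathbf j}e(\mathbf i)$; $\sum_{\mathbf i}e(\mathbf i)=1$; $x_re(\mathbf i)=e(\mathbf i)x_r$; $\tau_re(\mathbf i)=e(s_r(\mathbf i))\tau_r$; $x_rx_s=x_sx_r$; $\tau_rx_{r+1}e(\mathbf i)=(x_r\tau_r+\delta_{i_r,i_{r+1}})e(\mathbf i)$; $x_{r+1}\tau_re(\mathbf i)=(\tau_rx_r+\delta_{i_r,i_{r+1}})e(\mathbf i)$; $\tau_rx_s=x_s\tau_r$ if $s\ne r,r+1$; $\tau_r\tau_s=\tau_s\tau_r$ if $|r-s|>1$; $\tau_r^2e(\mathbf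 i)=Q_{i_r,i_{r+1}}(x_r,x_{r+1})e(\mathbf i)$; $(\tau_{r+1}\tau_r\tau_{r+1}-\tau_r\tau_{r+1}\tau_r)e(\mathbf i)$ equals $(x_{r+2}-x_r)^{-1}\big(Q_{i_r,i_{r+1}}(x_{r+2},x_{r+1})-Q_{i_r,i_{r+1}}(x_r,x_{r+1})\big)e(\mathbf i)$ if $i_r=i_{r+2}$ and $0$ otherwise. **Well-ordered and unordered sequences.** Let $\overline I=\mathbb Z/(e+1)\mathbb Z$. A sequence $\mathbf i=(i_1,\dots,i_d)\in\overline I^{d}$ is *well-ordered* if for each index $a$ with $i_a=k$ we have $a<d$ and $i_{a+1}=k+1$. It is *unordered* if there is $r\le d$ such that $(i_1,\dots,i_r)$ contains strictly more entries equal to $k+1$ than entries equal to $k$. $\overline I^{\overline\alpha}_{\rm ord}$ and $\overline I^{\overline\alpha}_{\rm un}$ denote the sets of well-ordered, respectively unordered, sequences in $\overline I^{\overline\alpha}$. *)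

(* Defs.v *)
From HB Require Import structures.
From mathcomp Require Import all_boot all_order all_algebra perm.
From mathcomp Require Import boolp.
From mathcomp Require Import monalg.

Set Implicit Arguments.
Unset Strict Implicit.
Unset Printing Implicit Defensive.

Import GRing.Theory.
Local Open Scope ring_scope.
Local Open Scope quotient_scope.

(* Unital associative K-algebras, as rings A with a ring morphism from K to the
   centre of A; the scalar multiple of u by c is scal c * u.  The library's
   algType is not used because it carries the axiom 1 != 0, which an algebra
   given by generators and relations, or a quotient by an arbitrary ideal, does
   not satisfy a priori; and Lmodule cannot be joined with PzRing without it. *)
HB.mixin Record isKAlgebra (K : comNzRingType) A of GRing.PzRing A := {
  scal : K -> A;
  scal_zmod : zmod_morphism scal;
  scal_monoid : monoid_morphism scal;
  scalC : forall (c : K) (u : A), scal c * u = u * scal c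
}.

#[short(type="kAlgType")]
HB.structure Definition KAlgebra (K : comNzRingType) :=
  {A of GRing.PzRing A & isKAlgebra K A}.

Arguments scal {K} A c : rename.
Notation "c %:S" := (scal _ c) (at level 1, format "c %:S") : ring_scope.

HB.instance Definition _ (K : comNzRingType) (A : kAlgType K) :=
  GRing.isZmodMorphism.Build K A (scal A) scal_zmod.
HB.instance Definition _ (K : comNzRingType) (A : kAlgType K) :=
  GRing.isMonoidMorphism.Build K A (scal A) scal_monoid.

Definition alg_isomorphism (K : comNzRingType) (A B : kAlgType K)
    (f : {rmorphism A -> B}) : Prop :=
  (forall c : K, f c%:S = c%:S) /\ bijective f.

(* Two-sided ideals, possibly improper. *)
HB.mixin Record isTwoSided (A : pzRingType) (J : A -> bool) := {
  tsidealMl : forall a u, u \in J -> a * u \in J;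
  tsidealMr : forall a u, u \in J -> u * a \in J
}.

#[short(type="tsIdeal")]
HB.structure Definition TsIdeal (A : pzRingType) :=
  {J of GRing.ZmodClosed A J & isTwoSided A J}.

Section QuotientAlgebra.
Variables (K : comNzRingType) (A : kAlgType K) (J : tsIdeal A).

Definition quot_alg : Type := Quotient.quot J.

HB.instance Definition _ := GRing.Zmodule.on quot_alg.

Definition quot_map (a : A) : quot_alg := \pi_(Quotient.quot J) a.

Lemma quot_mapP (a b : A) :
  reflect (quot_map a = quot_map b) (a - b \in (J : {pred A})).
Proof. by rewrite (Quotient.idealrBE J); exact: eqP. Qed.

Lemma quot_mapK (q : quot_alg) : quot_map (repr (q : Quotient.quot J)) = q.
Proof. exact: reprK. Qed.

Lemma quot_map_repr (a : A) :
  a - repr (\pi_(Quotient.quot J) a) \in (J : {pred A}).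
Proof. by rewrite Quotient.idealrBE reprK. Qed.

Fact quot_map_zmod : zmod_morphism quot_map.
Proof. by move=> a b; rewrite /quot_map raddfB. Qed.

HB.instance Definition _ :=
  GRing.isZmodMorphism.Build A quot_alg quot_map quot_map_zmod.

Definition quot_mul (p q : quot_alg) : quot_alg :=
  quot_map (repr (p : Quotient.quot J) * repr (q : Quotient.quot J)).

Fact quot_mulE a b : quot_mul (quot_map a) (quot_map b) = quot_map (a * b).
Proof.
apply/esym/quot_mapP; set a' := repr _; set b' := repr _.
have -> : a * b - a' * b' = (a - a') * b + a' * (b - b').
  by rewrite mulrBl mulrBr addrA addrNK.
by rewrite rpredD //; [apply: tsidealMr | apply: tsidealMl]; apply: quot_map_repr.
Qed.

Fact quot_mulA : associative quot_mul.
Proof.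
move=> p q r; rewrite -[p]quot_mapK -[q]quot_mapK -[r]quot_mapK.
by rewrite !quot_mulE mulrA.
Qed.

Fact quot_mul1l : left_id (quot_map 1) quot_mul.
Proof. by move=> p; rewrite -[p]quot_mapK quot_mulE mul1r. Qed.

Fact quot_mul1r : right_id (quot_map 1) quot_mul.
Proof. by move=> p; rewrite -[p]quot_mapK quot_mulE mulr1. Qed.

Fact quot_mulDl : left_distributive quot_mul +%R.
Proof.
move=> p q r; rewrite -[p]quot_mapK -[q]quot_mapK -[r]quot_mapK.
by rewrite -raddfD !quot_mulE mulrDl raddfD.
Qed.

Fact quot_mulDr : right_distributive quot_mul +%R.
Proof.
move=> p q r; rewrite -[p]quot_mapK -[q]quot_mapK -[r]quot_mapK.
by rewrite -raddfD !quot_mulE mulrDr raddfD.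
Qed.

HB.instance Definition _ := GRing.Zmodule_isPzRing.Build quot_alg
  quot_mulA quot_mul1l quot_mul1r quot_mulDl quot_mulDr.

Fact quot_map_monoid : monoid_morphism quot_map.
Proof. by split=> // a b; rewrite -quot_mulE. Qed.

HB.instance Definition _ :=
  GRing.isMonoidMorphism.Build A quot_alg quot_map quot_map_monoid.

Fact quot_scal_zmod : zmod_morphism (quot_map \o scal A).
Proof. exact: raddfB. Qed.

Fact quot_scal_monoid : monoid_morphism (quot_map \o scal A).
Proof. by split=> [|c c'] /=; rewrite ?rmorph1 ?rmorphM. Qed.

Fact quot_scalC (c : K) (q : quot_alg) :
  (quot_map \o scal A) c * q = q * (quot_map \o scal A) c.
Proof. by rewrite -[q]quot_mapK /= -!rmorphM scalC. Qed.

HB.instance Definition _ :=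
  isKAlgebra.Build K quot_alg quot_scal_zmod quot_scal_monoid quot_scalC.

Lemma quot_map_scal c : quot_map c%:S = c%:S.
Proof. by []. Qed.

End QuotientAlgebra.

(* The two-sided ideal generated by the differences x - y with r x y, i.e. the
   intersection of all two-sided ideals containing them. *)
Section GeneratedIdeal.
Variables (A : pzRingType) (r : A -> A -> Prop).

Definition ideal_gen_pred : A -> bool := fun a =>
  `[< forall J : tsIdeal A,
        (forall x y, r x y -> x - y \in (J : {pred A})) ->
        a \in (J : {pred A}) >].

Lemma ideal_gen_predP a :
  reflect (forall J : tsIdeal A,
             (forall x y, r x y -> x - y \in (J : {pred A})) ->
             a \in (J : {pred A}))
          (a \in ideal_gen_pred).
Proof. exact: asboolP. Qed.

Fact ideal_gen_zmod : zmod_closed ideal_gen_pred.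
Proof.
split=> [|a b]; first by apply/ideal_gen_predP => J _; rewrite rpred0.
by move=> /ideal_gen_predP Ja /ideal_gen_predP Jb; apply/ideal_gen_predP => J rJ;
   rewrite rpredB ?Ja ?Jb.
Qed.

Fact ideal_genMl a u : u \in ideal_gen_pred -> a * u \in ideal_gen_pred.
Proof.
by move=> /ideal_gen_predP Ju; apply/ideal_gen_predP => J rJ; rewrite tsidealMl ?Ju.
Qed.

Fact ideal_genMr a u : u \in ideal_gen_pred -> u * a \in ideal_gen_pred.
Proof.
by move=> /ideal_gen_predP Ju; apply/ideal_gen_predP => J rJ; rewrite tsidealMr ?Ju.
Qed.

HB.instance Definition _ := GRing.isZmodClosed.Build A ideal_gen_pred ideal_gen_zmod.
HB.instance Definition _ := isTwoSided.Build A ideal_gen_pred ideal_genMl ideal_genMr.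

Definition ideal_gen : tsIdeal A := TsIdeal.clone A ideal_gen_pred _.

Lemma ideal_gen_rel x y : r x y -> x - y \in (ideal_gen : {pred A}).
Proof. by move=> rxy; apply/ideal_gen_predP => J; apply. Qed.

End GeneratedIdeal.

(* Generators G and relations x = y for r x y: the free algebra on G is the
   monoid algebra of the free monoid on G. *)
Section Presentation.
Variables (K : comNzRingType) (G : choiceType).

Definition free_alg : Type := {malg K[{fmonom G}]}.

HB.instance Definition _ := GRing.NzRing.on free_alg.

Fact free_scalC (c : K) (g : free_alg) :
  (c%:MP : free_alg) * g = g * (c%:MP : free_alg).
Proof.
rewrite /GRing.mul /= fgmulUg fgmulgU; apply: eq_bigr => m _.
by rewrite mul1m mulm1 mulrC.
Qed.

Fact free_scal_zmod : zmod_morphism (@malgC {fmonom G} K : K -> free_alg).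
Proof. exact: raddfB. Qed.

Fact free_scal_monoid : monoid_morphism (@malgC {fmonom G} K : K -> free_alg).
Proof. by split; [exact: rmorph1 | exact: rmorphM]. Qed.

HB.instance Definition _ :=
  isKAlgebra.Build K free_alg free_scal_zmod free_scal_monoid free_scalC.

Definition free_gen (g : G) : free_alg := << fmu g >>.

Definition presented_alg (r : free_alg -> free_alg -> Prop) : Type :=
  quot_alg (ideal_gen r).

HB.instance Definition _ r := KAlgebra.on (presented_alg r).

Definition presented_gen r (g : G) : presented_alg r :=
  quot_map (ideal_gen r) (free_gen g).

End Presentation.

(* The algebra eAe, for an idempotent e, with unit e. *)
Record idempotent (A : pzRingType) := Idempotent {
  idem_val : A;
  idem_mul : idem_val * idem_val = idem_val
}.

Section CornerAlgebra.
Variables (K : comNzRingType) (A : kAlgType K) (ie : idempotent A).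
Local Notation e := (idem_val ie).

Definition corner_pred : pred A := fun a => `[< exists b : A, a = e * b * e >].

Definition corner : Type := {a : A | corner_pred a}.

HB.instance Definition _ := SubChoice.on corner.

Fact corner_zmod : zmod_closed corner_pred.
Proof.
split=> [|a b]; first by apply/asboolP; exists 0; rewrite mulr0 mul0r.
move=> /asboolP[a' ->] /asboolP[b' ->]; apply/asboolP; exists (a' - b').
by rewrite mulrBr mulrBl.
Qed.

HB.instance Definition _ := GRing.isZmodClosed.Build A corner_pred corner_zmod.
HB.instance Definition _ := [SubChoice_isSubZmodule of corner by <:].

Lemma val_cornerD (u v : corner) : val (u + v) = val u + val v.
Proof. exact: raddfD. Qed.

Lemma val_cornerB (u v : corner) : val (u - v) = val u - val v.
Proof. exact: raddfB. Qed.

Lemma corner_mull (u : corner) : e * val u = val u.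
Proof.
by case: u => u uP /=; case/asboolP: (uP) => b ->; rewrite !mulrA idem_mul.
Qed.

Lemma corner_mulr (u : corner) : val u * e = val u.
Proof.
by case: u => u uP /=; case/asboolP: (uP) => b ->; rewrite -[LHS]mulrA idem_mul.
Qed.

Fact corner_projP (a : A) : corner_pred (e * a * e).
Proof. by apply/asboolP; exists a. Qed.

Definition corner_proj (a : A) : corner := Sub (e * a * e) (corner_projP a).

Lemma val_corner_proj a : val (corner_proj a) = e * a * e.
Proof. by []. Qed.

Definition corner_mul (u v : corner) : corner := corner_proj (val u * val v).
Definition corner_one : corner := corner_proj 1.

Lemma val_corner_mul u v : val (corner_mul u v) = val u * val v.
Proof. by rewrite val_corner_proj mulrA corner_mull -mulrA corner_mulr. Qed.

Lemma val_corner_one : val corner_one = e.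
Proof. by rewrite val_corner_proj mulr1 idem_mul. Qed.

Fact corner_mulA : associative corner_mul.
Proof. by move=> u v w; apply: val_inj; rewrite !val_corner_mul mulrA. Qed.

Fact corner_mul1l : left_id corner_one corner_mul.
Proof.
by move=> u; apply: val_inj; rewrite val_corner_mul val_corner_one corner_mull.
Qed.

Fact corner_mul1r : right_id corner_one corner_mul.
Proof.
by move=> u; apply: val_inj; rewrite val_corner_mul val_corner_one corner_mulr.
Qed.

Fact corner_mulDl : left_distributive corner_mul +%R.
Proof.
move=> u v w; apply: val_inj.
by rewrite !(val_corner_mul, val_cornerD) mulrDl.
Qed.

Fact corner_mulDr : right_distributive corner_mul +%R.
Proof.
move=> u v w; apply: val_inj.
by rewrite !(val_corner_mul, val_cornerD) mulrDr.
Qed.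

HB.instance Definition _ := GRing.Zmodule_isPzRing.Build corner
  corner_mulA corner_mul1l corner_mul1r corner_mulDl corner_mulDr.

Lemma val_cornerM (u v : corner) : val (u * v) = val u * val v.
Proof. exact: val_corner_mul. Qed.

Definition corner_scal (c : K) : corner := corner_proj c%:S.

Lemma val_corner_scal c : val (corner_scal c) = c%:S * e.
Proof. by rewrite val_corner_proj -scalC -mulrA idem_mul. Qed.

Fact corner_scal_zmod : zmod_morphism corner_scal.
Proof.
move=> c c'; apply: val_inj.
by rewrite val_cornerB !val_corner_proj raddfB mulrBr mulrBl.
Qed.

Fact corner_scal_monoid : monoid_morphism corner_scal.
Proof.
split=> [|c c']; apply: val_inj; first by rewrite val_corner_proj rmorph1.
rewrite val_cornerM !val_corner_scal rmorphM -!mulrA; congr (_ * _).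
by rewrite mulrA -scalC -mulrA idem_mul.
Qed.

Fact corner_scalC (c : K) (u : corner) : corner_scal c * u = u * corner_scal c.
Proof.
apply: val_inj; rewrite !val_cornerM val_corner_scal -mulrA corner_mull.
by rewrite mulrA -scalC -mulrA corner_mulr.
Qed.

HB.instance Definition _ :=
  isKAlgebra.Build K corner corner_scal_zmod corner_scal_monoid corner_scalC.

(* The ideal \sum_(i | P i) e A (f i) A e of e A e; each summand is the additive
   span of the products e a (f i) b e. *)
Variables (T : finType) (f : T -> A) (P : pred T).

Definition corner_ideal_pred : corner -> bool := fun u =>
  `[< exists s : T -> seq (A * A),
        val u =
        \sum_(i | P i) \sum_(ab <- s i) e * ab.1 * f i * ab.2 * e >].

Fact corner_ideal_zmod : zmod_closed corner_ideal_pred.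
Proof.
split=> [|u v].
  apply/asboolP; exists (fun=> [::]).
  by rewrite big1 // => i _; rewrite big_nil.
move=> /asboolP[s us] /asboolP[t vt]; apply/asboolP.
exists (fun i => s i ++ [seq (- ab.1, ab.2) | ab <- t i]).
rewrite val_cornerB us vt -sumrB; apply: eq_bigr => i _.
rewrite big_cat big_map -sumrN /=; congr (_ + _); apply: eq_bigr => ab _.
by rewrite mulrN !mulNr.
Qed.

Fact corner_idealMl (c u : corner) :
  u \in corner_ideal_pred -> c * u \in corner_ideal_pred.
Proof.
move=> /asboolP[s us]; apply/asboolP.
exists (fun i => [seq (val c * e * ab.1, ab.2) | ab <- s i]).
rewrite val_cornerM us mulr_sumr; apply: eq_bigr => i _.
rewrite mulr_sumr big_map; apply: eq_bigr => ab _ /=.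
by rewrite !mulrA corner_mull corner_mulr.
Qed.

Fact corner_idealMr (c u : corner) :
  u \in corner_ideal_pred -> u * c \in corner_ideal_pred.
Proof.
move=> /asboolP[s us]; apply/asboolP.
exists (fun i => [seq (ab.1, ab.2 * e * val c) | ab <- s i]).
rewrite val_cornerM us mulr_suml; apply: eq_bigr => i _.
rewrite mulr_suml big_map; apply: eq_bigr => ab _ /=.
by rewrite -!mulrA corner_mulr.
Qed.

HB.instance Definition _ :=
  GRing.isZmodClosed.Build corner corner_ideal_pred corner_ideal_zmod.
HB.instance Definition _ :=
  isTwoSided.Build corner corner_ideal_pred corner_idealMl corner_idealMr.

Definition corner_ideal : tsIdeal corner :=
  TsIdeal.clone corner corner_ideal_pred _.

End CornerAlgebra.

Section KLR.
Variables (K : fieldType) (I : finType) (h : I -> I -> nat).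

Definition klrQ (A : pzRingType) (i j : I) (u v : A) : A :=
  if i == j then 0 else (v - u) ^+ h i j * (u - v) ^+ h j i.

(* K[u][v][w]: w is the outermost variable. *)
Local Notation K3 := {poly {poly {poly K}}}.

(* (w - u)^-1 (Q_{i,j}(w, v) - Q_{i,j}(u, v)); the Euclidean division is exact
   by klrDQ_exact. *)
Definition klrDQ (i j : I) : K3 :=
  let u : K3 := ('X%:P)%:P in
  let v : K3 := 'X%:P in
  let w : K3 := 'X in
  (klrQ i j w v - klrQ i j u v) %/ (w - u).

Lemma klrDQ_exact (i j : I) :
  klrDQ i j * ('X - ('X%:P)%:P) =
  klrQ i j 'X ('X%:P) - klrQ i j ('X%:P)%:P ('X%:P) :> K3.
Proof.
rewrite /klrDQ Pdiv.IdomainUnit.divpK ?lead_coefXsubC ?unitr1 //.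
rewrite dvdp_XsubCl /root /klrQ; case: (i =P j) => _.
  by rewrite subr0 horner0.
by rewrite !(hornerE, horner_exp) subrr.
Qed.

(* Evaluation at u = a, v = b, w = c; the order of the factors is immaterial
   where it is used, as the x_r commute in the KLR algebra. *)
Definition eval3 (A : kAlgType K) (p : K3) (a b c : A) : A :=
  \sum_(l < size p) \sum_(m < size p`_l) \sum_(n < size p`_l`_m)
     (p`_l`_m`_n)%:S * (a ^+ n * b ^+ m * c ^+ l).

Variable alpha : I -> nat.

Definition weight : nat := (\sum_i alpha i)%N.

Definition Iseq : Type :=
  {w : weight.-tuple I | [forall i, count_mem i w == alpha i]}.

HB.instance Definition _ := SubFinite.on Iseq.

(* Positions are numbered from 0: x_1, ..., x_d are indexed by 'I_d and
   tau_1, ..., tau_(d-1) by 'I_d.-1; fstp r and sndp r are the two positions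
   exchanged by s_r. *)
Fact sndp_subproof (r : 'I_weight.-1) : (r.+1 < weight)%N.
Proof. by rewrite -ltn_predRL. Qed.

Definition fstp (r : 'I_weight.-1) : 'I_weight :=
  widen_ord (leq_pred weight) r.
Definition sndp (r : 'I_weight.-1) : 'I_weight := Ordinal (sndp_subproof r).

Definition entry (w : Iseq) (a : 'I_weight) : I := tnth (val w) a.

Fact swap_subproof (r : 'I_weight.-1) (w : Iseq) :
  [forall i, count_mem i
    [tuple entry w (tperm (fstp r) (sndp r) a) | a < weight] == alpha i].
Proof.
apply/forallP => i; rewrite -(eqP (forallP (valP w) i)); apply/eqP.
apply/seq.permP/tuple_permP; by exists (tperm (fstp r) (sndp r)).
Qed.

Definition swap (r : 'I_weight.-1) (w : Iseq) : Iseq :=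
  Sub [tuple entry w (tperm (fstp r) (sndp r) a) | a < weight]
      (swap_subproof r w).

Definition klr_gen : Type := (Iseq + 'I_weight + 'I_weight.-1)%type.

HB.instance Definition _ := Finite.on klr_gen.

Local Notation F := (free_alg K klr_gen).

Definition free_e (w : Iseq) : F := free_gen K (inl (inl w) : klr_gen).
Definition free_x (a : 'I_weight) : F := free_gen K (inl (inr a) : klr_gen).
Definition free_t (r : 'I_weight.-1) : F := free_gen K (inr r : klr_gen).

Local Notation e := free_e.
Local Notation x := free_x.
Local Notation t := free_t.

Inductive klr_rel : F -> F -> Prop :=
| klr_ee v w : klr_rel (e v * e w) (if v == w then e v else 0)
| klr_e1 : klr_rel (\sum_w e w) 1
| klr_xe a w : klr_rel (x a * e w) (e w * x a)
| klr_te r w : klr_rel (t r * e w) (e (swap r w) * t r)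
| klr_xx a b : klr_rel (x a * x b) (x b * x a)
| klr_tx2 r w : klr_rel
    (t r * x (sndp r) * e w)
    ((x (fstp r) * t r + (entry w (fstp r) == entry w (sndp r))%:R) * e w)
| klr_x2t r w : klr_rel
    (x (sndp r) * t r * e w)
    ((t r * x (fstp r) + (entry w (fstp r) == entry w (sndp r))%:R) * e w)
| klr_tx r a : a != fstp r -> a != sndp r -> klr_rel (t r * x a) (x a * t r)
| klr_tt (r s : 'I_weight.-1) : (r.+1 < s)%N || (s.+1 < r)%N ->
    klr_rel (t r * t s) (t s * t r)
| klr_t2 r w : klr_rel
    (t r ^+ 2 * e w)
    (klrQ (entry w (fstp r)) (entry w (sndp r)) (x (fstp r)) (x (sndp r)) * e w)
| klr_braid (r s : 'I_weight.-1) w : s = r.+1 :> nat -> klr_rel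
    ((t s * t r * t s - t r * t s * t r) * e w)
    (if entry w (fstp r) == entry w (sndp s)
     then eval3 (klrDQ (entry w (fstp r)) (entry w (sndp r)))
                (x (fstp r)) (x (sndp r)) (x (sndp s)) * e w
     else 0).

Definition klr : Type := presented_alg klr_rel.

HB.instance Definition _ := KAlgebra.on klr.

Definition klr_e (w : Iseq) : klr :=
  presented_gen klr_rel (inl (inl w) : klr_gen).

Lemma klr_eM v w : klr_e v * klr_e w = if v == w then klr_e v else 0.
Proof.
have /quot_mapP E := ideal_gen_rel (klr_ee v w); rewrite rmorphM in E.
by apply: etrans E _; case: ifP => // _; rewrite rmorph0.
Qed.

Fact klr_idem_subproof (P : pred Iseq) :
  (\sum_(w | P w) klr_e w) * (\sum_(w | P w) klr_e w) = \sum_(w | P w) klr_e w.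
Proof.
rewrite mulr_suml; apply: eq_bigr => v Pv; rewrite mulr_sumr (bigD1 v) //=.
rewrite klr_eM eqxx big1 ?addr0 // => w /andP[_ wv].
by rewrite klr_eM eq_sym (negPf wv).
Qed.

Definition klr_idem (P : pred Iseq) : idempotent klr :=
  Idempotent (klr_idem_subproof P).

End KLR.

Definition cyclic_quiver (m : nat) (i j : 'I_m) : nat := (j == ordS i).

Section BalancedKLR.
Variables (K : fieldType) (e : nat) (k : 'I_e) (d : 'I_e -> nat).

(* \bar d_i = d_i for i <= k and \bar d_i = d_(i-1) for i > k. *)
Fact bar_subproof (i : 'I_e.+1) : (unbump k i < e)%N.
Proof.
rewrite /unbump; have [ki|ik] := ltnP k i.
  by rewrite subn1 -ltnS prednK ?ltn_ord ?(leq_ltn_trans _ ki).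
by rewrite subn0 (leq_ltn_trans ik).
Qed.

Definition bar_dim (i : 'I_e.+1) : nat := d (Ordinal (bar_subproof i)).

Local Notation quiver := (@cyclic_quiver e.+1).
Local Notation k0 := (widen_ord (leqnSn e) k).
Local Notation k1 := (ordS k0).

Definition well_ordered : pred (Iseq bar_dim) := fun w =>
  [forall a, (entry w a == k0) ==>
     [exists b : 'I_(weight bar_dim), (b == a.+1 :> nat) && (entry w b == k1)]].

Definition unordered : pred (Iseq bar_dim) := fun w =>
  [exists r : 'I_(weight bar_dim).+1,
     (count_mem k0 (take r (val w)) < count_mem k1 (take r (val w)))%N].

Definition balanced_klr : Type :=
  quot_alg
    (corner_ideal (klr_idem K quiver well_ordered)
                  (@klr_e K _ quiver bar_dim) unordered).

HB.instance Definition _ := KAlgebra.on balanced_klr.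

End BalancedKLR.

(* Main.v *)
(* Both KLR algebras act faithfully on their polynomial representations: words in
   the tau's reduce to normal forms indexed by permutations, and the operators of
   these normal forms are linearly independent by their leading terms (evaluating
   at points turns this into Dedekind's independence of characters).

   Let phi i be the sequence obtained by replacing each k in i by k, k+1 (and
   renumbering the other vertices); these are the well-ordered sequences.
   Restricting the functions over phi i to the points where the two variables of
   every such pair coincide contracts the polynomial representation for the long
   quiver onto the one for the short quiver.  An idempotent e(j) with j unordered
   acts by 0 after contraction, because the functions vanishing at all admissible
   points form a submodule.  The operator tau_r contracts from the block of
   crossings exchanging the blow-ups of the letters r and r+1, up to a sign.
   Hence every element of R_alpha(Gamma) is induced by some element of the
   KLR algebra R of the long quiver.

   Conversely, in e R e a normal form whose permutation does not move the pairs
   k, k+1 as blocks has a descent inside a pair of its target and thus factors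
   through an unordered sequence, and so does (x_(p+1) - x_p) e(phi i) = tau_p^2
   e(phi i) for a pair at p, p+1.  So e R e is spanned, modulo the ideal, by the
   elements inducing the normal forms of R_alpha(Gamma); as the latter are linearly
   independent, the relation "U induces a" is the graph of an isomorphism. *)
From HB Require Import structures.
From mathcomp Require Import all_boot all_algebra perm finmap.
From mathcomp Require Import boolp ssrcomplements mpoly zify ring.
From mathcomp Require monalg.
Require Import Defs.
Set Implicit Arguments.
Unset Strict Implicit.
Unset Printing Implicit Defensive.
Import GRing.Theory.


(** * Words of transpositions acting on lists *)

(** A homomorphism given on generators would require checking the quadratic and braid relations,
    inside the quotient, for blocks of up to four crossings. The relation [shadow] avoids this: [U]
    and [a] are related when [contract] intertwines them, which is stable under sums, products and
    scalars. So a multiplicative map results once every [a] has a lift and the elements with shadow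
    0 are identified. Identities between operators are tested at pairs of a sequence and a point. At
    the generic point, with distinct coordinates in a fraction field, the denominators are
    invertible and the relations become identities of rational functions. The same values at doubled
    points compute the contraction; there coordinates coincide, but only at different letters, for
    which tau has no denominator. Block permutations are recognised by an extremal count: without a
    descent inside a pair, the positions of the letters k+1 sum to at least those of the letters k
    plus the number of pairs. The source sequence fixes this difference to be exactly the number of
    pairs, and equality forces pairs to move as blocks. *)

Section Swaps.
Variable T : Type.
Implicit Types (s : seq T) (u : seq nat).

(** A letter beyond the end of the list acts as the identity, so that words carry no bound on their
    letters. *)
Fixpoint swapl r s : seq T :=
  match r, s with
  | 0, a :: b :: s' => b :: a :: s'
  | r'.+1, a :: s' => a :: swapl r' s'
  | _, _ => s
  end.

(** The rightmost letter acts first, as in a product of operators. A permutation is encoded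
    throughout by the list [actl u (iota 0 n)]. *)
Definition actl u s := foldr swapl s u.

Definition sw (r q : nat) : nat :=
  if q == r then r.+1 else if q == r.+1 then r else q.

Lemma swK r : involutive (sw r).
Proof.
move=> q; rewrite /sw; case: (eqVneq q r) => [->|qr].
  by rewrite (gtn_eqF (ltnSn r)) eqxx.
by case: (eqVneq q r.+1) => [->|qr1]; rewrite ?eqxx // (negPf qr) (negPf qr1).
Qed.

Lemma size_swapl r s : size (swapl r s) = size s.
Proof. by elim: r s => [|r IHr] [|a [|b s]] //=; rewrite IHr. Qed.

Lemma swaplK r : involutive (swapl r).
Proof. by elim: r => [|r IHr] [|a [|b s]] //=; rewrite IHr. Qed.

Lemma swapl_oob r s : size s <= r.+1 -> swapl r s = s.
Proof.
by elim: r s => [|r IHr] [|a s] //=; [case: s | rewrite ltnS => /IHr->].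
Qed.

Lemma swapl_catr r s1 s2 : swapl (size s1 + r) (s1 ++ s2) = s1 ++ swapl r s2.
Proof. by elim: s1 => //= a s1 ->. Qed.

Lemma swapl_cat s1 a b s2 :
  swapl (size s1) (s1 ++ a :: b :: s2) = s1 ++ b :: a :: s2.
Proof. by rewrite -[size s1]addn0 swapl_catr. Qed.

Lemma nth_swapl x0 r s q : r.+1 < size s ->
  nth x0 (swapl r s) q = nth x0 s (sw r q).
Proof.
elim: r s q => [|r IHr] [|a s] //= q.
  by case: s => [|b s] //= _; case: q => [|[|q]].
by rewrite ltnS => /IHr E; case: q => [|q] //=; rewrite E /sw !eqSS; do 2?case: eqP.
Qed.

Lemma swapl_split r s : r.+1 < size s ->
  exists s1 a b s2, s = s1 ++ a :: b :: s2 /\ size s1 = r.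
Proof.
elim: r s => [|r IHr] [|a s] //=.
  by case: s => [|b s] // _; exists [::], a, b, s.
by rewrite ltnS => /IHr[s1 [b [c [s2 [-> <-]]]]]; exists (a :: s1), b, c, s2.
Qed.

Lemma swaplC r r' s : r.+1 < r' -> swapl r (swapl r' s) = swapl r' (swapl r s).
Proof.
elim: r r' s => [|r IHr] [|r'] [|a s] //; last by rewrite ltnS => /IHr E /=; rewrite E.
by case: r' s => [|r'] [|b s].
Qed.

Lemma swapl_braid r s :
  r.+2 < size s ->
  swapl r (swapl r.+1 (swapl r s)) = swapl r.+1 (swapl r (swapl r.+1 s)).
Proof. by elim: r s => [|r IHr] [|a [|b [|c s]]] //= H; rewrite IHr. Qed.

Lemma size_actl u s : size (actl u s) = size s.
Proof. by elim: u => //= r u IHu; rewrite size_swapl. Qed.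

Lemma actl_cat u v s : actl (u ++ v) s = actl u (actl v s).
Proof. exact: foldr_cat. Qed.

Lemma actl_revK u s : actl u (actl (rev u) s) = s.
Proof.
elim: u s => //= r u IHu s.
by rewrite rev_cons -cats1 actl_cat IHu /= swaplK.
Qed.

End Swaps.

Lemma map_swapl (T U : Type) (f : T -> U) r s :
  map f (swapl r s) = swapl r (map f s).
Proof. by elim: r s => [|r IHr] [|a [|b s]] //=; rewrite IHr. Qed.

Lemma map_actl (T U : Type) (f : T -> U) u s :
  map f (actl u s) = actl u (map f s).
Proof. by elim: u => //= r u IHu; rewrite map_swapl IHu. Qed.

Lemma perm_swapl (T : eqType) r (s : seq T) : perm_eq (swapl r s) s.
Proof.
elim: r s => [|r IHr] [|a s] //=; last by rewrite perm_cons.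
by case: s => [|b s] //; apply/seq.permP => p /=; rewrite addnCA.
Qed.

Lemma perm_actl (T : eqType) u (s : seq T) : perm_eq (actl u s) s.
Proof. by elim: u => //= r u; apply: perm_trans (perm_swapl _ _). Qed.

Lemma actlE (T : Type) (x0 : T) u s :
  actl u s = map (nth x0 s) (actl u (iota 0 (size s))).
Proof. by rewrite map_actl -/(mkseq _ _) mkseq_nth. Qed.

Lemma actl_inj_nat (T : Type) u v n (s : seq T) : size s = n ->
  actl u (iota 0 n) = actl v (iota 0 n) -> actl u s = actl v s.
Proof.
case: s => [|x0 s] <- E; last by rewrite !(actlE x0) E.
have nilE w : actl w [::] = [::] :> seq T by apply: size0nil; rewrite size_actl.
by rewrite !nilE.
Qed.

(** Reversing a word inverts its permutation, and equal permutations have equal inverses. *)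
Lemma actl_rev_eq u v n : actl u (iota 0 n) = actl v (iota 0 n) ->
  actl (rev u) (iota 0 n) = actl (rev v) (iota 0 n).
Proof.
move=> E; apply: (can_inj (actl_revK (rev v))); rewrite revK actl_revK.
rewrite -(@actl_inj_nat _ u v n) ?actl_revK //.
by rewrite size_actl size_iota.
Qed.

(** * Descents, inversions and reduced words *)

Section Descents.
Implicit Types (L : seq nat) (u v : seq nat).

Definition desc r L := (r.+1 < size L) && (nth 0 L r.+1 < nth 0 L r).

Lemma desc_lt r L : desc r L -> r.+1 < size L.
Proof. by case/andP. Qed.

Lemma desc_far r s L : (r.+1 < s)%N || (s.+1 < r)%N ->
  desc r (swapl s L) = desc r L.
Proof.
move=> rs; have [sL|sL] := ltnP s.+1 (size L); last by rewrite swapl_oob.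
rewrite /desc size_swapl !nth_swapl //.
have [-> ->] : sw s r.+1 = r.+1 /\ sw s r = r.
  by split; rewrite /sw; do 2!(case: eqVneq => ?; try lia).
by [].
Qed.

(** Only three consecutive entries are involved, and the hypotheses force their order to be one from
    which [r] and then [s] can be peeled off. This is the situation of the braid relation in
    [exchange]. *)
Lemma desc_adj r s L : (r == s.+1) || (s == r.+1) -> (s.+1 < size L)%N ->
  desc r (swapl s L) -> ~~ desc s L -> desc r L && desc s (swapl r L).
Proof.
move=> rs sL; rewrite /desc !size_swapl sL /= !(nth_swapl _ _ sL).
case/andP=> rL; rewrite rL !(nth_swapl _ _ rL) -leqNgt /=.
case/orP: rs => /eqP E; rewrite {}E in rL *.
  have [-> -> -> ->] : [/\ sw s s.+2 = s.+2, sw s s.+1 = s,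
      sw s.+1 s.+1 = s.+2 & sw s.+1 s = s].
    by split; rewrite /sw; do 2!(case: eqVneq => ?; try lia).
  by move=> lt1 le2; rewrite (leq_trans lt1).
have [-> -> -> ->] : [/\ sw r.+1 r.+1 = r.+2, sw r.+1 r = r,
    sw r r.+2 = r.+2 & sw r r.+1 = r].
  by split; rewrite /sw; do 2!(case: eqVneq => ?; try lia).
by move=> lt1 le2; rewrite (leq_ltn_trans le2) //= lt1.
Qed.

Lemma desc_cat L1 a b L2 : desc (size L1) (L1 ++ a :: b :: L2) = (b < a).
Proof.
rewrite /desc size_cat /= !addnS !ltnS leq_addr /=.
by rewrite !nth_cat ltnn subnn (leq_gtF (leqnSn _)) subSnn.
Qed.

(** The letters of [v] peel off descents one by one, so [v] is an initial piece of a reduced word of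
    the permutation [L]; what remains is [actl (rev v) L]. *)
Fixpoint chain L v : bool :=
  if v is r :: v' then desc r L && chain (swapl r L) v' else true.

Lemma chain_cat L v v' :
  chain L (v ++ v') = chain L v && chain (actl (rev v) L) v'.
Proof.
elim: v L => //= r v IHv L; rewrite IHv -andbA rev_cons -cats1.
by rewrite actl_cat.
Qed.

Lemma chain_valid L v : chain L v -> all (fun r => r.+1 < size L) v.
Proof.
elim: v L => //= r v IHv L /andP[/desc_lt -> /IHv].
by rewrite size_swapl.
Qed.

Fixpoint inv L : nat :=
  if L is a :: L' then count (fun b => b < a) L' + inv L' else 0.

Lemma inv_desc r L : desc r L -> inv L = (inv (swapl r L)).+1.
Proof.
case/andP=> /swapl_split[L1 [a [b [L2 [-> <-]]]]] ba.
have {}ba: b < a.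
  by rewrite -(desc_cat L1 a b L2) /desc ba size_cat /= !addnS !ltnS leq_addr.
rewrite swapl_cat; elim: L1 => [|c L1 IH] /=.
  by rewrite ba ltnNge ltnW //= add0n add1n addSn addnCA.
by rewrite IH addnS; rewrite !count_cat /= [(a < c) + _]addnCA.
Qed.

Lemma inv_swapl r L : uniq L -> inv (swapl r L) <= (inv L).+1.
Proof.
move=> uL; have [rL|rL] := ltnP r.+1 (size L); last by rewrite swapl_oob.
have [dL|dL] := boolP (desc r L); first by rewrite (inv_desc dL) ltnW ?ltnS ?leqnSn.
have d': desc r (swapl r L).
  rewrite /desc size_swapl rL /= !nth_swapl // /sw eqxx (gtn_eqF (ltnSn r)) eqxx.
  move: dL; rewrite /desc rL /= -leqNgt leq_eqVlt => /orP[|//].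
  by rewrite nth_uniq // ?(ltnW rL) // (ltn_eqF (ltnSn r)).
by rewrite (inv_desc d') swaplK.
Qed.

Lemma inv_iota m n : inv (iota m n) = 0.
Proof.
elim: n m => //= n IHn m; rewrite IHn addn0; apply/eqP.
rewrite -leqn0 leqNgt -has_count; apply/hasPn => b; rewrite mem_iota -leqNgt.
by case/andP=> /ltnW.
Qed.

Lemma inv_actl u n : inv (actl u (iota 0 n)) <= size u.
Proof.
elim: u => [|r u IHu] /=; first by rewrite inv_iota.
apply: leq_trans (inv_swapl _ _) _; last by rewrite ltnS.
by rewrite (perm_uniq (perm_actl _ _)) iota_uniq.
Qed.

Lemma inv_chain L v : chain L v -> inv L = size v + inv (actl (rev v) L).
Proof.
elim: v L => //= r v IHv L /andP[dL /IHv E].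
by rewrite (inv_desc dL) E rev_cons -cats1 actl_cat addSn.
Qed.

Lemma no_desc_iota n L : perm_eq L (iota 0 n) ->
  (forall r, ~~ desc r L) -> L = iota 0 n.
Proof.
move=> pL dL; apply: (sorted_eq leq_trans anti_leq) => //.
  apply/(sortedP 0) => i iL; have := dL i; rewrite /desc iL /= -leqNgt //.
exact: iota_sorted.
Qed.

(** Removing the first descent each time yields a distinguished reduced word. Every step lowers
    [inv], the Coxeter length, by exactly one, so [inv L] is the exact number of steps. *)
Fixpoint nf_rec m L : seq nat :=
  if m is m'.+1 then
    let r := find (fun r => desc r L) (iota 0 (size L)) in
    r :: nf_rec m' (swapl r L)
  else [::].

Definition nf L := nf_rec (inv L) L.

Lemma nfP n L : perm_eq L (iota 0 n) ->
  chain L (nf L) /\ actl (rev (nf L)) L = iota 0 n.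
Proof.
rewrite /nf; have [m iL] : {m | inv L = m} by exists (inv L).
rewrite iL; elim: m L iL => [|m IHm] L iL pL /=.
  by split=> //; apply: no_desc_iota => // r; apply/negP => /inv_desc; rewrite iL.
set r := find _ _.
have hasL: has (fun r => desc r L) (iota 0 (size L)).
  apply/negPn/negP => /hasPn nL.
  have E: L = iota 0 n.
    apply: no_desc_iota => // q; apply/negP => dq; have := desc_lt dq => qL.
    by have := nL q; rewrite mem_iota add0n => /(_ (ltnW qL))/negP[].
  by move: iL; rewrite E inv_iota.
have dr: desc r L.
  have rL: r < size L by move: (hasL); rewrite has_find size_iota.
  by have := nth_find 0 hasL; rewrite -/r nth_iota.
have [||c E] := IHm (swapl r L).
- by move: iL; rewrite (inv_desc dr) => -[].
- exact: perm_trans (perm_swapl _ _) pL.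
by rewrite dr c rev_cons -cats1 actl_cat E.
Qed.

Lemma actl_nf n L : perm_eq L (iota 0 n) -> actl (nf L) (iota 0 n) = L.
Proof. by move=> /nfP[_ <-]; rewrite actl_revK. Qed.

Lemma size_nf n L : perm_eq L (iota 0 n) -> size (nf L) = inv L.
Proof.
by move=> /nfP[c E]; rewrite (inv_chain c) E inv_iota addn0.
Qed.

End Descents.

(** * Blowing up each letter k into k, k+1 *)

Section Blow.
Variables (e : nat) (k : 'I_e).
Implicit Types (i j : seq 'I_e).

(* Each letter k of i doubles the corresponding entry x of z into f x, g x. *)
Fixpoint blow (T U : Type) (f g : T -> U) i (z : seq T) : seq U :=
  match i, z with
  | a :: i', x :: z' => f x :: (if a == k then g x :: blow f g i' z' else blow f g i' z')
  | _, _ => [::]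
  end.

Lemma blow_cat T U (f g : T -> U) i1 i2 z1 z2 : size i1 = size z1 ->
  blow f g (i1 ++ i2) (z1 ++ z2) = blow f g i1 z1 ++ blow f g i2 z2.
Proof.
by elim: i1 z1 => [|a i1 IH] [|x z1] //= [/IH->]; case: ifP.
Qed.

Definition bsize i := size i + count_mem k i.

Lemma size_blow T U (f g : T -> U) i z : size i = size z ->
  size (blow f g i z) = bsize i.
Proof.
rewrite /bsize; elim: i z => [|a i IH] [|x z] //= [/IH E].
by case: eqP => _ /=; rewrite E ?addSn ?addnS ?add0n.
Qed.

Lemma blow_map T U W (f g : T -> U) (c : W -> T) i z :
  blow f g i (map c z) = blow (f \o c) (g \o c) i z.
Proof. by elim: i z => [|a i IH] [|x z] //=; rewrite IH. Qed.

Lemma map_blow T U W (f g : T -> U) (c : U -> W) i z :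
  map c (blow f g i z) = blow (c \o f) (c \o g) i z.
Proof. by elim: i z => [|a i IH] [|x z] //=; rewrite -IH; case: ifP. Qed.

(** The crossings that exchange the blow-ups of the letters [r] and [r.+1] of [j]. For [r] out of
    range, the letter [bsize j] is out of range for the blow-up as well, so that the corresponding
    tau's vanish on both sides. *)
Definition blk r j : seq nat :=
  let p := bsize (take r j) in
  let isk q := nth k j q == k in
  if r.+1 < size j then
    if isk r then
      if isk r.+1 then [:: p.+1; p; p.+2; p.+1] else [:: p; p.+1]
    else if isk r.+1 then [:: p.+1; p] else [:: p]
  else [:: bsize j].

Lemma blk_cat j1 a b j2 : blk (size j1) (j1 ++ a :: b :: j2) =
  let p := bsize j1 in
  if a == k then if b == k then [:: p.+1; p; p.+2; p.+1] else [:: p; p.+1]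
  else if b == k then [:: p.+1; p] else [:: p].
Proof.
rewrite /blk size_cat /= !addnS !ltnS leq_addr take_size_cat //.
rewrite !nth_cat ltnn subnn (leq_gtF (leqnSn _)) subSnn /=.
by case: (a == k); case: (b == k).
Qed.

Lemma actl_blk T U (f g : T -> U) j1 a b j2 z1 x y z2 : size j1 = size z1 ->
  actl (blk (size j1) (j1 ++ a :: b :: j2)) (blow f g (j1 ++ a :: b :: j2) (z1 ++ x :: y :: z2))
  = blow f g (j1 ++ b :: a :: j2) (z1 ++ y :: x :: z2).
Proof.
move=> sz; rewrite !blow_cat // blk_cat -(size_blow f g sz) /=.
move: (blow f g j1 z1) (blow f g j2 z2) => s1 s2.
have S0 w : swapl (size s1) (s1 ++ w) = s1 ++ swapl 0 w.
  by rewrite -{1}[size s1]addn0 swapl_catr.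
have S1 w : swapl (size s1).+1 (s1 ++ w) = s1 ++ swapl 1 w.
  by rewrite -{1}[(size s1).+1]addn1 swapl_catr.
have S2 w : swapl (size s1).+2 (s1 ++ w) = s1 ++ swapl 2 w.
  by rewrite -{1}[(size s1).+2]addn2 swapl_catr.
by case: (a == k); case: (b == k); rewrite /actl; cbn [foldr]; rewrite !(S0, S1, S2).
Qed.

(** The four inequalities put every entry of the blow-up of [x] below every entry of that of [y], so
    each crossing of the block removes an inversion. *)
Lemma chain_blk (f g : nat -> nat) j1 a b j2 z1 x y z2 : size j1 = size z1 ->
  f x < f y -> (b == k -> f x < g y) -> (a == k -> g x < f y) ->
  (a == k -> b == k -> g x < g y) ->
  chain (blow f g (j1 ++ b :: a :: j2) (z1 ++ y :: x :: z2))
        (blk (size j1) (j1 ++ a :: b :: j2)) /\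
  actl (rev (blk (size j1) (j1 ++ a :: b :: j2)))
       (blow f g (j1 ++ b :: a :: j2) (z1 ++ y :: x :: z2))
  = blow f g (j1 ++ a :: b :: j2) (z1 ++ x :: y :: z2).
Proof.
move=> sz ff fg gf gg; rewrite -(actl_blk f g a b j2 x y z2 sz).
split; last first.
  by rewrite -{2}[blk _ _]revK actl_revK.
rewrite actl_blk // !blow_cat // blk_cat -(size_blow f g sz) /=.
move: (blow f g j1 z1) (blow f g j2 z2) => s1 s2.
have S0 w : swapl (size s1) (s1 ++ w) = s1 ++ swapl 0 w.
  by rewrite -{1}[size s1]addn0 swapl_catr.
have S1 w : swapl (size s1).+1 (s1 ++ w) = s1 ++ swapl 1 w.
  by rewrite -{1}[(size s1).+1]addn1 swapl_catr.
have S2 w : swapl (size s1).+2 (s1 ++ w) = s1 ++ swapl 2 w.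
  by rewrite -{1}[(size s1).+2]addn2 swapl_catr.
have D0 c1 c2 w : desc (size s1) (s1 ++ c1 :: c2 :: w) = (c2 < c1) := desc_cat _ _ _ _.
have D1 c0 c1 c2 w : desc (size s1).+1 (s1 ++ c0 :: c1 :: c2 :: w) = (c2 < c1).
  by rewrite -cat_rcons -(size_rcons s1 c0) desc_cat.
have D2 c0 c1 c2 c3 w : desc (size s1).+2 (s1 ++ c0 :: c1 :: c2 :: c3 :: w) = (c3 < c2).
  by rewrite -cat_rcons -cat_rcons -(size_rcons s1 c0) -(size_rcons _ c1) desc_cat.
move: fg gf gg.
by case: (a == k); case: (b == k) => fg gf gg; cbn [chain cat];
  rewrite ?(S0, S1, S2, D0, D1, D2); cbn [swapl];
  rewrite ?(S0, S1, S2, D0, D1, D2); cbn [swapl];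
  rewrite ?(S0, S1, S2, D0, D1, D2); cbn [swapl];
  rewrite ?(S0, S1, S2, D0, D1, D2) ?ff ?fg ?gf ?gg.
Qed.

Fixpoint bword u i : seq nat :=
  if u is r :: u' then blk r (actl u' i) ++ bword u' i else [::].

(** The positions, counted from [m], at which the blow-ups of the successive letters begin. *)
Fixpoint poss m i : seq nat :=
  if i is a :: i' then m :: poss (if a == k then m.+2 else m.+1) i' else [::].

Lemma size_poss m i : size (poss m i) = size i.
Proof. by elim: i m => //= a i IH m; rewrite IH. Qed.

Lemma iota_blow m i : iota m (bsize i) = blow id S i (poss m i).
Proof.
rewrite /bsize; elim: i m => //= a i IH m; rewrite -IH.
by case: eqP => _; rewrite ?add0n // addnCA.
Qed.

Lemma poss_ge m i x : x \in poss m i -> m <= x.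
Proof.
elim: i m => //= a i IH m; rewrite inE => /orP[/eqP->//|/IH].
by case: ifP => _ /ltnW // /ltnW.
Qed.

Lemma nth_poss_lt m i q q' : q < q' < size i ->
  nth 0 (poss m i) q < nth 0 (poss m i) q' /\
  (nth k i q == k -> (nth 0 (poss m i) q).+1 < nth 0 (poss m i) q').
Proof.
elim: i m q q' => [|a i IH] m [|q] [|q']; rewrite ?ltn0 ?andbF //=; last first.
  by rewrite !ltnS => /IH.
rewrite ltnS => qi.
have /poss_ge : nth 0 (poss (if a == k then m.+2 else m.+1) i) q' \in
    poss (if a == k then m.+2 else m.+1) i by rewrite mem_nth // size_poss.
by case: ifP => _ le; split=> //; apply: leq_trans le.
Qed.

Lemma uniq_poss m i : uniq (poss m i).
Proof.
elim: i m => //= a i IH m; rewrite IH andbT; apply/negP => /poss_ge.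
by case: ifP => _; lia.
Qed.

Lemma nth_poss_blow (T U : Type) (x0 : T) (y0 : U) f g i s m : size s = size i ->
  forall q, q < size i ->
  nth y0 (blow f g i s) (nth 0 (poss m i) q - m) = f (nth x0 s q) /\
  (nth k i q == k -> nth y0 (blow f g i s) (nth 0 (poss m i) q - m).+1 = g (nth x0 s q)).
Proof.
elim: i s m => //= a i IH [|x s] m //= [sz] [|q] /=.
  by rewrite subnn; case: ifP.
rewrite ltnS => qi; have := IH s (if a == k then m.+2 else m.+1) sz q qi.
have /poss_ge : nth 0 (poss (if a == k then m.+2 else m.+1) i) q \in
    poss (if a == k then m.+2 else m.+1) i by rewrite mem_nth // size_poss.
case: ifP => _; move: (nth 0 _ q) => v le.
  have -> : (v - m) = (v - m.+2).+2 by lia.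
  by [].
have -> : (v - m) = (v - m.+1).+1 by lia.
by [].
Qed.

Section Chains.
Variable i0 : seq 'I_e.
Local Notation m := (size i0).
Local Notation pos q := (nth 0 (poss 0 i0) q).

(** The block permutation induced by [L], where [j] stands for [i0] rearranged by [L]. *)
Definition blow_state j (L : seq nat) := blow (fun q => pos q) (fun q => (pos q).+1) j L.

(** Blowing up preserves reducedness: a descent of [L] becomes a block of descents, because [poss]
    is increasing and leaves room for the second entry of a pair. *)
Lemma chain_bword v L : perm_eq L (iota 0 m) -> chain L v ->
  actl (rev v) L = iota 0 m ->
  let S := blow_state (actl v i0) L in
  chain S (bword v i0) /\ actl (rev (bword v i0)) S = iota 0 (bsize i0).
Proof.
elim: v L => [|r v IHv] L pL /=.
  move=> _ ->; split=> //; rewrite iota_blow /blow_state.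
  rewrite -{3}(mkseq_nth 0 (poss 0 i0)) size_poss blow_map //.
case/andP=> dr cv; rewrite rev_cons -cats1 actl_cat /= => ev.
have pL' : perm_eq (swapl r L) (iota 0 m) := perm_trans (perm_swapl _ _) pL.
have [cS eS] := IHv _ pL' cv ev.
have sL : size (swapl r L) = m by rewrite (perm_size pL') size_iota.
have jL : actl v i0 = map (nth k i0) (swapl r L).
  by rewrite (actlE k) -ev actl_revK.
have sj : size (actl v i0) = m by rewrite size_actl.
have rm : r.+1 < m by rewrite -sL size_swapl (desc_lt dr).
have [z1 [x [y [z2 [Ez z1r]]]]] : exists z1 x y z2, swapl r L = z1 ++ x :: y :: z2 /\ size z1 = r.
  by apply: swapl_split; rewrite sL.
have EL : L = z1 ++ y :: x :: z2 by rewrite -(swaplK r L) Ez -z1r swapl_cat.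
have xy : x < y by move: dr; rewrite EL -z1r desc_cat.
have ym : y < m.
  have : y \in L by rewrite EL mem_cat !inE eqxx orbT.
  by rewrite (perm_mem pL) mem_iota.
rewrite Ez map_cat /= in jL cS eS.
set j1 := map _ z1 in jL; set j2 := map _ z2 in jL.
have szj1 : size j1 = size z1 by rewrite size_map.
have [xy1 xy2] := @nth_poss_lt 0 i0 x y (introT andP (conj xy ym)).
have [||||] := @chain_blk (fun q => pos q) (fun q => (pos q).+1) j1 (nth k i0 x)
  (nth k i0 y) j2 z1 x y z2 szj1 => //; first by move=> _; apply: ltnW.
have -> : j1 ++ [:: nth k i0 y, nth k i0 x & j2] = swapl r (actl v i0).
  by rewrite jL -z1r -szj1 swapl_cat.
rewrite -jL szj1 z1r -EL => c1 e1.
rewrite chain_cat rev_cat actl_cat /blow_state c1 e1.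
exact: conj cS eS.
Qed.

End Chains.

Local Notation k0 := (widen_ord (leqnSn e) k).
Local Notation k1 := (ordS k0).
Local Notation beta := (lift k1).

Lemma val_k1 : val k1 = k.+1.
Proof. by rewrite /= modn_small // ltnS ltn_ord. Qed.

Lemma k0_neq_k1 : k0 != k1.
Proof. by rewrite -val_eqE val_k1 /= ltn_eqF. Qed.

Lemma beta_k : beta k = k0.
Proof. by apply: val_inj; rewrite [LHS]/(bump (val k1) k) val_k1 /bump ltnn. Qed.

Lemma beta_eq_k0 a : (beta a == k0) = (a == k).
Proof. by rewrite -[X in _ == X]beta_k (inj_eq lift_inj). Qed.

Lemma beta_neq_k1 a : (beta a == k1) = false.
Proof. by rewrite eq_sym (negPf (neq_lift _ _)). Qed.

(** Here [lift k1] is the increasing renumbering that misses k+1; it sends k to k. *)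
Definition phis i : seq 'I_e.+1 := blow beta (fun=> k1) i i.

Lemma phis_cat i j : phis (i ++ j) = phis i ++ phis j.
Proof. exact: blow_cat. Qed.

Lemma size_phis i : size (phis i) = bsize i.
Proof. exact: size_blow. Qed.

Lemma phis_cons a i :
  phis (a :: i) = beta a :: (if a == k then k1 :: phis i else phis i).
Proof. by []. Qed.

Lemma count_k1_phis i : count_mem k1 (phis i) = count_mem k i.
Proof.
elim: i => //= a i IH; rewrite beta_neq_k1 add0n.
by case: eqP => _ /=; rewrite ?eqxx IH.
Qed.

Lemma count_beta_phis a i : count_mem (beta a) (phis i) = count_mem a i.
Proof.
elim: i => //= b i IH; rewrite (inj_eq lift_inj); congr (_ + _).
by case: (b == k) => //=; rewrite eq_sym beta_neq_k1.
Qed.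

(** * Block permutations recognised by sums of positions *)

Section Parse.
Variable c : nat -> 'I_e.+1.

Definition sum0 (L : seq nat) := \sum_(x <- L | c x == k0) x.
Definition sum1 (L : seq nat) := \sum_(x <- L | c x == k1) x.

(** A pair k, k+1 carrying entries [x], [y] without descent has [x < y], so it adds at least 1 to
    the difference of [sum1] and [sum0]. If the total equals the number of pairs, then [y = x.+1] in
    every pair. *)
Lemma parse j L : map c L = phis j -> uniq L ->
  (exists2 p, nth k1 (phis j) p = k0 & desc p L) \/
  (sum0 L + count_mem k j <= sum1 L /\
   (sum0 L + count_mem k j = sum1 L ->
    exists2 z, size z = size j & L = blow id S j z)).
Proof.
have k10 : (k1 == k0) = false by rewrite eq_sym (negPf k0_neq_k1).
rewrite /sum0 /sum1; elim: j L => [|a j IH] [|x L] //.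
  by move=> _ _; right; rewrite !big_nil; split=> // _; exists [::].
rewrite phis_cons; case: (eqVneq a k) => [->|ak] /=.
  rewrite beta_k; case: L => [|y L] //= [cx cy cL] /and3P[].
  rewrite inE negb_or => /andP[xy _] _ uL; rewrite !big_cons cx cy k10 !eqxx.
  rewrite (negPf k0_neq_k1).
  have [yx|xley] := ltnP y x; first by left; exists 0.
  have {xy xley} xy : x < y by rewrite ltn_neqAle xy.
  case: (IH L cL uL) => [[p pk dp]|[le eq]]; first by left; exists p.+2.
  right; move: le eq.
  move: (\sum_(x0 <- L | c x0 == k0) x0) (\sum_(x0 <- L | c x0 == k1) x0).
  move: (count_mem k j) => cn s0 s1 le eq; split; first by lia.
  move=> E; have E1 : y = x.+1 by lia.
  have [|z sz ->] := eq _; first by lia.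
  by exists (x :: z); rewrite /= ?sz ?eqxx ?E1.
case=> cx cL /= /andP[_ uL]; rewrite !big_cons cx beta_neq_k1 beta_eq_k0 (negPf ak) add0n.
case: (IH L cL uL) => [[p pk dp]|[le eq]]; first by left; exists p.+1.
right; split=> // /eq[z sz ->].
by exists (x :: z); rewrite /= ?sz ?(negPf ak).
Qed.

Lemma blow_sums j z : size z = size j -> map c (blow id S j z) = phis j ->
  sum0 (blow id S j z) + count_mem k j = sum1 (blow id S j z) /\
  [seq x <- blow id S j z | c x != k1] = z.
Proof.
have k10 : (k1 == k0) = false by rewrite eq_sym (negPf k0_neq_k1).
rewrite /sum0 /sum1; elim: j z => [|a j IH] [|x z] //=; first by rewrite !big_nil.
case=> sz; rewrite !phis_cons; case: (eqVneq a k) => [->|ak] /=.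
  rewrite beta_k => -[cx cy cL]; rewrite !big_cons cx cy k10 !eqxx.
  rewrite !(negPf k0_neq_k1) /=.
  have [E ->] := IH z sz cL; split=> //; rewrite -E.
  by move: (\sum_(_ <- _ | _) _) (count_mem k j) => s0 cn; lia.
case=> cx cL; rewrite !big_cons cx beta_neq_k1 beta_eq_k0 (negPf ak) add0n /=.
by have [E ->] := IH z sz cL.
Qed.

End Parse.

(** The two sums depend only on the set of entries of [L], which is that of the identity, itself a
    blow-up by [iota_blow]. So, in the absence of a descent inside a pair, the extremal case of
    [parse] holds, and the starts of the blocks form a permutation of [poss 0 i0]. *)
Lemma balanced_or_desc i0 j (L : seq nat) :
  perm_eq L (iota 0 (bsize i0)) -> map (nth k1 (phis i0)) L = phis j ->
  (exists2 p, nth k1 (phis j) p = k0 & desc p L) \/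
  exists2 L', perm_eq L' (iota 0 (size i0)) &
    L = blow_state i0 j L' /\ j = map (nth k i0) L'.
Proof.
set c := nth k1 (phis i0) => pL cL.
have uL : uniq L by rewrite (perm_uniq pL) iota_uniq.
case: (parse cL uL) => [|[_ eq]]; first by left.
right.
have ci : map c (blow id S i0 (poss 0 i0)) = phis i0.
  by rewrite -iota_blow -size_phis -/(mkseq _ _) mkseq_nth.
have [E0 F0] := blow_sums (size_poss 0 i0) ci.
have kj : count_mem k j = count_mem k i0.
  rewrite -!count_k1_phis -cL -ci -iota_blow.
  by have /seq.permP := perm_map c pL; apply.
rewrite -iota_blow in E0 F0.
have [|z sz Lz] := eq.
  by rewrite kj /sum0 /sum1 !(perm_big _ pL).
have [_ Fz] := blow_sums sz (etrans (congr1 (map c) (esym Lz)) cL).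
have pz : perm_eq z (poss 0 i0) by rewrite -F0 -Fz -Lz perm_filter.
have zpos : z = map (nth 0 (poss 0 i0)) (map (index^~ (poss 0 i0)) z).
  rewrite -map_comp map_id_in // => x xz /=; rewrite nth_index //.
  by rewrite -(perm_mem pz).
exists (map (index^~ (poss 0 i0)) z).
  have -> : iota 0 (size i0) = map (index^~ (poss 0 i0)) (poss 0 i0).
    rewrite -{2}(mkseq_nth 0 (poss 0 i0)) size_poss -map_comp.
    apply/esym/map_id_in => q /=; rewrite mem_iota /= => qi.
    by rewrite index_uniq ?size_poss ?uniq_poss.
  exact: perm_map.
split; first by rewrite Lz /blow_state {1}zpos blow_map.
apply: (inj_map (@lift_inj _ k1)).
(* Deleting the letters k+1 undoes the blow-up, which recovers [j] from the labels of [L]. *)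
have -> : map beta j = [seq y <- phis j | y != k1].
  elim: (j) => //= a j' IH; rewrite beta_neq_k1 /= IH.
  by case: ifP => _ //=; rewrite eqxx.
rewrite -cL filter_map -[X in _ = map _ (map _ X)]map_id.
have -> : [seq x <- L | (preim c (predC1 k1)) x] = z by rewrite -[RHS]Fz Lz.
rewrite {1}zpos -!map_comp; apply/eq_in_map => x xz /=.
have qi : index x (poss 0 i0) < size i0.
  by rewrite -(size_poss 0 i0) index_mem -(perm_mem pz).
have := @nth_poss_blow 'I_e _ k k1 beta (fun=> k1) i0 i0 0 erefl _ qi.
rewrite subn0 nth_index -?(perm_mem pz) // => -[E _]; exact: E.
Qed.

End Blow.

Local Open Scope ring_scope.

(** * The defining relations of the KLR algebra *)

Lemma rmorph_klrQ (I : finType) (h : I -> I -> nat) (A B : pzRingType)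
    (f : {rmorphism A -> B}) i j u v :
  f (klrQ h i j u v) = klrQ h i j (f u) (f v).
Proof.
by rewrite /klrQ; case: ifP => _; rewrite ?rmorph0 // rmorphM !rmorphXn !rmorphB.
Qed.

Lemma rmorph_eval3 (K : fieldType) (A B : kAlgType K) (f : {rmorphism A -> B})
    (p : {poly {poly {poly K}}}) a b c :
  (forall s : K, f s%:S = s%:S) ->
  f (eval3 p a b c) = eval3 p (f a) (f b) (f c).
Proof.
move=> fS; rewrite /eval3 rmorph_sum; apply: eq_bigr => l _.
rewrite rmorph_sum; apply: eq_bigr => m _; rewrite rmorph_sum.
by apply: eq_bigr => o _; rewrite !rmorphM !rmorphXn fS.
Qed.

Section MorphRelations.
Variables (A B : pzRingType) (f : {rmorphism A -> B}).
Implicit Types a b c d x y z t s e u : A.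

Lemma morph_relM a b c d : f (a * b) = f (c * d) -> f a * f b = f c * f d.
Proof. by rewrite !rmorphM. Qed.

Lemma morph_rel_delta a b c d u (m : nat) :
  f (a * b * u) = f ((c * d + m%:R) * u) ->
  f a * f b * f u = (f c * f d + m%:R) * f u.
Proof. by rewrite !(rmorphM, rmorphD, rmorph_nat). Qed.

Lemma morph_relQ (I : finType) (h : I -> I -> nat) i j t u x y :
  f (t ^+ 2 * u) = f (klrQ h i j x y * u) ->
  f t ^+ 2 * f u = klrQ h i j (f x) (f y) * f u.
Proof. by rewrite !(rmorphM, rmorphXn, rmorph_klrQ). Qed.

Lemma morph_rel_braid (b : bool) t s u a :
  f ((s * t * s - t * s * t) * u) = f (if b then a * u else 0) ->
  (f s * f t * f s - f t * f s * f t) * f u = if b then f a * f u else 0.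
Proof. by case: b; rewrite !(rmorphM, rmorphB, rmorph0). Qed.

End MorphRelations.

Section KLRAlgebra.
Variables (K : fieldType) (I : finType) (h : I -> I -> nat) (alpha : I -> nat).
Local Notation R := (klr K h alpha).
Local Notation n := (weight alpha).
Local Notation Iseq := (Iseq alpha).
Local Notation e := (@klr_e K I h alpha).
Local Notation fgen := (klr_gen alpha).

Definition klr_pr (g : free_alg K fgen) : R :=
  quot_map (ideal_gen (@klr_rel K I h alpha)) g.

Fact klr_pr_zmod : zmod_morphism klr_pr.
Proof. exact: quot_map_zmod. Qed.
Fact klr_pr_monoid : monoid_morphism klr_pr.
Proof. exact: quot_map_monoid. Qed.
HB.instance Definition _ :=
  GRing.isZmodMorphism.Build (free_alg K fgen) R klr_pr klr_pr_zmod.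
HB.instance Definition _ :=
  GRing.isMonoidMorphism.Build (free_alg K fgen) R klr_pr klr_pr_monoid.

Lemma klr_pr_scal c : klr_pr c%:S = c%:S.
Proof. by []. Qed.

Definition klr_x (a : 'I_n) : R := klr_pr (free_x K a).
Definition klr_t (r : 'I_n.-1) : R := klr_pr (free_t K r).
Local Notation x := klr_x.
Local Notation t := klr_t.

Definition iword (w : Iseq) : seq I := val w.

Lemma size_iword w : size (iword w) = n.
Proof. exact: size_tuple. Qed.

Lemma iword_inj : injective iword.
Proof. by move=> v w /val_inj/val_inj. Qed.

Lemma entryE x0 (w : Iseq) a : entry w a = nth x0 (iword w) a.
Proof. exact: tnth_nth. Qed.

Lemma klr_relE g g' : klr_rel h g g' -> klr_pr g = klr_pr g'.
Proof. by move=> /ideal_gen_rel /quot_mapP. Qed.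

Lemma klr_e_sum : \sum_w e w = 1.
Proof.
by have := klr_relE (klr_e1 K h alpha); rewrite (rmorph_sum klr_pr) (rmorph1 klr_pr).
Qed.

Lemma klr_xe_comm a w : x a * e w = e w * x a.
Proof. exact: (morph_relM (f := klr_pr) (klr_relE (klr_xe K h a w))). Qed.

Lemma klr_te_comm r w : t r * e w = e (swap r w) * t r.
Proof. exact: (morph_relM (f := klr_pr) (klr_relE (klr_te K h r w))). Qed.

Lemma klr_x_comm a b : x a * x b = x b * x a.
Proof. exact: (morph_relM (f := klr_pr) (klr_relE (klr_xx K h a b))). Qed.

Lemma klr_tx_snd r w : t r * x (sndp r) * e w =
  (x (fstp r) * t r + (entry w (fstp r) == entry w (sndp r))%:R) * e w.
Proof. exact: (morph_rel_delta (f := klr_pr) (klr_relE (klr_tx2 K h r w))). Qed.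

Lemma klr_snd_tx r w : x (sndp r) * t r * e w =
  (t r * x (fstp r) + (entry w (fstp r) == entry w (sndp r))%:R) * e w.
Proof. exact: (morph_rel_delta (f := klr_pr) (klr_relE (klr_x2t K h r w))). Qed.

Lemma klr_tx_comm r a : a != fstp r -> a != sndp r -> t r * x a = x a * t r.
Proof.
move=> r1 r2; exact: (morph_relM (f := klr_pr) (klr_relE (klr_tx K h r1 r2))).
Qed.

Lemma klr_t_comm (r s : 'I_n.-1) : (r.+1 < s)%N || (s.+1 < r)%N ->
  t r * t s = t s * t r.
Proof.
by move=> rs; exact: (morph_relM (f := klr_pr) (klr_relE (klr_tt K h rs))).
Qed.

Lemma klr_t_sqr r w : t r ^+ 2 * e w =
  klrQ h (entry w (fstp r)) (entry w (sndp r)) (x (fstp r)) (x (sndp r)) * e w.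
Proof. exact: (morph_relQ (f := klr_pr) (klr_relE (klr_t2 K h r w))). Qed.

Lemma klr_t_braid (r s : 'I_n.-1) w : s = r.+1 :> nat ->
  (t s * t r * t s - t r * t s * t r) * e w =
  if entry w (fstp r) == entry w (sndp s)
  then eval3 (klrDQ K h (entry w (fstp r)) (entry w (sndp r)))
             (x (fstp r)) (x (sndp r)) (x (sndp s)) * e w
  else 0.
Proof.
move=> rs.
have E := morph_rel_braid (f := klr_pr) (klr_relE (klr_braid K h w rs)).
by rewrite (rmorph_eval3 _ _ _ _ klr_pr_scal) in E.
Qed.

End KLRAlgebra.

(** * Polynomials in commuting elements *)

Section PolynomialEvaluation.
Variables (K : fieldType) (A : kAlgType K) (n : nat) (x : 'I_n -> A).
Hypothesis xC : forall a b, x a * x b = x b * x a.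
Implicit Types p q : {mpoly K[n]}.

Definition mon_at (m : 'X_{1..n}) : A := \prod_(i < n) x i ^+ m i.
(** The evaluation of a polynomial at commuting elements of a noncommutative algebra; their
    commutation enters through [mon_atD]. *)
Definition poly_at p : A := \sum_(m <- msupp p) (p@_m)%:S * mon_at m.

Lemma poly_atE p k : (msize p <= k)%N ->
  poly_at p = \sum_(m : 'X_{1..n < k}) (p@_m)%:S * mon_at m.
Proof.
move=> le_pk; set J : subFinType _ := 'X_{1..n < k}.
rewrite /poly_at (big_mksub J) ?msupp_uniq //=; first last.
  by move=> m /msize_mdeg_lt /leq_trans; apply.
rewrite big_rmcond //= => j /memN_msupp_eq0 ->.
by rewrite (raddf0 (scal A)) mul0r.
Qed.

Fact poly_at_zmod : zmod_morphism poly_at.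
Proof.
move=> p q; pose k := maxn (maxn (msize p) (msize q)) (msize (p - q)).
rewrite !(@poly_atE _ k) ?leq_max ?leqnn ?orbT // -sumrB.
by apply: eq_bigr => m _; rewrite mcoeffB (raddfB (scal A)) mulrBl.
Qed.
HB.instance Definition _ :=
  GRing.isZmodMorphism.Build {mpoly K[n]} A poly_at poly_at_zmod.

Lemma poly_atZ c p : poly_at (c *: p) = c%:S * poly_at p.
Proof.
rewrite (poly_atE (leqnn (msize p))) mulr_sumr.
have lecp: (msize (c *: p) <= msize p)%N.
  exact: msizeZ_le.
rewrite (poly_atE lecp); apply: eq_bigr => m _.
by rewrite mcoeffZ (rmorphM (scal A)) mulrA.
Qed.

Lemma poly_atX m : poly_at 'X_[m] = mon_at m.
Proof. by rewrite /poly_at msuppX big_seq1 mcoeffX eqxx (rmorph1 (scal A)) mul1r. Qed.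

Lemma mon_at0 : mon_at 0%MM = 1.
Proof. by rewrite /mon_at big1 // => i _; rewrite mnm0E expr0. Qed.

Lemma poly_atC c : poly_at c%:MP = c%:S.
Proof.
by rewrite -[c%:MP]mulr1 mul_mpolyC poly_atZ -mpolyX0 poly_atX mon_at0 mulr1.
Qed.

Lemma poly_at1 : poly_at 1 = 1.
Proof. by rewrite -mpolyC1 poly_atC (rmorph1 (scal A)). Qed.

Lemma mon_atD m1 m2 : mon_at (m1 + m2) = mon_at m1 * mon_at m2.
Proof.
rewrite /mon_at -prodrM_comm => [|i j _ _]; last first.
  by apply: commrX; apply/commr_sym; apply: commrX; exact: xC.
by apply: eq_bigr => i _; rewrite mnmDE exprD.
Qed.

Lemma poly_at_sum (J : Type) (r : seq J) P F :
  poly_at (\sum_(j <- r | P j) F j) = \sum_(j <- r | P j) poly_at (F j).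
Proof. exact: raddf_sum. Qed.

Lemma poly_atD p q : poly_at (p + q) = poly_at p + poly_at q.
Proof. exact: raddfD. Qed.

Lemma poly_atB p q : poly_at (p - q) = poly_at p - poly_at q.
Proof. exact: raddfB. Qed.

Lemma poly_at0 : poly_at 0 = 0.
Proof. exact: raddf0. Qed.

Lemma poly_atM p q : poly_at (p * q) = poly_at p * poly_at q.
Proof.
rewrite {1}[p]mpolyE {1}[q]mpolyE mulr_suml poly_at_sum mulr_suml.
apply: eq_bigr => m1 _; rewrite mulr_sumr poly_at_sum mulr_sumr.
apply: eq_bigr => m2 _; rewrite -scalerAl -scalerAr !poly_atZ -mpolyXD poly_atX.
by rewrite mon_atD !mulrA; congr (_ * _); rewrite -!mulrA -scalC.
Qed.

Lemma poly_atXi a : poly_at 'X_a = x a.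
Proof.
rewrite poly_atX /mon_at (big_only1 a) //= ?mnm1E ?eqxx ?expr1 // => b ba _.
by rewrite mnm1E eq_sym (negPf ba) expr0.
Qed.

End PolynomialEvaluation.

(** * Modules over a presented algebra *)

Module PresentedAction.

Section PresentedModule.
Import monalg.
Variables (K : fieldType) (G : choiceType) (V : lmodType K).
Variable op : G -> V -> V.
Hypothesis op_lin : forall g (c : K) u v, op g (c *: u + v) = c *: op g u + op g v.
Local Notation F := (free_alg K G).
Local Notation M := (fmonom G).

Definition mon_act (m : M) (v : V) : V :=
  foldr op v (fmonom_val m).

Definition free_act (g : F) (v : V) : V :=
  \sum_(m <- msupp g) mcoeff m g *: mon_act m v.

Lemma mon_act_lin m c u v : mon_act m (c *: u + v) = c *: mon_act m u + mon_act m v.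
Proof.
by rewrite /mon_act; elim: (fmonom_val m) => //= g s ->; rewrite op_lin.
Qed.

Lemma free_actEw (d : {fset M}) (g : F) v : (msupp g `<=` d)%fset ->
  free_act g v = \sum_(m <- d) mcoeff m g *: mon_act m v.
Proof.
move=> le; rewrite [LHS](big_fset_incl _ le) => //= m _ /mcoeff_outdom ->.
by rewrite scale0r.
Qed.

Lemma free_actB g1 g2 v : free_act (g1 - g2) v = free_act g1 v - free_act g2 v.
Proof.
pose d := (msupp g1 `|` msupp g2 `|` msupp (g1 - g2))%fset.
rewrite !(@free_actEw d); last 3 first.
- by apply/fsubsetP => m; rewrite !inE => ->; rewrite ?orbT.
- by apply/fsubsetP => m; rewrite !inE => ->; rewrite ?orbT.
- by apply/fsubsetP => m; rewrite !inE => ->; rewrite ?orbT.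
by rewrite -sumrB; apply: eq_bigr => m _; rewrite mcoeffB scalerBl.
Qed.

Definition free_act_at v g := free_act g v.
HB.instance Definition _ v :=
  GRing.isZmodMorphism.Build F V (free_act_at v) (fun g1 g2 => free_actB g1 g2 v).

Lemma free_act_lin g c u v :
  free_act g (c *: u + v) = c *: free_act g u + free_act g v.
Proof.
rewrite /free_act scaler_sumr -big_split; apply: eq_bigr => m _ /=.
by rewrite mon_act_lin scalerDr !scalerA mulrC.
Qed.

HB.instance Definition _ m :=
  GRing.isLinear.Build K V V *:%R (mon_act m) (mon_act_lin m).
HB.instance Definition _ g :=
  GRing.isLinear.Build K V V *:%R (free_act g) (free_act_lin g).

Lemma free_actU c m v : free_act << c *g m >> v = c *: mon_act m v.
Proof.
rewrite (free_actEw _ msuppU_le) big_seq_fset1.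
by rewrite mcoeffUU.
Qed.

Lemma free_actM g1 g2 v : free_act (g1 * g2) v = free_act g1 (free_act g2 v).
Proof.
have actmM (m1 m2 : M) u : mon_act (mmul m1 m2) u = mon_act m1 (mon_act m2 u).
  by rewrite /mon_act fmM foldr_cat.
rewrite malgME -/(free_act_at v _) (raddf_sum (free_act_at v)).
rewrite [RHS]/free_act; apply: eq_bigr => m1 _.
rewrite (raddf_sum (free_act_at v)) linear_sum scaler_sumr.
apply: eq_bigr => m2 _; rewrite linearZ /= scalerA -actmM.
exact: free_actU.
Qed.

Lemma free_act_gen x v : free_act (free_gen K x) v = op x v.
Proof. by rewrite free_actU scale1r /mon_act fmU. Qed.

Lemma free_act_scal c v : free_act c%:S v = c *: v.
Proof. by rewrite free_actU /mon_act fm1. Qed.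

Variable r : F -> F -> Prop.
Hypothesis op_rel : forall g1 g2, r g1 g2 -> free_act g1 =1 free_act g2.

Definition annihilator : F -> bool := fun g => `[< forall v, free_act g v = 0 >].

Fact annihilator_zmod : zmod_closed annihilator.
Proof.
split=> [|g1 g2]; first by apply/asboolP => v; exact: (raddf0 (free_act_at v)).
move=> /asboolP g1P /asboolP g2P; apply/asboolP => v.
by rewrite free_actB g1P g2P subr0.
Qed.
Fact annihilatorMl g1 g2 : g2 \in annihilator -> g1 * g2 \in annihilator.
Proof.
by move=> /asboolP g2P; apply/asboolP => v; rewrite free_actM g2P linear0.
Qed.
Fact annihilatorMr g1 g2 : g2 \in annihilator -> g2 * g1 \in annihilator.
Proof. by move=> /asboolP g2P; apply/asboolP => v; rewrite free_actM g2P. Qed.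

HB.instance Definition _ := GRing.isZmodClosed.Build F annihilator annihilator_zmod.
HB.instance Definition _ := isTwoSided.Build F annihilator annihilatorMl annihilatorMr.

Local Notation P := (presented_alg r).

Definition pres_act (a : P) : V -> V :=
  free_act (repr (a : Quotient.quot (ideal_gen r))).

(** The elements of the free algebra acting by 0 form a two-sided ideal containing the relations,
    hence the ideal generated by them; so the choice of a representative is immaterial. *)
Lemma pres_actE g v : pres_act (quot_map (ideal_gen r) g) v = free_act g v.
Proof.
have relP g1 g2 : r g1 g2 -> g1 - g2 \in annihilator.
  by move=> /op_rel E; apply/asboolP => u; rewrite free_actB E subrr.
have /ideal_gen_predP := quot_map_repr (ideal_gen r) g.
move=> /(_ (TsIdeal.clone F annihilator _) relP) /asboolP /(_ v).
by move=> /eqP; rewrite free_actB subr_eq0 => /eqP.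
Qed.

Lemma pres_actB a b v : pres_act (a - b) v = pres_act a v - pres_act b v.
Proof.
rewrite -[a]quot_mapK -[b]quot_mapK -(rmorphB (quot_map _)) !pres_actE.
exact: free_actB.
Qed.

Lemma pres_actM a b v : pres_act (a * b) v = pres_act a (pres_act b v).
Proof.
rewrite -[a]quot_mapK -[b]quot_mapK -(rmorphM (quot_map _)) !pres_actE.
exact: free_actM.
Qed.

Lemma pres_act_gen x v : pres_act (presented_gen r x) v = op x v.
Proof. by rewrite pres_actE free_act_gen. Qed.

Lemma pres_act_scal c v : pres_act c%:S v = c *: v.
Proof. by rewrite -quot_map_scal pres_actE free_act_scal. Qed.

End PresentedModule.

Section PresentedInduction.
Import monalg.
Variables (K : fieldType) (G : choiceType) (r : free_alg K G -> free_alg K G -> Prop).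
Local Notation P := (presented_alg r).

(** Every element is a linear combination of words, and a word arises from 1 by left
    multiplications. *)
Lemma presented_ind (Q : P -> Prop) :
  Q 1 -> (forall a b, Q a -> Q b -> Q (a + b)) ->
  (forall c a, Q a -> Q (c%:S * a)) ->
  (forall x a, Q a -> Q (presented_gen r x * a)) -> forall a, Q a.
Proof.
move=> Q1 QD QZ Qg a; rewrite -[a]quot_mapK; move: (repr _) => g.
have Q0 : Q 0 by have := QZ 0 1 Q1; rewrite raddf0 mul0r.
pose f := quot_map (ideal_gen r).
have fM (a b : free_alg K G) : f (a * b) = f a * f b := rmorphM f a b.
have gE : g = \sum_(m <- msupp g) (<< mcoeff m g *g m >> : free_alg K G) :=
  monalgE g.
have fS (F : _ -> free_alg K G) :
  f (\sum_(m <- msupp g) F m) = \sum_(m <- msupp g) f (F m) :=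
  raddf_sum f _ _ _.
rewrite -/(f g) {1}gE fS big_seq.
elim/big_ind: _ => // m _; set c := mcoeff m g.
have -> : << c *g m >> = (c%:S : free_alg K G) * << m >> :> free_alg K G.
  by rewrite /GRing.mul /= fgmulUU mul1m mulr1.
rewrite (fM (c%:S) << m >>); apply: QZ.
case: m {c} => s; elim: s => [|x s IHs].
  by rewrite -fmoneE; have -> : f << fmone G >> = 1 by exact: (rmorph1 f).
have -> : << FMonom (x :: s) >> = free_gen K x * << FMonom s >> :> free_alg K G.
  by rewrite /GRing.mul /= /free_gen fgmulUU mulr1 fmuE /mmul /= fmmulE.
by rewrite (fM (free_gen K x) << FMonom s >>); apply: Qg.
Qed.
End PresentedInduction.

End PresentedAction.
Import PresentedAction.

(** * Reduction of words in the tau's to normal form *)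

Section WordAction.
Variables (I : finType) (alpha : I -> nat).
Local Notation n := (weight alpha).
Local Notation Iseq := (Iseq alpha).

Definition swapn (r : nat) (w : Iseq) : Iseq :=
  if insub r is Some r' then swap r' w else w.

Lemma iword_swap (r : 'I_n.-1) (w : Iseq) : iword (swap r w) = swapl r (iword w).
Proof.
have sr := sndp_subproof r.
have x0 : I := entry w (sndp r).
apply: (@eq_from_nth _ x0) => [|q]; rewrite ?size_swapl !size_iword // => qn.
rewrite nth_swapl ?size_iword // -(entryE x0 (swap r w) (Ordinal qn)).
rewrite /entry /= tnth_mktuple -/(entry w _) (entryE x0); congr (nth _ _ _).
rewrite /sw; case: tpermP => [/(congr1 val)|/(congr1 val)|] /=; rewrite ?eqxx //.
- by move=> ->; rewrite eqxx.
- by move=> ->; rewrite eqxx (gtn_eqF (ltnSn r)).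
by move=> /eqP + /eqP; rewrite -!val_eqE /= => /negPf -> /negPf ->.
Qed.

Lemma iword_swapn r w : iword (swapn r w) = swapl r (iword w).
Proof.
rewrite /swapn; case: insubP => [r' _ <-|]; first exact: iword_swap.
rewrite -leqNgt => nr; rewrite swapl_oob // size_iword.
by case: n nr.
Qed.

Definition actn u w := foldr swapn w u.

Lemma iword_actn u w : iword (actn u w) = actl u (iword w).
Proof. by elim: u => //= r u IHu; rewrite iword_swapn IHu. Qed.

Lemma swapnK r : involutive (swapn r).
Proof. by move=> w; apply: iword_inj; rewrite !iword_swapn swaplK. Qed.

Lemma actn_cat u v w : actn (u ++ v) w = actn u (actn v w).
Proof. exact: foldr_cat. Qed.

End WordAction.

Section System.
Variables (K : fieldType) (I : finType) (alpha : I -> nat) (A : kAlgType K).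
Local Notation n := (weight alpha).
Local Notation Iseq := (Iseq alpha).
Variables (e : Iseq -> A) (x : 'I_n -> A) (t : nat -> A).

(* The part of the KLR relations that the spanning argument needs: the quadratic
   and braid relations only matter up to polynomials in the x_a. *)
Record klr_system : Prop := KLRSystem {
  sys_ee : forall v w, e v * e w = if v == w then e v else 0;
  sys_e1 : \sum_w e w = 1;
  sys_xe : forall a w, x a * e w = e w * x a;
  sys_te : forall r w, t r * e w = e (swapn r w) * t r;
  sys_xx : forall a b, x a * x b = x b * x a;
  sys_xt : forall a r, exists b (c : Iseq -> K),
    x a * t r = t r * x b + \sum_w (c w)%:S * e w;
  sys_t0 : forall r, (n <= r.+1)%N -> t r = 0;
  sys_tt : forall r s, (r.+1 < s)%N -> t r * t s = t s * t r;
  sys_t2 : forall r w, exists q, t r * t r * e w = poly_at x q * e w;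
  sys_braid : forall r w, exists q,
    t r.+1 * t r * t r.+1 * e w = t r * t r.+1 * t r * e w + poly_at x q * e w;
  sys_ind : forall P : A -> Prop,
    P 1 -> (forall a b, P a -> P b -> P (a + b)) ->
    (forall c a, P a -> P (c%:S * a)) -> (forall w a, P a -> P (e w * a)) ->
    (forall i a, P a -> P (x i * a)) -> (forall r a, P a -> P (t r * a)) ->
    forall a, P a
}.

Definition tword u : A := foldr (fun r a => t r * a) 1 u.

Lemma tword_cat u v : tword (u ++ v) = tword u * tword v.
Proof. by elim: u => [|r u IHu] /=; rewrite ?mul1r // IHu mulrA. Qed.

Definition nelt u (p : {mpoly K[n]}) w : A := tword u * poly_at x p * e w.

(** The length filtration with a strict bound: [fil (size u)] means modulo words shorter than [u],
    and [fil 0] contains only 0. *)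
Inductive fil (l : nat) : A -> Prop :=
| fil0 : fil l 0
| filD u p w a : (size u < l)%N -> fil l a -> fil l (nelt u p w + a).

Hypothesis sys : klr_system.

Let xx := sys_xx sys.

Lemma fil_nelt l u p w : (size u < l)%N -> fil l (nelt u p w).
Proof. by move=> ul; rewrite -[nelt _ _ _]addr0; apply: filD => //; apply: fil0. Qed.

Lemma fil_add l a b : fil l a -> fil l b -> fil l (a + b).
Proof.
elim=> [|u p w {}a ul _ IH] fb; first by rewrite add0r.
by rewrite -addrA; apply: filD => //; apply: IH.
Qed.

Lemma fil_sum l (J : Type) (s : seq J) (P : pred J) F :
  (forall j, P j -> fil l (F j)) -> fil l (\sum_(j <- s | P j) F j).
Proof.
by move=> fF; elim/big_ind: _ => //; [apply: fil0 | apply: fil_add].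
Qed.

Lemma fil_leq l l' a : (l <= l')%N -> fil l a -> fil l' a.
Proof.
move=> ll'; elim=> [|u p w {}a ul _ IH]; first exact: fil0.
by apply: filD => //; apply: leq_trans ll'.
Qed.

Lemma fil_map l l' (f : A -> A) :
  f 0 = 0 -> {morph f : a b / a + b} ->
  (forall u p w, (size u < l)%N -> fil l' (f (nelt u p w))) ->
  forall a, fil l a -> fil l' (f a).
Proof.
move=> f0 fD ff a; elim=> [|u p w {}a ul _ IH]; first by rewrite f0; apply: fil0.
by rewrite fD; apply: fil_add => //; apply: ff.
Qed.

Lemma fil_t l r a : fil l a -> fil l.+1 (t r * a).
Proof.
apply: (@fil_map l l.+1 ( *%R (t r))) => [|b c|u p w ul]; first exact: mulr0.
  exact: mulrDr.
have -> : t r * nelt u p w = nelt (r :: u) p w by rewrite /nelt /= !mulrA.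
exact: fil_nelt.
Qed.

Lemma fil_tword l u a : fil l a -> fil (size u + l) (tword u * a).
Proof.
by move=> fa; elim: u => [|r u IHu] /=; rewrite ?mul1r // -mulrA; apply: fil_t.
Qed.

Lemma scal_tword c u : c%:S * tword u = tword u * c%:S.
Proof. exact: scalC. Qed.

Lemma fil_scal l c a : fil l a -> fil l (c%:S * a).
Proof.
apply: (@fil_map l l ( *%R c%:S)) => [|b d|u p w ul]; first exact: mulr0.
  exact: mulrDr.
have -> : c%:S * nelt u p w = nelt u (c *: p) w.
  by rewrite /nelt poly_atZ !mulrA scal_tword.
exact: fil_nelt.
Qed.

Lemma tword_e u w : tword u * e w = e (actn u w) * tword u.
Proof.
elim: u => [|r u IHu] /=; first by rewrite mul1r mulr1.
by rewrite -mulrA IHu mulrA (sys_te sys) mulrA.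
Qed.

Lemma mon_at_e m w : mon_at x m * e w = e w * mon_at x m.
Proof.
by apply/commr_sym; apply: commr_prod => a _; apply: commrX;
   apply/commr_sym; apply: sys_xe.
Qed.

Lemma poly_at_e p w : poly_at x p * e w = e w * poly_at x p.
Proof.
rewrite /poly_at mulr_suml mulr_sumr; apply: eq_bigr => m _.
by rewrite -mulrA mon_at_e mulrA scalC mulrA.
Qed.

Lemma e_nelt v u p w :
  e v * nelt u p w = if v == actn u w then nelt u p w else 0.
Proof.
have E : nelt u p w = e (actn u w) * nelt u p w.
  rewrite {1}/nelt -mulrA poly_at_e -{1}[e w](_ : e w * e w = _); last first.
    by rewrite (sys_ee sys) eqxx.
  by rewrite -mulrA -poly_at_e mulrA tword_e -!mulrA /nelt -mulrA poly_at_e.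
by rewrite E mulrA (sys_ee sys); case: eqVneq => [->//|_]; rewrite mul0r.
Qed.

Lemma fil_e l w a : fil l a -> fil l (e w * a).
Proof.
apply: (@fil_map l l ( *%R (e w))) => [|b d|u p v ul]; first exact: mulr0.
  exact: mulrDr.
by rewrite e_nelt; case: ifP => _; [apply: fil_nelt | apply: fil0].
Qed.

(** A variable moved to the right through a tau becomes another variable, up to a combination of
    idempotents replacing that tau; this correction has a shorter word. *)
Lemma fil_x l i a : fil l a -> fil l (x i * a).
Proof.
apply: (@fil_map l l ( *%R (x i))) => [|b d|u p w ul]; first exact: mulr0.
  exact: mulrDr.
apply: (@fil_leq (size u).+1) => // {ul}.
elim: u i => [|r u IHu] i.
  have -> : x i * nelt [::] p w = nelt [::] ('X_i * p) w.
    by rewrite /nelt poly_atM // poly_atXi // !mul1r mulrA.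
  exact: fil_nelt.
have -> : nelt (r :: u) p w = t r * nelt u p w by rewrite /nelt /= !mulrA.
have [j [c E]] := sys_xt sys i r.
rewrite mulrA E mulrDl -mulrA; apply: fil_add; first exact: fil_t.
rewrite mulr_suml; apply: fil_sum => v _; rewrite -mulrA; apply: fil_scal.
by apply: fil_e; apply: fil_nelt; rewrite ltnW.
Qed.

Lemma fil_polyl l p a : fil l a -> fil l (poly_at x p * a).
Proof.
move=> fa; rewrite /poly_at mulr_suml; apply: fil_sum => m _.
rewrite -mulrA; apply: fil_scal; rewrite /mon_at.
elim/big_rec: _ => [|i y _ IH]; first by rewrite mul1r.
elim: (m i) => [|k IHk]; first by rewrite expr0 mul1r.
by rewrite exprS -!mulrA; apply: fil_x; rewrite mulrA.
Qed.

Lemma fil_polyr l p a : fil l a -> fil l (a * poly_at x p).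
Proof.
apply: (@fil_map l l ( *%R^~ (poly_at x p))) => [|b d|u q w ul].
- exact: mul0r.
- exact: mulrDl.
have -> : nelt u q w * poly_at x p = nelt u (q * p) w.
  by rewrite /nelt -[_ * _ * e w]mulrA -!mulrA -poly_at_e poly_atM // !mulrA.
exact: fil_nelt.
Qed.

Lemma fil_all a : exists l, fil l a.
Proof.
apply: (sys_ind sys (P := fun a => exists l, fil l a)) a => [|a b|c a|w a|i a|r a].
- exists 1%N; rewrite -(sys_e1 sys); apply: fil_sum => w _.
  have -> : e w = nelt [::] 1 w by rewrite /nelt poly_at1 !mul1r.
  exact: fil_nelt.
- case=> la fa [lb fb]; exists (maxn la lb).
  by apply: fil_add; [apply: fil_leq fa | apply: fil_leq fb];
    rewrite leq_max leqnn ?orbT.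
- by case=> l fa; exists l; apply: fil_scal.
- by case=> l fa; exists l; apply: fil_e.
- by case=> l fa; exists l; apply: fil_x.
- by case=> l fa; exists l.+1; apply: fil_t.
Qed.

Definition st u := actl u (iota 0 n).

Lemma size_st u : size (st u) = n.
Proof. by rewrite size_actl size_iota. Qed.

Lemma sys_braid_adj r s w : (r == s.+1) || (s == r.+1) -> exists q,
  t s * t r * t s * e w = t r * t s * t r * e w + poly_at x q * e w.
Proof.
case/orP=> /eqP ->; last exact: (sys_braid sys).
have [q E] := sys_braid sys s w; exists (- q).
by rewrite E (raddfN (poly_at x)) mulNr addrK.
Qed.

(* A descent at r of the permutation of a word lets one move the letter r to the
   front, unless the word is not reduced: both up to shorter words. *)
Lemma exchange u w r : desc r (st u) ->
  fil (size u) (tword u * e w) \/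
  exists v, [/\ size u = (size v).+1, st v = swapl r (st u) &
               fil (size u) (tword u * e w - tword (r :: v) * e w)].
Proof.
have [m] := ubnP (size u); elim: m u r => // m IHm [|s v] r; rewrite ltnS => /= um.
  by move=> dr; have := inv_desc dr; rewrite inv_iota.
have [ns|sn] := leqP n s.+1.
  by move=> _; left; rewrite (sys_t0 sys ns) !mul0r; apply: fil0.
have fil_step b : fil (size v) b -> fil (size v).+1 (t s * b) := @fil_t _ s b.
have szv : (s.+1 < size (st v))%N by rewrite size_st.
rewrite -/(st v) => dr; case: (eqVneq s r) => [sr|sr].
  right; exists v; rewrite sr swaplK; split=> //.
  by rewrite subrr; apply: fil0.
have [far|near] := boolP ((r.+1 < s)%N || (s.+1 < r)%N).
  rewrite desc_far // in dr.
  case: (IHm v r um dr) => [fv|[v' [sv stv fv]]].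
    by left; rewrite -mulrA; apply: fil_step.
  right; exists (s :: v'); split; rewrite /= ?sv //.
    rewrite -/(st v') stv.
    by case/orP: far => /swaplC ->.
  have tC : t s * t r = t r * t s.
    by case/orP: far => /(sys_tt sys) ->.
  rewrite [t r * _]mulrA -tC -!mulrA -mulrBr; apply: fil_leq (fil_step _ _).
    by rewrite sv.
  by rewrite mulrA.
have adj : (r == s.+1) || (s == r.+1).
  by move: near sr; lia.
(* If [s] is already a descent of [v], the word is not reduced: moving [s] to the front of [v]
   creates the square [t s * t s], a polynomial by the quadratic relation. *)
have [ds|nds] := boolP (desc s (st v)).
  case: (IHm v s um ds) => [fv|[v' [sv stv fv]]].
    by left; rewrite -mulrA; apply: fil_step.
  left; have [q E] := sys_t2 sys s (actn v' w).
  have -> : t s * tword v * e w =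
    t s * (tword v * e w - tword (s :: v') * e w) + poly_at x q * (tword v' * e w).
    have -> : poly_at x q * (tword v' * e w) = t s * (t s * (tword v' * e w)).
      by rewrite tword_e !mulrA E.
    by rewrite mulrBr /= -!mulrA subrK.
  apply: fil_add; first exact: fil_step.
  apply: fil_polyl; have -> : tword v' * e w = nelt v' 1 w.
    by rewrite /nelt poly_at1 mulr1.
  by apply: fil_nelt; rewrite sv ltnW.
(* Braid case: bringing [r] and then [s] forward turns the word into [s :: r :: s :: v''], which is
   exchanged for [r :: s :: r :: v''] up to a polynomial times the shorter word [v'']. *)
case/andP: (desc_adj adj szv dr nds) => drv dsv.
case: (IHm v r um drv) => [fv|[v' [sv stv fv]]].
  by left; rewrite -mulrA; apply: fil_step.
rewrite -stv in dsv.
have um' : (size v' < m)%N by apply: leq_trans um; rewrite sv.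
case: (IHm v' s um' dsv) => [fv'|[v'' [sv' stv' fv']]].
  left; have -> : t s * tword v * e w =
     t s * (tword v * e w - tword (r :: v') * e w) + t s * (t r * (tword v' * e w)).
    by rewrite mulrBr /= -!mulrA subrK.
  apply: fil_add; first exact: fil_step.
  by rewrite sv; do 2 apply: fil_t.
right; exists (s :: r :: v''); split; rewrite /= ?sv ?sv' //.
  rewrite -/(st v'') stv' stv.
  have swE : swapl r (swapl s (swapl r (st v))) = swapl s (swapl r (swapl s (st v))).
    by case/orP: (adj) sn dr => /eqP -> sn /desc_lt;
       rewrite size_swapl size_st => nr; rewrite swapl_braid // size_st //.
  by rewrite swE !swaplK.
have [q E] := sys_braid_adj (actn v'' w) adj.
have -> : t s * tword v * e w - t r * (t s * (t r * tword v'')) * e w =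
    t s * (tword v * e w - tword (r :: v') * e w)
    + t s * (t r * (tword v' * e w - tword (s :: v'') * e w))
    + poly_at x q * (tword v'' * e w).
  have -> : poly_at x q * (tword v'' * e w) =
      t s * (t r * (t s * (tword v'' * e w))) - t r * (t s * (t r * (tword v'' * e w))).
    by rewrite tword_e !mulrA E mulrDl addrAC subrr add0r.
  by rewrite !mulrBr /= -!mulrA !addrA !subrK.
apply: fil_add; first apply: fil_add.
- by rewrite -sv' -sv; apply: fil_step.
- by rewrite -sv'; do 2 apply: fil_t.
- apply: fil_polyl; have -> : tword v'' * e w = nelt v'' 1 w.
    by rewrite /nelt poly_at1 mulr1.
  by apply: fil_nelt; rewrite ltnW.
Qed.

Lemma exchanges u w v : chain (st u) v ->
  fil (size u) (tword u * e w) \/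
  exists u', [/\ size u = (size v + size u')%N, st u' = actl (rev v) (st u) &
                fil (size u) (tword u * e w - tword (v ++ u') * e w)].
Proof.
elim: v u => [|r v IHv] u /=.
  by move=> _; right; exists u; rewrite subrr; split=> //; apply: fil0.
case/andP=> dr; case: (exchange w dr) => [fu _|[u1 [su1 stu1 fu1]]]; first by left.
rewrite -stu1 => /IHv[fu|[u2 [su2 stu2 fu2]]].
  left; rewrite -[X in fil _ X](subrK (tword (r :: u1) * e w)).
  by apply: fil_add => //; rewrite su1 /= -mulrA; apply: fil_t.
right; exists u2; rewrite su1 su2 rev_cons -cats1 actl_cat; split=> //.
  by rewrite stu2 stu1.
rewrite -(subrKA (tword (r :: u1) * e w)); apply: fil_add; first by rewrite -su2 -su1.
by rewrite -su2 /= -!mulrA -mulrBr; apply: fil_t.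
Qed.

(** After its first letter [r], the rest of the word has the permutation of the transposition [r];
    bringing [r] to the front of that rest produces a square, which is a polynomial. *)
Lemma fil_id u w : st u = iota 0 n -> (0 < size u)%N -> fil (size u) (tword u * e w).
Proof.
case: u => //= r u su _; have [nr|rn] := leqP n r.+1.
  by rewrite (sys_t0 sys nr) !mul0r; apply: fil0.
have stu : st u = swapl r (iota 0 n) by rewrite -su swaplK.
have dr : desc r (st u).
  rewrite stu /desc size_swapl size_iota rn /= !nth_swapl ?size_iota // /sw.
  by rewrite (gtn_eqF (ltnSn r)) !eqxx !nth_iota ?(ltnW rn).
rewrite -mulrA; case: (exchange w dr) => [fu|[v [sv stv fv]]]; first exact: fil_t.
rewrite -(subrK (tword (r :: v) * e w) (tword u * e w)) mulrDr.
apply: fil_add; first exact: fil_t.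
have [q E] := sys_t2 sys r (actn v w).
rewrite /= -mulrA tword_e !mulrA E -mulrA -tword_e; apply: fil_polyl.
have -> : tword v * e w = nelt v 1 w by rewrite /nelt poly_at1 mulr1.
by apply: fil_nelt; rewrite sv ltnW.
Qed.

(** Exchanging all letters of the reduced word [v] to the front leaves a remainder with trivial
    permutation: it is empty, or [fil_id] shortens it. *)
Lemma fil_reduce u w v : chain (st u) v -> actl (rev v) (st u) = iota 0 n ->
  fil (size u) (tword u * e w) \/ fil (size u) (tword u * e w - tword v * e w).
Proof.
move=> cv ev; case: (exchanges w cv) => [|[u' [su stu fu]]]; first by left.
case: u' => [|r u'] in su stu fu; first by rewrite cats0 in fu; right.
left; rewrite -(subrK (tword (v ++ r :: u') * e w) (tword u * e w)).
apply: fil_add => //; rewrite tword_cat -mulrA su; apply: fil_tword.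
by apply: fil_id => //; rewrite stu ev.
Qed.

End System.

Section PolynomialElements.
Variables (K : fieldType) (A : kAlgType K) (n : nat) (x : 'I_n -> A).
Hypothesis xC : forall a b, x a * x b = x b * x a.

Definition polynomial_in (a : A) := exists p, a = poly_at x p.

Lemma polynomial_in_x i : polynomial_in (x i).
Proof. by exists 'X_i; rewrite poly_atXi. Qed.

Lemma polynomial_in_scal c : polynomial_in c%:S.
Proof. by exists c%:MP; rewrite poly_atC. Qed.

Lemma polynomial_in1 : polynomial_in 1.
Proof. by exists 1; rewrite poly_at1. Qed.

Lemma polynomial_in0 : polynomial_in 0.
Proof. by exists 0; rewrite poly_at0. Qed.

Lemma polynomial_inB a b :
  polynomial_in a -> polynomial_in b -> polynomial_in (a - b).
Proof. by move=> [p ->] [q ->]; exists (p - q); rewrite poly_atB. Qed.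

Lemma polynomial_inM a b :
  polynomial_in a -> polynomial_in b -> polynomial_in (a * b).
Proof. by move=> [p ->] [q ->]; exists (p * q); rewrite poly_atM. Qed.

Lemma polynomial_inX a m : polynomial_in a -> polynomial_in (a ^+ m).
Proof.
move=> pa; elim: m => [|m IHm]; first exact: polynomial_in1.
by rewrite exprS; apply: polynomial_inM.
Qed.

Lemma polynomial_in_sum (J : Type) (s : seq J) F :
  (forall j, polynomial_in (F j)) -> polynomial_in (\sum_(j <- s) F j).
Proof.
move=> pF; elim/big_ind: _ => // [|_ _ [p ->] [q ->]].
  exact: polynomial_in0.
by exists (p + q); rewrite poly_atD.
Qed.

Lemma polynomial_in_klrQ (I : finType) (h : I -> I -> nat) i j u v :
  polynomial_in u -> polynomial_in v -> polynomial_in (klrQ h i j u v).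
Proof.
move=> pu pv; rewrite /klrQ; case: ifP => _; first exact: polynomial_in0.
by apply: polynomial_inM; apply: polynomial_inX; apply: polynomial_inB.
Qed.

Lemma polynomial_in_eval3 p a b c :
  polynomial_in a -> polynomial_in b -> polynomial_in c ->
  polynomial_in (eval3 p a b c).
Proof.
move=> pa pb pc; apply: polynomial_in_sum => l; apply: polynomial_in_sum => m.
apply: polynomial_in_sum => o; apply: polynomial_inM; first exact: polynomial_in_scal.
by do 2?apply: polynomial_inM; apply: polynomial_inX.
Qed.

End PolynomialElements.

Section Relations.
Variables (K : fieldType) (I : finType) (h : I -> I -> nat) (alpha : I -> nat).
Local Notation n := (weight alpha).
Local Notation Iseq := (Iseq alpha).

Section Abstract.
Variables (A : kAlgType K) (e : Iseq -> A) (x : 'I_n -> A) (t : 'I_n.-1 -> A).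

Record klr_relations : Prop := KLRRelations {
  rel_ee : forall v w, e v * e w = if v == w then e v else 0;
  rel_e1 : \sum_w e w = 1;
  rel_xe : forall a w, x a * e w = e w * x a;
  rel_te : forall r w, t r * e w = e (swap r w) * t r;
  rel_xx : forall a b, x a * x b = x b * x a;
  rel_tx_snd : forall r w, t r * x (sndp r) * e w =
    (x (fstp r) * t r + (entry w (fstp r) == entry w (sndp r))%:R) * e w;
  rel_snd_tx : forall r w, x (sndp r) * t r * e w =
    (t r * x (fstp r) + (entry w (fstp r) == entry w (sndp r))%:R) * e w;
  rel_tx : forall r a, a != fstp r -> a != sndp r -> t r * x a = x a * t r;
  rel_tt : forall r s : 'I_n.-1, (r.+1 < s)%N || (s.+1 < r)%N ->
    t r * t s = t s * t r;
  rel_t2 : forall r w, t r ^+ 2 * e w =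
    klrQ h (entry w (fstp r)) (entry w (sndp r)) (x (fstp r)) (x (sndp r)) * e w;
  rel_braid : forall (r s : 'I_n.-1) w, s = r.+1 :> nat ->
    (t s * t r * t s - t r * t s * t r) * e w =
    if entry w (fstp r) == entry w (sndp s)
    then eval3 (klrDQ K h (entry w (fstp r)) (entry w (sndp r)))
               (x (fstp r)) (x (sndp r)) (x (sndp s)) * e w
    else 0;
  rel_ind : forall P : A -> Prop,
    P 1 -> (forall a b, P a -> P b -> P (a + b)) ->
    (forall c a, P a -> P (c%:S * a)) -> (forall w a, P a -> P (e w * a)) ->
    (forall i a, P a -> P (x i * a)) -> (forall r a, P a -> P (t r * a)) ->
    forall a, P a
}.

(** Out of range tau is 0 whereas [swapn] is the identity; with these conventions the relations of
    [klr_system] hold for all natural numbers. *)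
Definition extend_t (r : nat) : A := if insub r is Some r' then t r' else 0.
Local Notation tn := extend_t.

Lemma extend_tE (r : 'I_n.-1) : tn r = t r.
Proof. by rewrite /extend_t valK. Qed.

Lemma extend_t_oob r : (n <= r.+1)%N -> tn r = 0.
Proof.
by move=> nr; rewrite /extend_t insubF //; apply/negbTE; rewrite -leqNgt; case: n nr.
Qed.

Lemma ord_pred_weight r : (r.+1 < n)%N -> exists r' : 'I_n.-1, r = r'.
Proof. by move=> rn; have rn' : (r < n.-1)%N by [lia]; exists (Ordinal rn'). Qed.

Lemma swapnE (r : 'I_n.-1) (w : Iseq) : swapn r w = swap r w.
Proof. by rewrite /swapn valK. Qed.

Hypothesis rel : klr_relations.

Lemma mulr_e_sum (a b : A) : (forall w, a * e w = b * e w) -> a = b.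
Proof.
move=> ab; rewrite -[a]mulr1 -[b]mulr1 -(rel_e1 rel) !mulr_sumr.
exact: eq_bigr.
Qed.

Lemma x_extend_t a r : exists b (c : Iseq -> K),
  x a * tn r = tn r * x b + \sum_w (c w)%:S * e w.
Proof.
have [nr|/ord_pred_weight[{}r ->]] := leqP n r.+1.
  exists a, (fun=> 0); rewrite extend_t_oob // mul0r mulr0 add0r big1 // => w _.
  by rewrite (raddf0 (scal A)) mul0r.
rewrite extend_tE.
pose delta w := entry w (fstp r) == entry w (sndp r).
have sumE (c : Iseq -> K) w : (\sum_v (c v)%:S * e v) * e w = (c w)%:S * e w.
  rewrite mulr_suml (bigD1 w) //= -mulrA (rel_ee rel) eqxx big1 ?addr0 // => v vw.
  by rewrite -mulrA (rel_ee rel) (negPf vw) mulr0.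
case: (eqVneq a (fstp r)) => [->|a1].
  exists (sndp r), (fun w => - (delta w)%:R); apply: mulr_e_sum => w.
  rewrite mulrDl (rel_tx_snd rel) sumE (rmorphN (scal A)) (rmorph_nat (scal A)).
  by rewrite mulrDl mulNr addrK.
case: (eqVneq a (sndp r)) => [->|a2].
  exists (fstp r), (fun w => (delta w)%:R); apply: mulr_e_sum => w.
  by rewrite (rel_snd_tx rel) !mulrDl sumE (rmorph_nat (scal A)).
exists a, (fun=> 0); rewrite (rel_tx rel) // big1 ?addr0 // => w _.
by rewrite (raddf0 (scal A)) mul0r.
Qed.

Lemma klr_relations_system : klr_system e x tn.
Proof.
have xC := rel_xx rel.
have px := @polynomial_in_x K A n x.
split=> //.
- exact: rel_ee.
- exact: rel_e1.
- exact: rel_xe.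
- move=> r w; have [nr|/ord_pred_weight[{}r ->]] := leqP n r.+1.
    by rewrite extend_t_oob // mul0r mulr0.
  by rewrite extend_tE swapnE (rel_te rel).
- exact: x_extend_t.
- exact: extend_t_oob.
- move=> r s rs; have [ns|sn] := leqP n s.+1.
    by rewrite (extend_t_oob ns) mul0r mulr0.
  have rn : (r.+1 < n)%N by lia.
  case: (ord_pred_weight sn) rs => s' -> ; case: (ord_pred_weight rn) => r' -> rs.
  by rewrite !extend_tE (rel_tt rel) ?rs.
- move=> r w; have [nr|/ord_pred_weight[{}r ->]] := leqP n r.+1.
    by exists 0; rewrite extend_t_oob // poly_at0 !mul0r.
  rewrite extend_tE -expr2 (rel_t2 rel).
  by have [q ->] := polynomial_in_klrQ xC h (entry w (fstp r)) (entry w (sndp r))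
    (px (fstp r)) (px (sndp r)); exists q.
- move=> r w; have [nr|] := leqP n r.+2.
    by exists 0; rewrite (extend_t_oob nr) poly_at0 !(mul0r, mulr0) addr0.
  move=> rn; have rn' : (r.+1 < n)%N by lia.
  case: (ord_pred_weight rn') => r' E; case: (ord_pred_weight rn) => s' E'.
  have rs : s' = r'.+1 :> nat by rewrite -E' -E.
  have := rel_braid rel w rs; rewrite E' E !extend_tE mulrBl.
  case: ifP => _ B; last first.
    exists 0; rewrite poly_at0 mul0r addr0; apply/eqP; rewrite -subr_eq0.
    exact/eqP.
  have [q Eq] := polynomial_in_eval3 xC
    (klrDQ K h (entry w (fstp r')) (entry w (sndp r')))
    (px (fstp r')) (px (sndp r')) (px (sndp s')).
  by exists q; rewrite -Eq -B addrC subrK.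
- move=> P P1 PD PZ Pe Px Pt; apply: (rel_ind rel) => // r b Pb.
  by have := Pt r b Pb; rewrite extend_tE.
Qed.

End Abstract.

Local Notation R := (klr K h alpha).
Local Notation e := (@klr_e K I h alpha).
Local Notation x := (@klr_x K I h alpha).
Local Notation t := (@klr_t K I h alpha).

Lemma klr_klr_relations : klr_relations e x t.
Proof.
split.
- exact: klr_eM.
- exact: klr_e_sum.
- exact: klr_xe_comm.
- exact: klr_te_comm.
- exact: klr_x_comm.
- exact: klr_tx_snd.
- exact: klr_snd_tx.
- exact: klr_tx_comm.
- exact: klr_t_comm.
- exact: klr_t_sqr.
- exact: klr_t_braid.
- move=> P P1 PD PZ Pe Px Pt; apply: presented_ind => // -[[w|a]|r] b Pb.
  + exact: (Pe w b Pb).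
  + exact: (Px a b Pb).
  + exact: (Pt r b Pb).
Qed.

Lemma klr_klr_system : klr_system e x (extend_t t).
Proof. exact: klr_relations_system klr_klr_relations. Qed.

End Relations.

(** * The polynomial representation *)

Lemma mpoly_ring_ind (K : fieldType) n (P : {mpoly K[n]} -> Prop) :
  (forall c, P c%:MP) -> (forall i, P 'X_i) ->
  (forall f g, P f -> P g -> P (f + g)) ->
  (forall f g, P f -> P g -> P (f * g)) -> forall f, P f.
Proof.
move=> PC PX PD PM; elim/mpolyind => [|c m f _ _ Pf]; first exact: PC 0.
apply: PD => //; rewrite -mul_mpolyC; apply: (PM) => //.
rewrite mpolyXE_id; elim/big_ind: _ => [||i _]; [exact: PC 1 | apply: (PM) |].
elim: (m i) => [|k IHk]; first exact: PC 1.
by rewrite exprS; apply: (PM).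
Qed.

Section Evaluation.
Variables (K : fieldType) (n : nat) (B : comNzRingType) (iota : {rmorphism K -> B}).
Implicit Types (f g : {mpoly K[n]}) (z : seq B).

(** Points have values in any commutative ring over K: fields serve to test identities, polynomial
    rings to substitute variables. *)
Definition evp z (f : {mpoly K[n]}) : B := mmap iota (fun a : 'I_n => z`_a) f.

HB.instance Definition _ z := GRing.RMorphism.copy (evp z) (mmap iota (fun a => z`_a)).

Lemma evpD z f g : evp z (f + g) = evp z f + evp z g.
Proof. exact: rmorphD. Qed.

Lemma evpB z f g : evp z (f - g) = evp z f - evp z g.
Proof. exact: rmorphB. Qed.

Lemma evpM z f g : evp z (f * g) = evp z f * evp z g.
Proof. exact: rmorphM. Qed.

Lemma evpXn z f m : evp z (f ^+ m) = evp z f ^+ m.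
Proof. exact: rmorphXn. Qed.

Lemma evpX z a : evp z 'X_a = z`_a.
Proof. by rewrite /evp mmapX mmap1U. Qed.

Lemma evpC z c : evp z c%:MP = iota c.
Proof. exact: mmapC. Qed.

Lemma evpZ z c f : evp z (c *: f) = iota c * evp z f.
Proof. exact: mmapZ. Qed.

End Evaluation.

Lemma evp_comp (K : fieldType) (n : nat) (B B' : comNzRingType)
    (iota : {rmorphism K -> B}) (iota' : {rmorphism K -> B'})
    (phi : {rmorphism B -> B'}) (z : seq B) (f : {mpoly K[n]}) :
  (forall c, phi (iota c) = iota' c) ->
  phi (evp iota z f) = evp iota' (map phi z) f.
Proof.
move=> phiC; elim/mpoly_ring_ind: f => [c|i|f g|f g].
- by rewrite !evpC.
- rewrite !evpX; have [iz|zi] := ltnP i (size z); first by rewrite (nth_map 0).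
  by rewrite !nth_default ?size_map // rmorph0.
- by move=> Hf Hg; rewrite !evpD rmorphD Hf Hg.
- by move=> Hf Hg; rewrite !evpM rmorphM Hf Hg.
Qed.

Lemma evp_id (K : fieldType) (n : nat) (f : {mpoly K[n]}) :
  evp (@mpolyC n K) [seq 'X_a | a : 'I_n] f = f.
Proof.
elim/mpoly_ring_ind: f => [c|i|f g|f g]; first exact: evpC.
- by rewrite evpX (nth_map i) ?size_enum_ord // nth_ord_enum.
- by move=> Hf Hg; rewrite evpD Hf Hg.
- by move=> Hf Hg; rewrite evpM Hf Hg.
Qed.

Section Demazure.
Variables (K : fieldType) (n : nat) (a b : 'I_n).
Implicit Types (f g : {mpoly K[n]}).
Local Notation s := (tperm a b).

(** Twisted Leibniz rule: the quotient for [f1 * f2] is [g1 * msym s f2 + f1 * g2], so divisibility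
    passes from the variables to all polynomials. *)
Lemma demazure_exists f : exists g, ('X_a - 'X_b) * g = msym s f - f.
Proof.
elim/mpoly_ring_ind: f => [c|i|f1 f2 [g1 E1] [g2 E2]|f1 f2 [g1 E1] [g2 E2]].
- by exists 0; rewrite /msym mmapC subrr mulr0.
- rewrite {1}/msym mmapX mmap1U; case: tpermP => [->|->|_ _].
  + by exists (-1); rewrite mulrN1 opprB.
  + by exists 1; rewrite mulr1.
  + by exists 0; rewrite subrr mulr0.
- by exists (g1 + g2); rewrite mulrDr E1 E2 rmorphD opprD addrACA.
- exists (g1 * msym s f2 + f1 * g2).
  rewrite mulrDr mulrA E1 mulrCA E2 rmorphM mulrBl mulrBr.
  by rewrite addrA addrNK.
Qed.

Definition demazure f : {mpoly K[n]} := sval (cid (demazure_exists f)).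

Lemma demazureE f : ('X_a - 'X_b) * demazure f = msym s f - f.
Proof. exact: svalP (cid (demazure_exists f)). Qed.

Lemma subX_neq0 : a != b -> 'X_a - 'X_b != 0 :> {mpoly K[n]}.
Proof.
move=> ab; rewrite subr_eq0; apply: contra ab => /eqP /(congr1 (mcoeff U_(a))).
rewrite !mcoeffX eqxx; case: eqP => [/mnmP /(_ b)|_ /eqP]; last by rewrite oner_eq0.
by rewrite !mnm1E eqxx; case: eqVneq.
Qed.

Lemma demazure_lin (c : K) f g : a != b ->
  demazure (c *: f + g) = c *: demazure f + demazure g.
Proof.
move=> /subX_neq0 ab; apply: (mulfI ab).
rewrite demazureE mulrDr -scalerAr !demazureE linearP /= scalerBr opprD.
by rewrite addrACA.
Qed.

End Demazure.

Section EvalSwap.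
Variables (K : fieldType) (I : finType) (alpha : I -> nat).
Local Notation n := (weight alpha).
Local Notation P := {mpoly K[n]}.
Local Notation s r := (tperm (fstp r) (sndp r)).

Lemma fst_neq_snd (r : 'I_n.-1) : fstp r != sndp r.
Proof. by rewrite -val_eqE /= ltn_eqF. Qed.

Lemma evp_msym (B : comNzRingType) (iota : {rmorphism K -> B}) (r : 'I_n.-1) z
    (f : P) : size z = n ->
  evp iota z (msym (s r) f) = evp iota (swapl r z) f.
Proof.
move=> zn; elim/mpoly_ring_ind: f => [c|i|f g|f g].
- by rewrite /msym mmapC !evpC.
- have sr := sndp_subproof r.
  rewrite /msym mmapX mmap1U !evpX nth_swapl ?zn // /sw.
  congr (nth _ _ _); case: tpermP => [->|->|] /=; rewrite ?eqxx //.
    by rewrite (gtn_eqF (ltnSn r)).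
  by move=> /eqP + /eqP; rewrite -!val_eqE /= => /negPf -> /negPf ->.
- by move=> Hf Hg; rewrite msymD !evpD Hf Hg.
- by move=> Hf Hg; rewrite msymM !evpM Hf Hg.
Qed.

Lemma evp_demazure (B : fieldType) (iota : {rmorphism K -> B}) (r : 'I_n.-1) z
    (f : P) : size z = n -> z`_r != z`_r.+1 ->
  evp iota z (demazure (fstp r) (sndp r) f) =
  (evp iota (swapl r z) f - evp iota z f) / (z`_r - z`_r.+1).
Proof.
move=> zn; rewrite -subr_eq0 => zr; apply: (mulfI zr).
by rewrite [RHS]mulrC divfK // -evp_msym // -evpB -demazureE evpM evpB !evpX.
Qed.

End EvalSwap.

Section GenericPoint.
Variables (K : fieldType) (n : nat).
Local Notation P := {mpoly K[n]}.

Definition tofrac_scal : {rmorphism K -> {fraction P}} :=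
  (@tofrac P : {rmorphism _ -> _}) \o (@mpolyC n K : {rmorphism _ -> _}).

Definition generic_pt : seq {fraction P} := [seq tofrac ('X_a : P) | a : 'I_n].

Lemma size_generic_pt : size generic_pt = n.
Proof. by rewrite size_map size_enum_ord. Qed.

Lemma evp_generic f : evp tofrac_scal generic_pt f = tofrac f.
Proof.
rewrite -{2}(evp_id f) (@evp_comp _ _ _ _ _ tofrac_scal) //.
by rewrite /generic_pt -map_comp.
Qed.

Lemma uniq_generic_pt : uniq generic_pt.
Proof.
rewrite map_inj_uniq ?enum_uniq // => a b /eqP; rewrite tofrac_eq => /eqP ab.
apply/eqP/negPn/negP => nab; have := @subX_neq0 K n a b nab.
by rewrite ab subrr eqxx.
Qed.

(** The generic point suffices: its coordinates are distinct, and evaluation there is the embedding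
    into the fraction field. *)
Lemma evp_ext (f g : P) :
  (forall (B : fieldType) (iota : {rmorphism K -> B}) (z : seq B),
     size z = n -> uniq z -> evp iota z f = evp iota z g) -> f = g.
Proof.
move=> E; apply/eqP; rewrite -tofrac_eq -!evp_generic; apply/eqP.
exact: E size_generic_pt uniq_generic_pt.
Qed.

End GenericPoint.

Lemma morph_klrDQ (A B : pzRingType) (f : {rmorphism A -> B}) (I : finType)
    (h : I -> I -> nat) i j (p u v w : A) (a b c : B) :
  p * (w - u) = klrQ h i j w v - klrQ h i j u v ->
  f w = c -> f v = b -> f u = a ->
  f p * (c - a) = klrQ h i j c b - klrQ h i j a b.
Proof. by move=> E <- <- <-; rewrite -!rmorph_klrQ -!rmorphB -rmorphM E. Qed.

Section MPolyKAlgebra.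
Variables (K : fieldType) (n : nat).

Fact mpolyC_zmod : zmod_morphism (@mpolyC n K).
Proof. exact: rmorphB. Qed.

Fact mpolyC_monoid : monoid_morphism (@mpolyC n K).
Proof. by split; [exact: rmorph1 | exact: rmorphM]. Qed.

Fact mpoly_scalC (c : K) (f : {mpoly K[n]}) : c%:MP * f = f * c%:MP.
Proof. exact: mulrC. Qed.

HB.instance Definition _ :=
  isKAlgebra.Build K {mpoly K[n]} mpolyC_zmod mpolyC_monoid mpoly_scalC.

Section Eval3.
Variables (a b c : {mpoly K[n]}).

Definition hom1 : {poly K} -> {mpoly K[n]} :=
  horner_morph (fun x : K => mulrC a (x%:MP)).
HB.instance Definition _ := GRing.RMorphism.on hom1.
Definition hom2 : {poly {poly K}} -> {mpoly K[n]} :=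
  horner_morph (fun x => mulrC b (hom1 x)).
HB.instance Definition _ := GRing.RMorphism.on hom2.
Definition hom3 : {poly {poly {poly K}}} -> {mpoly K[n]} :=
  horner_morph (fun x => mulrC c (hom2 x)).
HB.instance Definition _ := GRing.RMorphism.on hom3.

(** In a commutative algebra [eval3] is an iterated Horner evaluation, hence a ring morphism; this
    transports the exact division [klrDQ_exact]. *)
Lemma eval3_hom3 p : eval3 p a b c = hom3 p.
Proof.
rewrite /hom3 /horner_morph horner_poly; apply: eq_bigr => l _.
rewrite /hom2 /horner_morph horner_poly mulr_suml; apply: eq_bigr => m _.
rewrite /hom1 /horner_morph horner_poly !mulr_suml; apply: eq_bigr => o _.
by rewrite !mulrA.
Qed.

Lemma eval3_klrDQ (I : finType) (h : I -> I -> nat) i j :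
  eval3 (klrDQ K h i j) a b c * (c - a) = klrQ h i j c b - klrQ h i j a b.
Proof.
have hX : hom3 'X = c by exact: horner_morphX.
have hY : hom3 ('X%:P) = b.
  by apply: etrans (horner_morphC _ _) _; exact: horner_morphX.
have hZ : hom3 (('X%:P)%:P) = a.
  apply: etrans (horner_morphC _ _) _; apply: etrans (horner_morphC _ _) _.
  exact: horner_morphX.
rewrite eval3_hom3; exact: (morph_klrDQ (f := hom3) (klrDQ_exact K h i j)).
Qed.

End Eval3.
End MPolyKAlgebra.

(** * The operators of the polynomial representation and their values at points *)

Section PolyRep.
Variables (K : fieldType) (I : finType) (h : I -> I -> nat) (alpha : I -> nat).
Local Notation n := (weight alpha).
Local Notation Iseq := (Iseq alpha).
Local Notation P := {mpoly K[n]}.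
Local Notation V := {ffun Iseq -> P}.

Definition op_e (w : Iseq) (F : V) : V := [ffun v => if v == w then F v else 0].

Definition op_poly (p : P) (F : V) : V := [ffun v => p * F v].

(* The choice of the exponent h (w_r, w_(r+1)), w being the target sequence, and
   of the sign of x_(r+1) - x_r makes the square of this operator equal to Q. *)
Definition op_t (r : 'I_n.-1) (F : V) : V :=
  [ffun w => if entry w (fstp r) == entry w (sndp r)
             then demazure (fstp r) (sndp r) (F w)
             else ('X_(sndp r) - 'X_(fstp r)) ^+ h (entry w (fstp r)) (entry w (sndp r))
                  * msym (tperm (fstp r) (sndp r)) (F (swap r w))].

Lemma op_e_lin w (c : K) F G : op_e w (c *: F + G) = c *: op_e w F + op_e w G.
Proof.
by apply/ffunP => v; rewrite !ffunE; case: ifP => _; rewrite ?scaler0 ?addr0.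
Qed.

Lemma op_poly_lin p (c : K) F G :
  op_poly p (c *: F + G) = c *: op_poly p F + op_poly p G.
Proof. by apply/ffunP => v; rewrite !ffunE mulrDr scalerAr. Qed.

Lemma op_t_lin r (c : K) F G : op_t r (c *: F + G) = c *: op_t r F + op_t r G.
Proof.
apply/ffunP => v; rewrite !ffunE; case: ifP => _.
  by rewrite demazure_lin // fst_neq_snd.
by rewrite linearP mulrDr scalerAr.
Qed.

Section EvaluateRep.
Variables (B : fieldType) (iota : {rmorphism K -> B}).
Implicit Types (i : seq I) (z : seq B) (F G : V).

(** Extension by 0 to lists outside the index set lets sequences be cut and permuted as plain
    lists. *)
Definition evV F i z : B :=
  if [pick v : Iseq | iword v == i] is Some v then evp iota z (F v) else 0.

Lemma evV_iword F v z : evV F (iword v) z = evp iota z (F v).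
Proof.
rewrite /evV; case: pickP => [w /eqP/iword_inj ->//|/(_ v)].
by rewrite eqxx.
Qed.

Lemma evV_other F i z : (forall v : Iseq, iword v != i) -> evV F i z = 0.
Proof. by move=> ni; rewrite /evV; case: pickP => // v; rewrite (negPf (ni v)). Qed.

Variant iword_spec i : Prop :=
  | IsIword (v : Iseq) of i = iword v
  | NotIword of (forall v : Iseq, iword v != i).

Lemma iwordP i : iword_spec i.
Proof.
case: (pickP (fun v : Iseq => iword v == i)) => [v /eqP <-|ni].
  exact: (IsIword (v := v)).
by apply: NotIword => v; rewrite ni.
Qed.

Lemma evV_e w F i z : evV (op_e w F) i z = if i == iword w then evV F i z else 0.
Proof.
case: (iwordP i) => [v ->|ni]; last by rewrite !evV_other ?if_same.
rewrite !evV_iword ffunE (inj_eq (@iword_inj _ _)); case: eqP => // _.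
exact: rmorph0.
Qed.

Lemma evV_poly p F i z : evV (op_poly p F) i z = evp iota z p * evV F i z.
Proof.
case: (iwordP i) => [v ->|ni]; last by rewrite !evV_other ?mulr0.
by rewrite !evV_iword ffunE evpM.
Qed.

Lemma evVD F G i z : evV (F + G) i z = evV F i z + evV G i z.
Proof.
case: (iwordP i) => [v ->|ni]; last by rewrite !evV_other ?addr0.
by rewrite !evV_iword ffunE evpD.
Qed.

Lemma evVB F G i z : evV (F - G) i z = evV F i z - evV G i z.
Proof.
case: (iwordP i) => [v ->|ni]; last by rewrite !evV_other ?subr0.
by rewrite !evV_iword !ffunE evpB.
Qed.

Lemma evV0 i z : evV 0 i z = 0.
Proof.
case: (iwordP i) => [v ->|ni]; last by rewrite evV_other.
by rewrite evV_iword ffunE; apply: rmorph0.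
Qed.

(** Distinct coordinates are asked for where the letters agree, as the divided difference is what
    has a denominator. The formula therefore also applies at doubled points. *)
Lemma evV_t (r : 'I_n.-1) F i1 a b i2 z1 x y z2 :
  size i1 = r -> size z1 = r -> size i2 = size z2 ->
  (size z1 + (size z2).+2)%N = n -> (a == b -> x != y) ->
  evV (op_t r F) (i1 ++ a :: b :: i2) (z1 ++ x :: y :: z2) =
  if a == b
  then (evV F (i1 ++ a :: b :: i2) (z1 ++ y :: x :: z2) -
        evV F (i1 ++ a :: b :: i2) (z1 ++ x :: y :: z2)) / (x - y)
  else (y - x) ^+ h a b * evV F (i1 ++ b :: a :: i2) (z1 ++ y :: x :: z2).
Proof.
move=> i1r z1r i2z2 szn xy.
have sz : size (z1 ++ [:: x, y & z2]) = n by rewrite size_cat.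
have zr : (z1 ++ [:: x, y & z2])`_r = x by rewrite nth_cat z1r ltnn subnn.
have zr1 : (z1 ++ [:: x, y & z2])`_r.+1 = y.
  by rewrite nth_cat z1r (leq_gtF (leqnSn _)) subSnn.
have swi : swapl r (i1 ++ [:: a, b & i2]) = i1 ++ [:: b, a & i2].
  by rewrite -i1r swapl_cat.
have swz : swapl r (z1 ++ [:: x, y & z2]) = z1 ++ [:: y, x & z2].
  by rewrite -z1r swapl_cat.
case: (iwordP (i1 ++ [:: a, b & i2])) => [v iv|ni]; last first.
  have ni' (v : Iseq) : iword v != i1 ++ [:: b, a & i2].
    by apply: contra (ni (swap r v)); rewrite iword_swap => /eqP ->; rewrite -swi swaplK.
  by rewrite !(evV_other _ _ ni) !(evV_other _ _ ni') subrr mul0r mulr0 if_same.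
have ea : entry v (fstp r) = a.
  by rewrite (entryE a) -iv /= nth_cat i1r ltnn subnn.
have eb : entry v (sndp r) = b.
  by rewrite (entryE a) -iv /= nth_cat i1r (leq_gtF (leqnSn _)) subSnn.
have sv : iword (swap r v) = i1 ++ [:: b, a & i2] by rewrite iword_swap -iv swi.
rewrite iv -sv !evV_iword ffunE ea eb; case: ifP xy => [_ /(_ isT) xy|_ _].
  by rewrite evp_demazure ?zr ?zr1 // swz.
rewrite evpM evpXn evpB !evpX /= zr zr1 evp_msym //; congr (_ * _).
by rewrite swz.
Qed.

End EvaluateRep.

Lemma evV_ext (F G : V) :
  (forall (B : fieldType) (iota : {rmorphism K -> B}) i z,
     size i = n -> size z = n -> uniq z -> evV iota F i z = evV iota G i z) ->
  F = G.
Proof.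
move=> E; apply/ffunP => v; apply: evp_ext => B iota z zn uz.
by rewrite -!evV_iword; apply: E => //; apply: size_iword.
Qed.

End PolyRep.

Section Splitting.
Variables (T : Type) (U : eqType) (n : nat).

Lemma split_two (r : nat) (i : seq T) (z : seq U) :
  (r.+1 < n)%N -> size i = n -> size z = n -> uniq z ->
  exists i1 a b i2 z1 x y z2,
    [/\ i = i1 ++ a :: b :: i2, z = z1 ++ x :: y :: z2, size i1 = r /\ size z1 = r,
        size i2 = size z2 /\ (size z1 + (size z2).+2)%N = n & x != y].
Proof.
move=> rn si sz uz.
have [i1 [a [b [i2 [Ei i1r]]]]] : exists i1 a b i2, i = i1 ++ a :: b :: i2 /\ size i1 = r.
  by apply: swapl_split; rewrite si.
have [z1 [x [y [z2 [Ez z1r]]]]] : exists z1 x y z2, z = z1 ++ x :: y :: z2 /\ size z1 = r.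
  by apply: swapl_split; rewrite sz.
exists i1, a, b, i2, z1, x, y, z2; split=> //.
  have := congr1 size Ei; have := congr1 size Ez; rewrite !size_cat /= si sz; lia.
move: uz; rewrite Ez cat_uniq => /and3P[_ _] /=.
by rewrite inE negb_or => /andP[/andP[]].
Qed.

Lemma split_three (r : nat) (i : seq T) (z : seq U) :
  (r.+2 < n)%N -> size i = n -> size z = n -> uniq z ->
  exists i1 a b c i2 z1 x y w z2,
    [/\ i = i1 ++ a :: b :: c :: i2, z = z1 ++ x :: y :: w :: z2,
        size i1 = r /\ size z1 = r,
        size i2 = size z2 /\ (size z1 + (size z2).+3)%N = n &
        [/\ x != y, y != w & x != w]].
Proof.
move=> rn si sz uz; have rn' : (r.+1 < n)%N by apply: ltnW.
case: (split_two rn' si sz uz) => i1 [a [b [[|c i2] [z1 [x [y [[|w z2]]]]]]]];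
  case=> Ei Ez [i1r z1r] /= [] ; try by [lia].
move=> [i2z2] szn _; exists i1, a, b, c, i2, z1, x, y, w, z2; split=> //.
move: uz; rewrite Ez cat_uniq => /and3P[_ _] /=; rewrite !inE !negb_or.
by case/and3P=> /and3P[-> -> _] /andP[-> _].
Qed.

Lemma split_far (r s : nat) (i : seq T) (z : seq U) :
  (r.+1 < s)%N -> (s.+1 < n)%N -> size i = n -> size z = n -> uniq z ->
  exists i1 a b i2 c d i3 z1 x y z2 v w z3,
    [/\ i = i1 ++ a :: b :: i2 ++ c :: d :: i3, z = z1 ++ x :: y :: z2 ++ v :: w :: z3,
        size i1 = r /\ size z1 = r,
        [/\ (size i1 + (size i2).+2)%N = s, (size z1 + (size z2).+2)%N = s,
            (size i2 + (size i3).+2)%N = (size z2 + (size z3).+2)%N,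
            (size z1 + (size z2 + (size z3).+2).+2)%N = n
          & size i3 = size z3 /\ (s + (size z3).+2)%N = n] &
        x != y /\ v != w].
Proof.
move=> rs sn si sz uz; have rn : (r.+1 < n)%N by lia.
case: (split_two rn si sz uz) => i1 [a [b [i2 [z1 [x [y [z2]]]]]]].
case=> Ei Ez [i1r z1r] [i2z2 szn] xy.
have [i3 [c [d [i4 [Ei2 i3s]]]]] :
    exists i3 c d i4, i2 = i3 ++ c :: d :: i4 /\ size i3 = (s - r.+2)%N.
  by apply: swapl_split; lia.
have [z3 [v [w [z4 [Ez2 z3s]]]]] :
    exists z3 v w z4, z2 = z3 ++ v :: w :: z4 /\ size z3 = (s - r.+2)%N.
  by apply: swapl_split; lia.
exists i1, a, b, i3, c, d, i4, z1, x, y, z3, v, w, z4.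
have := congr1 size Ez2; have := congr1 size Ei2; rewrite !size_cat /= => si2 sz2.
split=> //; first by rewrite Ei Ei2.
- by rewrite Ez Ez2.
- by split; [| | | |split]; lia.
split=> //; move: uz; rewrite Ez Ez2 cat_uniq => /and3P[_ _] /= /and3P[_ _].
by rewrite cat_uniq => /and3P[_ _] /= /andP[]; rewrite inE negb_or => /andP[].
Qed.

End Splitting.

(** * The KLR relations for the operators *)

Section Relations.
Variables (K : fieldType) (I : finType) (h : I -> I -> nat) (alpha : I -> nat).
Local Notation n := (weight alpha).
Local Notation Iseq := (Iseq alpha).
Local Notation P := {mpoly K[n]}.
Local Notation V := {ffun Iseq -> P}.
Local Notation T := (@op_t K I h alpha).
Local Notation E := (@op_e K I alpha).
Local Notation X a := (@op_poly K I alpha 'X_a).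

Lemma evp_fst (B : fieldType) (iota : {rmorphism K -> B}) (r : 'I_n.-1) z1 x y z2 :
  size z1 = r -> evp iota (z1 ++ x :: y :: z2) 'X_(fstp r) = x.
Proof. by move=> z1r; rewrite evpX /= nth_cat z1r ltnn subnn. Qed.

Lemma evp_snd (B : fieldType) (iota : {rmorphism K -> B}) (r : 'I_n.-1) z1 x y z2 :
  size z1 = r -> evp iota (z1 ++ x :: y :: z2) 'X_(sndp r) = y.
Proof.
by move=> z1r; rewrite evpX /= nth_cat z1r (leq_gtF (leqnSn _)) subSnn.
Qed.

Lemma evp_klrQ (B : fieldType) (iota : {rmorphism K -> B}) z i j (f g : P) :
  evp iota z (klrQ h i j f g) = klrQ h i j (evp iota z f) (evp iota z g).
Proof. exact: rmorph_klrQ. Qed.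

Lemma op_te r w F : T r (E w F) = E (swap r w) (T r F).
Proof.
apply: evV_ext => B iota i z si sz uz.
have [i1 [a [b [i2 [z1 [x [y [z2 [Ei Ez [i1r z1r] [i2z2 szn] xy]]]]]]]]] :=
  split_two (sndp_subproof r) si sz uz.
subst i z; rewrite evV_e !evV_t // !evV_e iword_swap.
have -> : (i1 ++ [:: a, b & i2] == swapl r (iword w)) = (i1 ++ [:: b, a & i2] == iword w).
  by rewrite -(can_eq (@swaplK _ r)) swaplK -i1r swapl_cat.
case: (eqVneq a b) => [->|ab]; case: ifP => _ //.
  by rewrite subrr mul0r.
by rewrite mulr0.
Qed.

(** The Kronecker term of the relations between tau and x, gathered over all sequences. *)
Definition op_diag (r : 'I_n.-1) (F : V) : V :=
  [ffun v => if entry v (fstp r) == entry v (sndp r) then F v else 0].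

Lemma op_diag_e r w F :
  op_diag r (E w F) = E w F *+ (entry w (fstp r) == entry w (sndp r)).
Proof.
apply/ffunP => v; rewrite ffunMnE !ffunE; case: (eqVneq v w) => [->|_].
  by case: ifP.
by rewrite if_same mul0rn.
Qed.

Lemma evV_diag (B : fieldType) (iota : {rmorphism K -> B}) (r : 'I_n.-1) F i1 a b i2 z :
  size i1 = r ->
  evV iota (op_diag r F) (i1 ++ a :: b :: i2) z =
  if a == b then evV iota F (i1 ++ a :: b :: i2) z else 0.
Proof.
move=> i1r; case: (iwordP alpha (i1 ++ [:: a, b & i2])) => [v iv|ni]; last first.
  by rewrite !evV_other ?if_same.
have ea : entry v (fstp r) = a.
  by rewrite (entryE a) -iv /= nth_cat i1r ltnn subnn.
have eb : entry v (sndp r) = b.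
  by rewrite (entryE a) -iv /= nth_cat i1r (leq_gtF (leqnSn _)) subSnn.
rewrite iv !evV_iword ffunE ea eb; case: ifP => // _; exact: rmorph0.
Qed.

Lemma op_tx_snd r F : T r (X (sndp r) F) = X (fstp r) (T r F) + op_diag r F.
Proof.
apply: evV_ext => B iota i z si sz uz.
have [i1 [a [b [i2 [z1 [x [y [z2 [Ei Ez [i1r z1r] [i2z2 szn] xy]]]]]]]]] :=
  split_two (sndp_subproof r) si sz uz.
subst i z; rewrite evVD evV_poly evV_diag // !evV_t // !evV_poly evp_fst // !evp_snd //.
case: ifP => _; last by rewrite addr0 mulrCA.
by field; rewrite subr_eq0.
Qed.

Lemma op_snd_tx r F : X (sndp r) (T r F) = T r (X (fstp r) F) + op_diag r F.
Proof.
apply: evV_ext => B iota i z si sz uz.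
have [i1 [a [b [i2 [z1 [x [y [z2 [Ei Ez [i1r z1r] [i2z2 szn] xy]]]]]]]]] :=
  split_two (sndp_subproof r) si sz uz.
subst i z; rewrite evVD evV_poly evV_diag // !evV_t // !evV_poly !evp_fst // evp_snd //.
case: ifP => _; last by rewrite addr0 mulrCA.
by field; rewrite subr_eq0.
Qed.

Lemma op_tx r a F : a != fstp r -> a != sndp r -> T r (X a F) = X a (T r F).
Proof.
move=> a1 a2; apply: evV_ext => B iota i z si sz uz.
have Ea : evp iota (swapl r z) 'X_a = evp iota z ('X_a : P).
  rewrite !evpX nth_swapl ?sz ?sndp_subproof // /sw.
  by rewrite -[val a == r]/(a == fstp r) -[val a == r.+1]/(a == sndp r) (negPf a1) (negPf a2).
have [i1 [a' [b [i2 [z1 [x [y [z2 [Ei Ez [i1r z1r] [i2z2 szn] xy]]]]]]]]] :=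
  split_two (sndp_subproof r) si sz uz.
move: Ea; subst i z; rewrite -{1}z1r swapl_cat => Ea.
rewrite evV_poly !evV_t // !evV_poly Ea.
case: ifP => _; last by rewrite mulrCA.
by rewrite mulrA mulrBr.
Qed.

Lemma op_t2 r F w : T r (T r (E w F)) =
  op_poly (klrQ h (entry w (fstp r)) (entry w (sndp r)) 'X_(fstp r) 'X_(sndp r)) (E w F).
Proof.
apply: evV_ext => B iota i z si sz uz.
have [i1 [a [b [i2 [z1 [x [y [z2 [Ei Ez [i1r z1r] [i2z2 szn] xy]]]]]]]]] :=
  split_two (sndp_subproof r) si sz uz.
have yx : y != x by rewrite eq_sym.
subst i z; rewrite evV_poly evV_t // !evV_t // ?[b == a]eq_sym // !evV_e.
rewrite evp_klrQ evp_fst // evp_snd // /klrQ.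
case: (eqVneq (i1 ++ [:: a, b & i2]) (iword w)) => [ew|/negPf nw]; last first.
  case: (eqVneq a b) nw => [<- nw|_ _]; rewrite ?mulr0 // ?nw.
  by rewrite !(subrr, mul0r).
have -> : entry w (fstp r) = a.
  by rewrite (entryE a) -ew /= nth_cat i1r ltnn subnn.
have -> : entry w (sndp r) = b.
  by rewrite (entryE a) -ew /= nth_cat i1r (leq_gtF (leqnSn _)) subSnn.
case: (eqVneq a b) ew => [<-|_] ew; last by rewrite mulrA.
by rewrite ew ?eqxx; field; rewrite !subr_eq0 xy yx.
Qed.

Lemma op_tt (r s : 'I_n.-1) F : (r.+1 < s)%N -> T r (T s F) = T s (T r F).
Proof.
move=> rs; apply: evV_ext => B iota i z si sz uz.
have [i1 [a [b [i2 [c [d [i3 [z1 [x [y [z2 [v [w [z3 [Ei Ez [i1r z1r] szs [xy vw]]]]]]]]]]]]]]]] :=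
  split_far rs (sndp_subproof s) si sz uz.
case: szs => i2s z2s i23 szn1 [i3z3 szn].
have Tr G a' b' c' d' x' y' v' w' : x' != y' ->
    evV iota (T r G) (i1 ++ a' :: b' :: i2 ++ c' :: d' :: i3)
      (z1 ++ x' :: y' :: z2 ++ v' :: w' :: z3) =
    if a' == b'
    then (evV iota G (i1 ++ a' :: b' :: i2 ++ c' :: d' :: i3)
            (z1 ++ y' :: x' :: z2 ++ v' :: w' :: z3) -
          evV iota G (i1 ++ a' :: b' :: i2 ++ c' :: d' :: i3)
            (z1 ++ x' :: y' :: z2 ++ v' :: w' :: z3)) / (x' - y')
    else (y' - x') ^+ h a' b' *
      evV iota G (i1 ++ b' :: a' :: i2 ++ c' :: d' :: i3)
         (z1 ++ y' :: x' :: z2 ++ v' :: w' :: z3).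
  by move=> xy'; rewrite evV_t // size_cat /= ?size_cat.
have catE (U : Type) (u1 : seq U) p q u2 u3 :
    u1 ++ p :: q :: u2 ++ u3 = (u1 ++ p :: q :: u2) ++ u3 by rewrite -catA.
have Ts G a' b' c' d' x' y' v' w' : v' != w' ->
    evV iota (T s G) (i1 ++ a' :: b' :: i2 ++ c' :: d' :: i3)
      (z1 ++ x' :: y' :: z2 ++ v' :: w' :: z3) =
    if c' == d'
    then (evV iota G (i1 ++ a' :: b' :: i2 ++ c' :: d' :: i3)
            (z1 ++ x' :: y' :: z2 ++ w' :: v' :: z3) -
          evV iota G (i1 ++ a' :: b' :: i2 ++ c' :: d' :: i3)
            (z1 ++ x' :: y' :: z2 ++ v' :: w' :: z3)) / (v' - w')
    else (w' - v') ^+ h c' d' *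
      evV iota G (i1 ++ a' :: b' :: i2 ++ d' :: c' :: i3)
         (z1 ++ x' :: y' :: z2 ++ w' :: v' :: z3).
  by move=> vw'; rewrite !catE evV_t // size_cat /= ?z2s.
subst i z; have yx : y != x by rewrite eq_sym.
have wv : w != v by rewrite eq_sym.
move: (evV iota) (T r) (T s) Tr Ts => f Tr Ts TrE TsE.
rewrite !(TrE, TsE) //; case: (a == b); case: (c == d) => //.
- by field; rewrite !subr_eq0 xy vw.
- by rewrite -mulrBr mulrA.
- by rewrite -mulrBr mulrA.
- by rewrite mulrCA.
Qed.

Lemma op_braid (r s : 'I_n.-1) F w : s = r.+1 :> nat ->
  T s (T r (T s (E w F))) - T r (T s (T r (E w F))) =
  if entry w (fstp r) == entry w (sndp s)
  then op_poly (eval3 (klrDQ K h (entry w (fstp r)) (entry w (sndp r)))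
             'X_(fstp r) 'X_(sndp r) 'X_(sndp s)) (E w F)
  else 0.
Proof.
move=> rs; apply: evV_ext => B iota i z si sz uz.
have rn : (r.+2 < n)%N by rewrite -rs sndp_subproof.
have [i1 [a [b [c [i2 [x1 [x [y [v [z2 [Ei Ez [i1r z1r] [i2z2 szn] [xy yv xv]]]]]]]]]]]] :=
  split_three rn si sz uz.
have Tr G a' b' c' x' y' v' : x' != y' ->
    evV iota (T r G) (i1 ++ a' :: b' :: c' :: i2) (x1 ++ x' :: y' :: v' :: z2) =
    if a' == b'
    then (evV iota G (i1 ++ a' :: b' :: c' :: i2) (x1 ++ y' :: x' :: v' :: z2) -
          evV iota G (i1 ++ a' :: b' :: c' :: i2) (x1 ++ x' :: y' :: v' :: z2)) / (x' - y')
    else (y' - x') ^+ h a' b' *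
      evV iota G (i1 ++ b' :: a' :: c' :: i2) (x1 ++ y' :: x' :: v' :: z2).
  by move=> xy'; rewrite evV_t //= i2z2.
have Ts G a' b' c' x' y' v' : y' != v' ->
    evV iota (T s G) (i1 ++ a' :: b' :: c' :: i2) (x1 ++ x' :: y' :: v' :: z2) =
    if b' == c'
    then (evV iota G (i1 ++ a' :: b' :: c' :: i2) (x1 ++ x' :: v' :: y' :: z2) -
          evV iota G (i1 ++ a' :: b' :: c' :: i2) (x1 ++ x' :: y' :: v' :: z2)) / (y' - v')
    else (v' - y') ^+ h b' c' *
      evV iota G (i1 ++ a' :: c' :: b' :: i2) (x1 ++ x' :: v' :: y' :: z2).
  move=> yv'; rewrite -(cat_rcons a') -(cat_rcons x') evV_t ?size_rcons ?i1r ?z1r ?rs //.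
    by rewrite !cat_rcons.
  by rewrite addSn -z1r -addnS.
subst i z.
have [yx vy vx] : [/\ y != x, v != y & v != x] by rewrite !(eq_sym v) eq_sym.
pose G := E w F.
(* The equalities among [a], [b], [c] decide which tau's are divided differences, and each pattern
   gives a rational identity in [x], [y], [v]. A remainder survives for a = c != b: the divided
   difference of Q. *)
have -> : evV iota (T s (T r (T s G)) - T r (T s (T r G)))
      (i1 ++ [:: a, b, c & i2]) (x1 ++ [:: x, y, v & z2]) =
    if (a == c) && (a != b)
    then (klrQ h a b v y - klrQ h a b x y) / (v - x) *
         evV iota G (i1 ++ [:: a, b, c & i2]) (x1 ++ [:: x, y, v & z2])
    else 0.
  rewrite evVB; move: (evV iota) (T r) (T s) Tr Ts G => f Tr Ts TrE TsE G.
  rewrite !(TrE, TsE) // /klrQ.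
  have nz : [/\ x - y != 0, y - v != 0, x - v != 0 &
            [/\ y - x != 0, v - y != 0 & v - x != 0]].
    by rewrite !subr_eq0.
  case: nz => n1 n2 n3 [n4 n5 n6].
  have dist : ((a == c) && (a == b)) \/ ((a == c) && (a != b)) \/
      ((a != c) && (a == b)) \/ ((a != c) && (b == c)) \/
      [&& a != c, a != b & b != c].
    by case: (a == c); case: (a == b); case: (b == c); do ?[by left | right].
  rewrite ?[b == a]eq_sym ?[c == b]eq_sym ?[c == a]eq_sym.
  case: dist => [/andP[/eqP<- /eqP<-]|].
    rewrite !eqxx /=; field; rewrite ?n1 ?n2 ?n3 ?n4 ?n5 ?n6 //.
  case=> [/andP[/eqP<- ab]|].
    rewrite ?[b == a]eq_sym !eqxx !(negPf ab) /=.
    move: ((y - v) ^+ h a b) ((v - y) ^+ h b a) ((y - x) ^+ h a b) => p1 p2 p3.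
    move: ((x - y) ^+ h b a) => p4.
    field; rewrite ?n1 ?n2 ?n3 ?n4 ?n5 ?n6 //.
  case=> [/andP[ac /eqP<-]|].
    rewrite !eqxx !(negPf ac) /=.
    move: ((v - y) ^+ h a c) ((v - x) ^+ h a c) => p1 p2.
    field; rewrite ?n1 ?n2 ?n3 ?n4 ?n5 ?n6 //.
  case=> [/andP[ac /eqP bc]|/and3P[ac ab bc]]; last first.
    rewrite !(negPf ab) !(negPf ac) !(negPf bc) /=.
    by rewrite ![in LHS]mulrA; move: (_ ^+ _) (_ ^+ _) (_ ^+ _) => p1 p2 p3; ring.
  rewrite -bc in ac *; rewrite !eqxx !(negPf ac) /=.
  move: ((v - x) ^+ h a b) ((y - x) ^+ h a b) => p1 p2.
  field; rewrite ?n1 ?n2 ?n3 ?n4 ?n5 ?n6 //.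
rewrite {}/G evV_e (fun_if (fun H => evV iota H _ _)) evV_poly evV0 evV_e.
case: (eqVneq _ (iword w)) => [ew|_]; last by rewrite !mulr0 !if_same.
have -> : entry w (fstp r) = a by rewrite (entryE a) -ew /= nth_cat i1r ltnn subnn.
have -> : entry w (sndp r) = b.
  by rewrite (entryE a) -ew /= nth_cat i1r (leq_gtF (leqnSn _)) subSnn.
have -> : entry w (sndp s) = c.
  rewrite (entryE a) -ew /= nth_cat i1r rs ltnNge ltnW ?ltnS //=.
  by rewrite -addn2 -addnBAC // subnn.
case: (eqVneq a c) => [_|//] /=.
have e3 : evp iota (x1 ++ [:: x, y, v & z2]) ('X_(sndp s) : P) = v.
  rewrite evpX /= nth_cat z1r rs ltnNge ltnW ?ltnS //=.
  by rewrite -addn2 -addnBAC // subnn.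
have /(congr1 (evp iota (x1 ++ [:: x, y, v & z2]))) :=
  eval3_klrDQ 'X_(fstp r) 'X_(sndp r) ('X_(sndp s) : P) h a b.
rewrite evpM !evpB !evp_klrQ e3 evp_fst // evp_snd // => D.
have nvx : v - x != 0 by rewrite subr_eq0.
set ev := evp iota _ _ in D *.
have -> : ev = (klrQ h a b v y - klrQ h a b x y) / (v - x) by rewrite -D mulfK.
by case: (eqVneq a b) => [->|//]; rewrite /klrQ eqxx subrr mul0r mul0r.
Qed.

End Relations.

Section AbstractAction.
Variables (K : fieldType) (I : finType) (alpha : I -> nat).
Local Notation n := (weight alpha).
Local Notation P := {mpoly K[n]}.
Local Notation V := {ffun Iseq alpha -> P}.
Variables (A : kAlgType K) (act : A -> V -> V).
Hypothesis actM : forall a b v, act (a * b) v = act a (act b v).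
Hypothesis actB : forall a b v, act (a - b) v = act a v - act b v.
Hypothesis actS : forall c v, act c%:S v = c *: v.
Local Notation M := (@op_poly K I alpha).

Lemma act0 v : act 0 v = 0.
Proof. by rewrite -(subrr 0) actB subrr. Qed.

Lemma actD a b v : act (a + b) v = act a v + act b v.
Proof. by rewrite -{1}[b]opprK -[- b]sub0r !actB act0 sub0r opprK. Qed.

Lemma act1 v : act 1 v = v.
Proof. by rewrite -(rmorph1 (scal A)) actS scale1r. Qed.

Lemma act_sum (J : Type) (s : seq J) (Q : pred J) F v :
  act (\sum_(j <- s | Q j) F j) v = \sum_(j <- s | Q j) act (F j) v.
Proof. by apply: (big_morph (act^~ v)) => [a b|]; [exact: actD | exact: act0]. Qed.

Lemma act_nat m v : act m%:R v = v *+ m.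
Proof. by elim: m => [|m IHm]; rewrite ?act0 // !mulrSr actD IHm act1. Qed.

Lemma act_relM a b c d :
  (forall v, act a (act b v) = act c (act d v)) ->
  forall v, act (a * b) v = act (c * d) v.
Proof. by move=> E v; rewrite !actM. Qed.

Lemma act_rel_delta a b c d u m :
  (forall v, act a (act b (act u v)) = act c (act d (act u v)) + act u v *+ m) ->
  forall v, act (a * b * u) v = act ((c * d + m%:R) * u) v.
Proof. by move=> E v; rewrite !actM actD !actM act_nat. Qed.

Lemma op_polyM p q v : M (p * q) v = M p (M q v).
Proof. by apply/ffunP => w; rewrite !ffunE mulrA. Qed.

Lemma op_polyB p q v : M (p - q) v = M p v - M q v.
Proof. by apply/ffunP => w; rewrite !ffunE mulrBl. Qed.

Lemma op_polyD p q v : M (p + q) v = M p v + M q v.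
Proof. by apply/ffunP => w; rewrite !ffunE mulrDl. Qed.

Lemma op_poly0 v : M 0 v = 0.
Proof. by apply/ffunP => w; rewrite !ffunE mul0r. Qed.

Lemma op_polyC c v : M c%:MP v = c *: v.
Proof. by apply/ffunP => w; rewrite !ffunE mul_mpolyC. Qed.

Definition acts_as a p := forall v, act a v = M p v.

Lemma acts_asM a b p q : acts_as a p -> acts_as b q -> acts_as (a * b) (p * q).
Proof. by move=> ap bq v; rewrite actM ap bq op_polyM. Qed.

Lemma acts_asB a b p q : acts_as a p -> acts_as b q -> acts_as (a - b) (p - q).
Proof. by move=> ap bq v; rewrite actB ap bq op_polyB. Qed.

Lemma acts_as0 : acts_as 0 0.
Proof. by move=> v; rewrite act0 op_poly0. Qed.

Lemma acts_asS c : acts_as c%:S c%:MP.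
Proof. by move=> v; rewrite actS op_polyC. Qed.

Lemma acts_asX a p m : acts_as a p -> acts_as (a ^+ m) (p ^+ m).
Proof.
move=> ap; elim: m => [|m IHm]; last by rewrite !exprS; apply: acts_asM.
by move=> v; rewrite !expr0 act1 -(mpolyC1 n K) op_polyC scale1r.
Qed.

Lemma acts_as_sum k F G : (forall j : 'I_k, acts_as (F j) (G j)) ->
  acts_as (\sum_(j < k) F j) (\sum_(j < k) G j).
Proof.
move=> FG; elim/big_rec2: _ => [|j p a _ ap]; first exact: acts_as0.
by move=> v; rewrite actD FG ap op_polyD.
Qed.

Lemma acts_as_klrQ (h : I -> I -> nat) i j a b p q :
  acts_as a p -> acts_as b q -> acts_as (klrQ h i j a b) (klrQ h i j p q).
Proof.
move=> ap bq; rewrite /klrQ; case: ifP => _; first exact: acts_as0.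
by apply: acts_asM; apply: acts_asX; apply: acts_asB.
Qed.

Lemma acts_as_eval3 f a b c p q r : acts_as a p -> acts_as b q -> acts_as c r ->
  acts_as (eval3 f a b c) (eval3 f p q r).
Proof.
move=> ap bq cr; do 3!apply: acts_as_sum => ?.
by apply: acts_asM; [exact: acts_asS | do 2?apply: acts_asM; apply: acts_asX].
Qed.

Lemma act_relQ (h : I -> I -> nat) i j t u x y p q :
  acts_as x p -> acts_as y q ->
  (forall v, act t (act t (act u v)) = M (klrQ h i j p q) (act u v)) ->
  forall v, act (t ^+ 2 * u) v = act (klrQ h i j x y * u) v.
Proof.
by move=> xp yq E v; rewrite expr2 !actM (acts_as_klrQ h i j xp yq) E.
Qed.

Lemma act_rel_braid (b : bool) t s u a p Tt Ts Eu :
  act t =1 Tt -> act s =1 Ts -> act u =1 Eu -> acts_as a p ->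
  (forall v, Ts (Tt (Ts (Eu v))) - Tt (Ts (Tt (Eu v))) =
             if b then M p (Eu v) else 0) ->
  forall v, act ((s * t * s - t * s * t) * u) v = act (if b then a * u else 0) v.
Proof.
move=> tE sE uE ap E v; rewrite actM actB !actM uE !(tE, sE) E.
by case: b {E}; rewrite ?act0 // actM ap uE.
Qed.

End AbstractAction.

Section KLRAction.
Variables (K : fieldType) (I : finType) (h : I -> I -> nat) (alpha : I -> nat).
Local Notation n := (weight alpha).
Local Notation P := {mpoly K[n]}.
Local Notation V := {ffun Iseq alpha -> P}.
Local Notation R := (klr K h alpha).
Local Notation T := (@op_t K I h alpha).
Local Notation E := (@op_e K I alpha).
Local Notation M := (@op_poly K I alpha).

Definition klr_op (g : klr_gen alpha) : V -> V :=
  match g with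
  | inl (inl w) => E w
  | inl (inr a) => M 'X_a
  | inr r => T r
  end.

Lemma klr_op_lin g (c : K) u v : klr_op g (c *: u + v) = c *: klr_op g u + klr_op g v.
Proof.
by case: g => [[w|a]|r] /=; [exact: op_e_lin | exact: op_poly_lin | exact: op_t_lin].
Qed.

Local Notation fact := (free_act (K := K) klr_op).

Let fM := free_actM klr_op_lin.
Let fB := @free_actB K (klr_gen alpha) V klr_op.
Let fS := @free_act_scal K (klr_gen alpha) V klr_op.
Let fe w v : fact (free_e K w) v = E w v := free_act_gen (K := K) klr_op (inl (inl w)) v.
Let fx a v : fact (free_x K a) v = M 'X_a v :=
  free_act_gen (K := K) klr_op (inl (inr a)) v.
Let ft r v : fact (free_t K r) v = T r v := free_act_gen (K := K) klr_op (inr r) v.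

Lemma klr_op_rel g1 g2 : klr_rel h g1 g2 -> fact g1 =1 fact g2.
Proof.
case=> [v w||a w|r w|a b|r w|r w|r a r1 r2|r s rs|r w|r s w rs] {g1 g2}.
- move=> F; apply: etrans (fM _ _ _) _; rewrite !fe.
  apply/ffunP => u; rewrite !ffunE; case: (eqVneq v w) => [->|vw].
    by rewrite fe !ffunE; case: (u == w).
  rewrite (act0 fB) ffunE; case: (eqVneq u v) => // ->.
  by rewrite (negPf vw).
- move=> F; apply: etrans (act_sum fB _ _ _ _) _; apply: etrans (esym (act1 fS _)).
  apply/ffunP => v; rewrite sum_ffunE (bigD1 v) //= fe !ffunE eqxx big1 ?addr0 //.
  by move=> w wv; rewrite fe ffunE eq_sym (negPf wv).
- apply: (act_relM fM) => F; rewrite !(fx, fe).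
  by apply/ffunP => v; rewrite !ffunE; case: ifP; rewrite ?mulr0.
- by apply: (act_relM fM) => F; rewrite !(ft, fe) op_te.
- apply: (act_relM fM) => F; rewrite !fx.
  by apply/ffunP => v; rewrite !ffunE mulrCA.
- apply: (act_rel_delta fM fB fS) => F; rewrite !(ft, fx, fe) op_tx_snd.
  by rewrite op_diag_e.
- apply: (act_rel_delta fM fB fS) => F; rewrite !(ft, fx, fe) op_snd_tx.
  by rewrite op_diag_e.
- by apply: (act_relM fM) => F; rewrite !(ft, fx) op_tx.
- apply: (act_relM fM) => F; rewrite !ft.
  by case/orP: rs => rs; rewrite (op_tt h F rs).
- apply: (act_relQ fM fB fS (fx _) (fx _)) => F; rewrite !(ft, fe).
  exact: op_t2.
- apply: (act_rel_braid fM fB (ft _) (ft _) (fe _)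
    (acts_as_eval3 fM fB fS _ (fx _) (fx _) (fx _))) => F.
  exact: op_braid.
Qed.

Definition klr_act : R -> V -> V := pres_act (r := @klr_rel K I h alpha) klr_op.

Lemma klr_actM a b v : klr_act (a * b) v = klr_act a (klr_act b v).
Proof. exact: (pres_actM klr_op_lin klr_op_rel). Qed.

Lemma klr_actB a b v : klr_act (a - b) v = klr_act a v - klr_act b v.
Proof. exact: (pres_actB klr_op_lin klr_op_rel). Qed.

Lemma klr_act_scal c v : klr_act c%:S v = c *: v.
Proof. exact: (pres_act_scal klr_op_lin klr_op_rel). Qed.

Lemma klr_act_e w v : klr_act (klr_e K h w) v = E w v.
Proof. exact: (pres_act_gen klr_op_lin klr_op_rel (inl (inl w))). Qed.

Lemma klr_act_x a v : klr_act (klr_x K h a) v = M 'X_a v.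
Proof. exact: (pres_act_gen klr_op_lin klr_op_rel (inl (inr a))). Qed.

Lemma klr_act_t r v : klr_act (klr_t K h r) v = T r v.
Proof. exact: (pres_act_gen klr_op_lin klr_op_rel (inr r)). Qed.

End KLRAction.

(** * Linear independence of the normal form *)

(* Dedekind's independence of characters, for evaluations at points. *)
Lemma evp_independent (K : fieldType) n (B : fieldType) (iota : {rmorphism K -> B})
    (l : seq (B * seq B)) (y0 : seq B) :
  size y0 = n -> (forall cy, cy \in l -> size cy.2 = n) ->
  (forall f : {mpoly K[n]}, \sum_(cy <- l) cy.1 * evp iota cy.2 f = 0) ->
  \sum_(cy <- l | cy.2 == y0) cy.1 = 0.
Proof.
move=> sy0; have [m] := ubnP (count (fun cy => cy.2 != y0) l).
elim: m l => // m IHm l; rewrite ltnS => lm sl El.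
have [/hasP[[c1 y1] ly1 /= y10]|/hasPn nl] := boolP (has (fun cy => cy.2 != y0) l); last first.
  rewrite -big_filter (_ : [seq _ <- _ | _] = l); last first.
    by apply/all_filterP/allP => cy /nl; rewrite negbK.
  rewrite -[RHS](El 1); apply: eq_bigr => cy _.
  by rewrite [evp _ _ _](rmorph1 (evp iota cy.2)) mulr1.
have [a a01] : exists a : 'I_n, y0`_a != y1`_a.
  apply/existsP; rewrite -negb_forall; apply: contra y10 => /forallP eqa.
  apply/eqP; apply: (@eq_from_nth _ 0); rewrite ?sy0 ?(sl _ ly1) // => i ii.
  by apply/esym/eqP; apply: (eqa (Ordinal ii)).
(* Testing against [f] times ['X_a] minus the coordinate of [y1] removes all terms at [y1], and
   multiplies the total coefficient at [y0] by a nonzero difference of coordinates. *)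
pose l' := [seq (cy.1 * (cy.2`_a - y1`_a), cy.2) | cy <- l & cy.2 != y1].
have /= := IHm l' _ _ _.
rewrite big_map big_filter_cond /=.
have -> : \sum_(cy <- l | (cy.2 != y1) && (cy.2 == y0)) cy.1 * (cy.2`_a - y1`_a) =
    (\sum_(cy <- l | cy.2 == y0) cy.1) * (y0`_a - y1`_a).
  rewrite mulr_suml; apply: eq_big => [cy|cy /andP[_ /eqP->]] //.
  by case: (eqVneq cy.2 y1) => [->|] //=; rewrite (negPf y10).
move=> E; apply: (mulIf (x := y0`_a - y1`_a)); first by rewrite subr_eq0.
rewrite mul0r; apply: E => [|cy /mapP[cy' + ->]|f].
- rewrite count_map count_filter; apply: leq_trans lm.
  have -> : count (fun cy : B * seq B => cy.2 != y0) l =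
     (count (predI (fun cy => cy.2 != y0) (fun cy => cy.2 != y1)) l +
      count (predI (fun cy => cy.2 != y0) (fun cy => cy.2 == y1)) l)%N.
    by rewrite -count_predUI; apply: etrans (esym (addn0 _)) _; congr (_ + _)%N;
      [apply: eq_count | apply/esym/eqP; rewrite -leqn0 leqNgt -has_count; apply/hasPn] => cy /=;
      case: (cy.2 == y1); rewrite ?andbF ?andbT ?orbF.
  rewrite -addn1 leq_add2l -has_count; apply/hasP; exists (c1, y1) => //=.
  by rewrite y10 eqxx.
- by rewrite mem_filter => /andP[_ /sl].
rewrite big_map big_filter /= big_mkcond /=.
have Ef : \sum_(cy <- l) (cy.1 * evp iota cy.2 ('X_a * f) -
    y1`_a * (cy.1 * evp iota cy.2 f)) = 0.
  by rewrite sumrB -mulr_sumr !El mulr0 subr0.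
rewrite -[RHS]Ef; apply: eq_bigr => cy _; rewrite evpM evpX.
by case: eqVneq => [->|_] /=; ring.
Qed.

Section PointWords.
Variables (T : eqType) (n : nat) (z : seq T).
Hypotheses (zn : size z = n) (uz : uniq z).

Lemma actl_iota_inj u v : actl u z = actl v z -> actl u (iota 0 n) = actl v (iota 0 n).
Proof.
case: n (z) zn uz => [|m] [|x0 z'] // sz uz' E.
  by apply: etrans (size0nil _) (esym (size0nil _)); rewrite size_actl.
have inA w : actl w (iota 0 m.+1) \in [pred s | all (mem (gtn m.+1)) s].
  by apply/allP => q; rewrite (perm_mem (perm_actl _ _)) mem_iota.
apply: (inj_in_map (A := gtn m.+1) (f := nth x0 (x0 :: z'))) => //.
  by move=> p q pm qm /eqP; rewrite nth_uniq ?sz // => /eqP.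
by rewrite -sz -!actlE.
Qed.

End PointWords.

Section LeadingTerms.
Variables (K : fieldType) (I : finType) (h : I -> I -> nat) (alpha : I -> nat).
Local Notation n := (weight alpha).
Local Notation Iseq := (Iseq alpha).
Local Notation P := {mpoly K[n]}.
Local Notation V := {ffun Iseq -> P}.
Local Notation T := (@op_t K I h alpha).
Local Notation E := (@op_e K I alpha).
Local Notation M := (@op_poly K I alpha).

Definition op_tn (r : nat) (F : V) : V := if insub r is Some r' then T r' F else 0.

Definition opw (u : seq nat) (F : V) : V := foldr op_tn F u.

Lemma op_tnE (r : 'I_n.-1) F : op_tn r F = T r F.
Proof. by rewrite /op_tn valK. Qed.

Lemma op_tn_oob r F : (n <= r.+1)%N -> op_tn r F = 0.
Proof.
by move=> nr; rewrite /op_tn insubF //; apply/negbTE; rewrite -leqNgt; case: n nr.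
Qed.

Lemma op_tn_lin r (c : K) F G : op_tn r (c *: F + G) = c *: op_tn r F + op_tn r G.
Proof.
by rewrite /op_tn; case: insub => [r'|]; [exact: op_t_lin | rewrite scaler0 addr0].
Qed.

Lemma opw_lin u (c : K) F G : opw u (c *: F + G) = c *: opw u F + opw u G.
Proof. by elim: u => //= r u ->; rewrite op_tn_lin. Qed.

Lemma opw0 u : opw u 0 = 0.
Proof. by have := opw_lin u (-1) 0 0; rewrite scaler0 addr0 scaleN1r addNr. Qed.

Lemma op_tn_e r w F : op_tn r (E w F) = E (swapn r w) (op_tn r F).
Proof.
rewrite /op_tn /swapn; case: insubP => [r' _ _|_]; first exact: op_te.
by apply/ffunP => v; rewrite !ffunE if_same.
Qed.

Lemma opw_e u w F : opw u (E w F) = E (actn u w) (opw u F).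
Proof. by elim: u => //= r u ->; rewrite op_tn_e. Qed.

(** Both branches of [op_t] combine the values at the swapped and at the original point. The first
    coefficient is the inverse or a power of a difference of two coordinates, hence nonzero. *)
Lemma op_t_leading (B : fieldType) (iota : {rmorphism K -> B}) r w z :
  size z = n -> uniq z -> (r.+1 < n)%N -> exists c1 c2, c1 != 0 /\ forall F,
  evp iota z (op_tn r F (swapn r w)) =
  c1 * evp iota (swapl r z) (F w) + c2 * evp iota z (F w).
Proof.
move=> sz uz /ord_pred_weight[{}r ->].
have zr : z`_r - z`_r.+1 != 0.
  have sr := sndp_subproof r.
  by rewrite subr_eq0 nth_uniq ?sz ?(ltnW sr) // ltn_eqF.
have ew x : entry (swap r w) x = entry w (tperm (fstp r) (sndp r) x).
  by rewrite /entry /= tnth_mktuple.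
have swK : swap r (swap r w) = w by rewrite -!swapnE swapnK.
rewrite swapnE.
pose a := entry w (fstp r); pose b := entry w (sndp r).
case: (eqVneq a b) => [ab|ab].
  exists (z`_r - z`_r.+1)^-1, (- (z`_r - z`_r.+1)^-1); split.
    by rewrite invr_eq0.
  have sww : swap r w = w.
    apply: val_inj; apply: eq_from_tnth => x.
    rewrite -[tnth _ x]/(entry (swap r w) x) ew -[RHS]/(entry w x).
    by case: tpermP => [->|->|].
  move=> F; rewrite op_tnE ffunE sww -/a -/b ab eqxx evp_demazure //; last first.
    by rewrite -subr_eq0.
  by rewrite mulrC mulrBr mulNr.
exists ((z`_r.+1 - z`_r) ^+ h b a), 0; split.
  by rewrite expf_neq0 // -oppr_eq0 opprB.
move=> F; rewrite op_tnE ffunE !ew tpermL tpermR -/a -/b eq_sym (negPf ab).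
by rewrite evpM evpXn evpB !evpX /= evp_msym // swK mul0r addr0.
Qed.

(** Each tau of the word either moves the point or keeps it: moving it every time gives the leading
    term, and all other terms sit at points reached by shorter words. *)
Lemma opw_leading (B : fieldType) (iota : {rmorphism K -> B}) u w z :
  size z = n -> uniq z -> all (fun r => r.+1 < n)%N u ->
  exists c0 (l : seq (B * seq nat)),
    [/\ c0 != 0, all (fun cv => size cv.2 < size u)%N l & forall F,
      evp iota z (opw u F (actn u w)) =
      c0 * evp iota (actl (rev u) z) (F w) +
      \sum_(cv <- l) cv.1 * evp iota (actl cv.2 z) (F w)].
Proof.
elim: u z => [|r u IHu] z sz uz /=.
  exists 1, [::]; split=> //; first exact: oner_neq0.
  by move=> F; rewrite big_nil mul1r addr0.
case/andP=> rn un; have [c1 [c2 [c1n Er]]] := op_t_leading iota (actn u w) sz uz rn.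
have [||c0 [l [c0n ll El]]] := IHu (swapl r z) _ _ un.
- by rewrite size_swapl.
- by rewrite (perm_uniq (perm_swapl _ _)).
have [c0' [l' [_ ll' El']]] := IHu z sz uz un.
exists (c1 * c0), ([seq (c1 * cv.1, rcons cv.2 r) | cv <- l] ++
  (c2 * c0', rev u) :: [seq (c2 * cv.1, cv.2) | cv <- l']); split.
- by rewrite mulf_neq0.
- rewrite all_cat /= size_rev ltnSn !all_map /=; apply/andP; split.
    by apply: sub_all ll => cv /=; rewrite size_rcons ltnS.
  by apply: sub_all ll' => cv /= /ltnW.
move=> F; rewrite Er El El' big_cat big_cons !big_map /= !mulrDr.
rewrite rev_cons -cats1 actl_cat /= -!mulrA -!addrA; congr (_ + _).
rewrite !mulr_sumr !addrA; congr (_ + _ + _); apply: eq_bigr => cv _.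
  by rewrite -cats1 actl_cat /= mulrA.
by rewrite mulrA.
Qed.

(** A permutation of the coordinates of the generic point is again generic. *)
Lemma evp_actl_eq0 v (f : P) :
  evp (tofrac_scal K n) (actl v (generic_pt K n)) f = 0 -> f = 0.
Proof.
elim: v f => [|r v IHv] f /=.
  by rewrite evp_generic => /eqP; rewrite tofrac_eq0 => /eqP.
have szv : size (actl v (generic_pt K n)) = n by rewrite size_actl size_generic_pt.
have [nr|/ord_pred_weight[{}r ->]] := leqP n r.+1.
  by rewrite swapl_oob ?szv //; apply: IHv.
rewrite -evp_msym // => /IHv f0; apply: evp_ext => B iota z sz uz.
by rewrite -(swaplK r z) -evp_msym ?size_swapl // f0 ![evp _ _ 0]rmorph0.
Qed.

(** No word shorter than [inv L] reaches the leading point of [nf L], so this point is not a lower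
    term of any [L'] with [inv L' <= inv L], and distinct permutations have distinct leading points.
    Once the longer permutations have coefficient 0, the coefficient of that point is a nonzero
    multiple of a value of [p L w]. *)
Theorem opw_free (p : seq nat -> Iseq -> P) :
  (forall F, \sum_w \sum_(L <- permutations (iota 0 n)) opw (nf L) (M (p L w) (E w F)) = 0) ->
  forall w L, perm_eq L (iota 0 n) -> p L w = 0.
Proof.
move=> p0 w; set perms := permutations (iota 0 n) in p0 *.
have permsE L : (L \in perms) = perm_eq L (iota 0 n) by rewrite mem_permutations.
pose cst (f : P) : V := [ffun=> f].
(* Placing [f] on the single sequence [w] isolates its summand; [f] stays arbitrary, as the
   independence of evaluations requires. *)
have {p0} pw f : \sum_(L <- perms) opw (nf L) (E w (cst (p L w * f))) = 0.
  rewrite -[RHS](p0 (E w (cst f))) (bigD1 w) //= [X in _ + X]big1 ?addr0 => [|v vw].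
    apply: eq_bigr => L _; congr (opw _ _); apply/ffunP => v; rewrite !ffunE.
    by case: (v == w); rewrite ?mulr0.
  apply: big1 => L _; rewrite [M _ _](_ : _ = 0) ?opw0 //.
  apply/ffunP => v'; rewrite !ffunE; case: (eqVneq v' v) => [->|_].
    by rewrite (negPf vw) mulr0.
  by rewrite mulr0.
pose z := generic_pt K n; pose emb := tofrac_scal K n.
have sz : size z = n := size_generic_pt K n.
have uz : uniq z := uniq_generic_pt K n.
pose lead L (q : {fraction P} * seq ({fraction P} * seq nat)) :=
  perm_eq L (iota 0 n) ->
  [/\ q.1 != 0, all (fun cv => size cv.2 < inv L)%N q.2 & forall F,
      evp emb z (opw (nf L) F (actn (nf L) w)) =
      q.1 * evp emb (actl (rev (nf L)) z) (F w) +
      \sum_(cv <- q.2) cv.1 * evp emb (actl cv.2 z) (F w)].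
have leadP L : exists q, lead L q.
  have [pL|npL] := boolP (perm_eq L (iota 0 n)); last by exists (0, [::]) => /(negP npL).
  have un : all (fun r => r.+1 < n)%N (nf L).
    have [/chain_valid + _] := nfP pL.
    by rewrite (perm_size pL) size_iota.
  have [c0 [l [c0n ll El]]] := opw_leading emb w sz uz un.
  by exists (c0, l) => _; split=> //; rewrite -(size_nf pL).
have [q qP] := choice leadP.
(* All evaluations in the relation, as pairs of a coefficient and a point; points may repeat. *)
pose lst := flatten [seq
    (let y := actl (rev (nf L)) z in ((q L).1 * evp emb y (p L w), y)) ::
    [seq (cv.1 * evp emb (actl cv.2 z) (p L w), actl cv.2 z) | cv <- (q L).2]
  | L <- perms].
have lst_sum (f : P) : \sum_(cy <- lst) cy.1 * evp emb cy.2 f = 0.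
  rewrite big_flatten big_map /=.
  have E0 (v : Iseq) :
      \sum_(L <- perms) evp emb z (opw (nf L) (E w (cst (p L w * f))) v) = 0.
    have /(congr1 (fun F : V => evp emb z (F v))) := pw f.
    rewrite sum_ffunE ffunE [evp _ _ _](rmorph_sum (evp emb z)) => ->.
    exact: rmorph0.
  have : \sum_(v : Iseq)
      \sum_(L <- perms) evp emb z (opw (nf L) (E w (cst (p L w * f))) v) = 0.
    by apply: big1 => v _; apply: E0.
  rewrite exchange_big /= => E1; rewrite -[RHS]E1; apply: eq_big_seq => L.
  rewrite permsE => pL; have [_ _ Ef] := qP L pL.
  rewrite (bigD1 (actn (nf L) w)) //= [X in _ = _ + X]big1 ?addr0 => [|v vw]; last first.
    by rewrite opw_e ffunE (negPf vw); apply: rmorph0.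
  rewrite Ef !ffunE eqxx big_cons big_map /= evpM mulrA; congr (_ + _).
  by apply: eq_bigr => cv _; rewrite ?ffunE ?eqxx evpM mulrA.
have sz_lst cy : cy \in lst -> size cy.2 = n.
  case/flattenP=> _ /mapP[L _ ->]; rewrite inE => /orP[/eqP->|/mapP[cv _ ->]] /=;
    by rewrite size_actl.
suff main L : perm_eq L (iota 0 n) ->
    (forall L', perm_eq L' (iota 0 n) -> (inv L < inv L')%N -> p L' w = 0) -> p L w = 0.
  pose N := (\sum_(L <- perms) inv L)%N.
  have le_N L : perm_eq L (iota 0 n) -> (inv L <= N)%N.
    by rewrite -permsE => pL; rewrite /N (big_rem L) //= leq_addr.
  (* Downward induction on [inv L] from the bound [N], with [j] counting the levels. Length 0 is
     treated apart, since the strict inequality never reaches it. *)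
  suff all0 j L : perm_eq L (iota 0 n) -> (N - j < inv L)%N -> p L w = 0.
    move=> L pL; have [L0|L0] := posnP (inv L); last by apply: (all0 N); rewrite ?subnn.
    by apply: main => // L' pL' iL'; apply: (all0 N); rewrite ?subnn // -L0.
  elim: j L => [|j IHj] L pL iL.
    by move: iL; rewrite subn0 ltnNge le_N.
  apply: main => // L' pL' iL'; apply: IHj => //.
  by move: iL iL'; lia.
move=> pL above.
pose y0 := actl (rev (nf L)) z.
have sy0 : size y0 = n by rewrite size_actl.
have far L' v : perm_eq L' (iota 0 n) -> (size v < inv L')%N ->
    actl v z != actl (rev (nf L')) z.
  move=> pL' vL'; apply/negP => /eqP /(actl_iota_inj sz uz) /actl_rev_eq.
  rewrite revK (actl_nf pL') => E; move: vL'.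
  by rewrite -E ltnNge -(size_rev v) inv_actl.
have := evp_independent sy0 sz_lst lst_sum.
rewrite big_flatten big_map /= (bigD1_seq L) /=; last 2 first.
- by rewrite permsE.
- exact: permutations_uniq.
rewrite [X in _ + X]big_seq_cond [X in _ + X]big1 ?addr0 => [|L' /andP[]]; last first.
  rewrite permsE => pL' LL'.
  have [iL'|iL'] := ltnP (inv L) (inv L').
    rewrite big_cons big_map /= (above L') // [evp _ _ 0]rmorph0 mulr0 add0r if_same.
    by apply: big1 => cv _; rewrite [evp _ _ 0]rmorph0 mulr0.
  have [_ /allP ll _] := qP L' pL'.
  rewrite big_cons big_map /= ifN; last first.
    apply: contra LL' => /eqP /(actl_iota_inj sz uz) /actl_rev_eq.
    by rewrite !revK !actl_nf // => ->.
  rewrite big_seq_cond big1 // => cv /andP[/ll /= cvL' /eqP E].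
  by have := far L cv.2 pL (leq_trans cvL' iL'); rewrite E eqxx.
have [q0 /allP ll _] := qP L pL.
rewrite big_cons big_map /= eqxx big_seq_cond big1 ?addr0 => [|cv /andP[/ll /= cvL /eqP E]].
  by move/eqP; rewrite mulf_eq0 (negPf q0) /= => /eqP /evp_actl_eq0.
by have := far L cv.2 pL cvL; rewrite E eqxx.
Qed.

End LeadingTerms.

(** * Spanning and faithfulness *)

Section Spanning.
Variables (K : fieldType) (I : finType) (alpha : I -> nat) (A : kAlgType K).
Local Notation n := (weight alpha).
Local Notation Iseq := (Iseq alpha).
Variables (e : Iseq -> A) (x : 'I_n -> A) (t : nat -> A).
Hypothesis sys : klr_system e x t.
Local Notation nelt := (nelt e x t).
Local Notation fil := (fil e x t).

Lemma fil_induction (Q : A -> Prop) :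
  Q 0 -> (forall a b, Q a -> Q b -> Q (a + b)) ->
  (forall u q w, (forall a, fil (size u) a -> Q a) -> Q (nelt u q w)) ->
  forall a, Q a.
Proof.
move=> Q0 QD Qu a; have [l fa] := fil_all sys a.
elim: l a fa => [|l IHl] a; elim=> // u q w {}a ul _ Qa.
by apply: QD => //; apply: Qu => b fb; apply: IHl; apply: fil_leq fb.
Qed.

Lemma nelt_polyr u q w : nelt u q w = tword t u * e w * poly_at x q.
Proof. by rewrite -!mulrA -(poly_at_e sys) !mulrA. Qed.

(** By [fil_reduce] a word may be replaced by the normal form of its permutation up to shorter
    words, to which the induction applies. *)
Lemma span_normal a : exists p : seq nat -> Iseq -> {mpoly K[n]},
  a = \sum_w \sum_(L <- permutations (iota 0 n)) nelt (nf L) (p L w) w.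
Proof.
elim/fil_induction: a => [|_ _ [p ->] [q ->]|u q w fu].
- exists (fun _ _ => 0); rewrite big1 // => w _; rewrite big1 // => L _.
  by rewrite nelt_polyr poly_at0 mulr0.
- exists (fun L w => p L w + q L w); rewrite -big_split; apply: eq_bigr => w _.
  rewrite -big_split; apply: eq_bigr => L _ /=.
  by rewrite !nelt_polyr poly_atD mulrDr.
have pst : perm_eq (st alpha u) (iota 0 n) := perm_actl _ _.
have [c E] := nfP pst.
have single : exists p : seq nat -> Iseq -> {mpoly K[n]}, nelt (nf (st alpha u)) q w =
    \sum_w \sum_(L <- permutations (iota 0 n)) nelt (nf L) (p L w) w.
  exists (fun L v => if (L == st alpha u) && (v == w) then q else 0).
  rewrite (bigD1 w) //= (bigD1_seq (st alpha u)) ?permutations_uniq ?mem_permutations //=.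
  rewrite !eqxx /= !big1 ?addr0 // => [v vw|L Lu].
    by apply: big1 => L _; rewrite (negPf vw) andbF nelt_polyr poly_at0 mulr0.
  by rewrite (negPf Lu) nelt_polyr poly_at0 mulr0.
have [fu'|fu'] := fil_reduce sys w c E.
  by apply: fu; rewrite nelt_polyr; apply: fil_polyr.
have [|p1 E1] := fu (nelt u q w - nelt (nf (st alpha u)) q w).
  by rewrite !nelt_polyr -mulrBl; apply: fil_polyr.
have [p2 E2] := single.
exists (fun L w => p1 L w + p2 L w).
rewrite -[LHS](subrK (nelt (nf (st alpha u)) q w)) E1 E2 -big_split.
apply: eq_bigr => v _; rewrite -big_split; apply: eq_bigr => L _ /=.
by rewrite !nelt_polyr poly_atD mulrDr.
Qed.

End Spanning.

Section Faithful.
Variables (K : fieldType) (I : finType) (h : I -> I -> nat) (alpha : I -> nat).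
Local Notation n := (weight alpha).
Local Notation P := {mpoly K[n]}.
Local Notation V := {ffun Iseq alpha -> P}.

Section Abstract.
Variables (A : kAlgType K) (e : Iseq alpha -> A) (x : 'I_n -> A) (t : nat -> A).
Hypothesis sys : klr_system e x t.
Variable act : A -> V -> V.
Hypothesis actM : forall a b F, act (a * b) F = act a (act b F).
Hypothesis actB : forall a b F, act (a - b) F = act a F - act b F.
Hypothesis actS : forall c F, act c%:S F = c *: F.
Hypothesis act_e : forall w F, act (e w) F = op_e w F.
Hypothesis act_x : forall a F, act (x a) F = op_poly 'X_a F.
Hypothesis act_t : forall r F, act (t r) F = op_tn h r F.

Lemma act_poly p : acts_as act (poly_at x p) p.
Proof.
have xC := sys_xx sys.
elim/mpoly_ring_ind: p => [c|i|f g Hf Hg|f g Hf Hg] F.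
- by rewrite poly_atC; apply: (acts_asS actS).
- by rewrite poly_atXi; apply: act_x.
- by rewrite poly_atD (actD actB) Hf Hg op_polyD.
- by rewrite poly_atM //; apply: (acts_asM actM).
Qed.

Lemma act_tword u F : act (tword t u) F = opw h u F.
Proof.
by elim: u => [|r u IHu] /=; [exact: (act1 actS) | rewrite actM act_t IHu].
Qed.

Lemma act_nelt u p w F : act (nelt e x t u p w) F = opw h u (op_poly p (op_e w F)).
Proof. by rewrite !actM act_tword act_poly act_e. Qed.

(** Spanning and independence concern the same normal forms, so an element acting by 0 has all its
    coefficients 0. *)
Theorem act_faithful a : (forall F, act a F = 0) -> a = 0.
Proof.
have [p ->] := span_normal sys a => a0.
apply: big1 => w _; rewrite big_seq big1 // => L; rewrite mem_permutations => pL.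
have -> : p L w = 0.
  apply: (opw_free (h := h)) pL => F; rewrite -[RHS](a0 F).
  rewrite (act_sum actB); apply: eq_bigr => v _.
  by rewrite (act_sum actB); apply: eq_bigr => L' _; rewrite act_nelt.
by rewrite (nelt_polyr sys) poly_at0 mulr0.
Qed.

End Abstract.

Local Notation e := (@klr_e K I h alpha).
Local Notation x := (@klr_x K I h alpha).
Local Notation t := (extend_t (@klr_t K I h alpha)).
Local Notation act := (@klr_act K I h alpha).

Lemma klr_act_tn r F : act (t r) F = op_tn h r F.
Proof.
rewrite /extend_t /op_tn; case: insub => [r'|]; first exact: klr_act_t.
exact: (act0 (@klr_actB K I h alpha)).
Qed.

End Faithful.

(** * Well-ordered sequences *)

Section IseqOf.
Local Open Scope nat_scope.
Variables (I : finType) (alpha : I -> nat).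

Lemma sum_count_mem (s : seq I) : \sum_i count_mem i s = size s.
Proof.
elim: s => [|a s IH] /=; first by rewrite big1.
rewrite big_split /= IH (bigD1 a) //= eqxx big1 // => i ia.
by rewrite eq_sym (negPf ia).
Qed.

Lemma count_iword (w : Iseq alpha) i : count_mem i (iword w) = alpha i.
Proof. exact/eqP/(forallP (valP w)). Qed.

Lemma Iseq_of (s : seq I) : (forall i, count_mem i s = alpha i) ->
  {w : Iseq alpha | iword w = s}.
Proof.
move=> cs; have szs : size s == weight alpha.
  by rewrite -sum_count_mem; apply/eqP/eq_bigr => i _.
have cP : [forall i, count_mem i (Tuple szs) == alpha i].
  by apply/forallP => i; rewrite /= cs.
by exists (Sub (Tuple szs) cP).
Qed.

End IseqOf.

Section Phi.
Local Open Scope nat_scope.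
Variables (e : nat) (k : 'I_e) (d : 'I_e -> nat).
Local Notation k0 := (widen_ord (leqnSn e) k).
Local Notation k1 := (ordS k0).
Local Notation beta := (lift k1).
Local Notation bar := (bar_dim k d).

Lemma bar_dim_beta a : bar (beta a) = d a.
Proof.
congr d; apply: val_inj; rewrite [LHS]/(unbump k (bump (val k1) a)) (val_k1 k).
rewrite /unbump /bump; have [ka|ak] := leqP k.+1 a.
  by rewrite add1n ltnS (ltnW ka) subn1.
by rewrite add0n ltnNge -ltnS ak subn0.
Qed.

Lemma bar_dim_k1 : bar k1 = d k.
Proof.
congr d; apply: val_inj; rewrite [LHS]/(unbump k (val k1)) (val_k1 k).
by rewrite /unbump ltnSn subn1.
Qed.

Lemma phi_subproof (w : Iseq d) c : count_mem c (phis k (iword w)) = bar c.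
Proof.
case: (unliftP k1 c) => [a ->|->].
  by rewrite count_beta_phis count_iword bar_dim_beta.
by rewrite count_k1_phis count_iword bar_dim_k1.
Qed.

Definition phi (w : Iseq d) : Iseq bar := sval (Iseq_of (phi_subproof w)).

Lemma iword_phi w : iword (phi w) = phis k (iword w).
Proof. exact: svalP (Iseq_of (phi_subproof w)). Qed.

Lemma phis_inj : injective (phis k).
Proof.
move=> i j E; apply: (inj_map (@lift_inj _ k1)).
have F s : map beta s = [seq y <- phis k s | y != k1].
  elim: s => //= a s IH; rewrite beta_neq_k1 /= IH.
  by case: ifP => _ //=; rewrite eqxx.
by rewrite !F E.
Qed.

Lemma phi_inj : injective phi.
Proof.
by move=> v w /(congr1 (@iword _ _)); rewrite !iword_phi => /phis_inj/iword_inj.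
Qed.

Lemma nth_phis i p : nth k1 (phis k i) p = k0 -> nth k1 (phis k i) p.+1 = k1 /\
  exists i1 i2, i = i1 ++ k :: i2 /\ size (phis k i1) = p.
Proof.
have k01 := k0_neq_k1 k.
elim/ltn_ind: p i => p IHp [|a i]; first by rewrite nth_nil => /eqP; rewrite eq_sym (negPf k01).
rewrite phis_cons; case: (eqVneq a k) => [->|ak].
  case: p IHp => [|[|p]] IHp /=.
  - by move=> _; split=> //; exists [::], i.
  - by move=> /eqP; rewrite eq_sym (negPf k01).
  move=> /(IHp _ (ltnW (ltnSn _)))[-> [i1 [i2 [-> <-]]]].
  by split=> //; exists (k :: i1), i2; rewrite phis_cons eqxx.
case: p IHp => [|p] IHp /=.
  by move=> /eqP; rewrite beta_eq_k0 (negPf ak).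
move=> /(IHp _ (ltnSn _))[-> [i1 [i2 [-> <-]]]].
by split=> //; exists (a :: i1), i2; rewrite phis_cons (negPf ak).
Qed.

Lemma phi_well_ordered w : well_ordered (phi w).
Proof.
apply/forallP => a; apply/implyP; rewrite !(entryE k1) iword_phi => /eqP /nth_phis.
move=> [ak1 [i1 [i2 [Ew sa]]]].
have aw : a.+1 < weight bar.
  apply: leq_trans (eq_leq (size_iword (phi w))).
  by rewrite iword_phi Ew phis_cat size_cat phis_cons eqxx sa /= !addnS !ltnS leq_addr.
apply/existsP; exists (Ordinal aw); rewrite eqxx (entryE k1) iword_phi /=.
by rewrite ak1 eqxx.
Qed.

(** Each k is followed by its own k+1; if the two letters are equally frequent, no k+1 is left
    outside such a pair. *)
Lemma wo_decode (s : seq 'I_e.+1) :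
  (forall p, p < size s -> nth k1 s p = k0 ->
     p.+1 < size s /\ nth k1 s p.+1 = k1) ->
  count_mem k0 s <= count_mem k1 s /\
  (count_mem k0 s = count_mem k1 s -> exists i, s = phis k i).
Proof.
have k01 := k0_neq_k1 k; have k10 : (k1 == k0) = false by rewrite eq_sym (negPf k01).
have [m] := ubnP (size s); elim: m s => // m IHm [|x s] /=.
  by move=> _ _; split=> // _; exists [::].
rewrite ltnS => sm wo.
case: (eqVneq x k0) => [xk0|xk0].
  have [s1 sk1] := wo 0 isT xk0.
  case: s sm wo s1 sk1 => //= y s sm wo _ yk1.
  have [|le ex] := IHm s (ltnW sm); first by move=> p ps; apply: (wo p.+2).
  rewrite xk0 yk1 !eqxx (negPf k01) k10 !add0n !add1n; split=> // -[/ex[i ->]].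
  by exists (k :: i); rewrite phis_cons eqxx beta_k.
have [|le ex] := IHm s sm; first by move=> p ps; apply: (wo p.+1).
rewrite add0n; case: (unliftP k1 x) => [a xa|->].
  rewrite xa beta_neq_k1 add0n; split=> // /ex[i ->]; exists (a :: i).
  by rewrite phis_cons -beta_eq_k0 -xa (negPf xk0).
by rewrite eqxx add1n; split; [exact: leqW | move=> E; move: le; rewrite E ltnn].
Qed.

Lemma well_orderedP (v : Iseq bar) : well_ordered v -> exists w, v = phi w.
Proof.
move=> /forallP wo.
have [|_] := wo_decode (s := iword v).
  rewrite size_iword => p pv vp; have := wo (Ordinal pv).
  rewrite (entryE k1) vp eqxx => /existsP[b /andP[/eqP bp /eqP]].
  by rewrite (entryE k1) bp => bk; split=> //; rewrite -bp.
have bk0 : bar k0 = d k by rewrite -[in bar k0](beta_k k) bar_dim_beta.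
rewrite !count_iword bar_dim_k1 bk0 => /(_ erefl)[i vi].
have [|w wi] := @Iseq_of _ d i.
  move=> a; rewrite -(count_beta_phis k) -vi count_iword; exact: bar_dim_beta.
by exists w; apply: iword_inj; rewrite iword_phi wi.
Qed.

(** The part before the pair contains as many k as k+1, so after the exchange the prefix ending with
    the displaced k+1 has one more k+1. *)
Lemma swap_phi_unordered w p : nth k1 (iword (phi w)) p = k0 ->
  unordered (swapn p (phi w)).
Proof.
rewrite iword_phi => /nth_phis[_ [i1 [i2 [Ew <-]]]].
have E : iword (phi w) = phis k i1 ++ k0 :: k1 :: phis k i2.
  by rewrite iword_phi Ew phis_cat phis_cons eqxx beta_k.
have pn : (size (phis k i1)).+1 < (weight bar).+1.
  by rewrite -(size_iword (phi w)) E size_cat /= !addnS !ltnS ltnW // ltnS leq_addr.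
apply/existsP; exists (Ordinal pn).
rewrite -![X in take _ X]/(iword (swapn (size (phis k i1)) (phi w))).
rewrite iword_swapn E swapl_cat /= -cat_rcons take_size_cat ?size_rcons //.
rewrite -!cats1 !count_cat /= eqxx eq_sym (negPf (k0_neq_k1 k)) !addn0.
by rewrite -[in count_mem k0](beta_k k) count_k1_phis count_beta_phis addn1.
Qed.

End Phi.

(** * Functions vanishing at admissible points *)

Section Admissible.
Variables (e : nat) (k : 'I_e).
Local Notation k0 := (widen_ord (leqnSn e) k).
Local Notation k1 := (ordS k0).
Variable T : eqType.
Variable t0 : T.
Implicit Types (s : seq 'I_e.+1) (y : seq T).

(* Points at which every k+1 can be matched with an earlier k having the same
   coordinate, these being the only coincidences of coordinates. *)
Definition admissible s y : Prop :=
  (forall p q, (p < size s)%N -> (q < size s)%N -> p <> q ->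
     nth t0 y p = nth t0 y q -> (nth k1 s p == k1) <> (nth k1 s q == k1)) /\
  (forall q, (q < size s)%N -> nth k1 s q = k1 ->
     exists p, [/\ (p < q)%N, nth k1 s p = k0 & nth t0 y p = nth t0 y q]).

(** A simple transposition puts a k behind its matching k+1 only if the two are the neighbours
    exchanged, which is the excluded case. *)
Lemma admissible_swap r s y : (r.+1 < size s)%N -> size y = size s ->
  ~ [/\ nth k1 s r = k0, nth k1 s r.+1 = k1 & nth t0 y r = nth t0 y r.+1] ->
  admissible s y -> admissible (swapl r s) (swapl r y).
Proof.
move=> rs sy nr [inj match_].
have ry : (r.+1 < size y)%N by rewrite sy.
have swlt p : (p < size s)%N -> (sw r p < size s)%N.
  by rewrite /sw; case: eqVneq => // _; case: eqVneq => // -> _; apply: ltnW.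
split=> [p q|q]; rewrite size_swapl => ps.
  move=> qs pq; rewrite !nth_swapl //; apply: inj; try exact: swlt.
  by move=> /(can_inj (swK r)).
rewrite nth_swapl // => qk; have [p [pq pk0 yp]] := match_ _ (swlt _ ps) qk.
exists (sw r p); rewrite !nth_swapl // swK; split=> //.
have np : ~ (p = r /\ sw r q = r.+1).
  by move=> [pr qr]; apply: nr; rewrite qr in qk yp; rewrite pr in pk0 yp.
move: pq np; rewrite /sw.
by case: (eqVneq p r) => ?; case: (eqVneq q r) => ?; case: (eqVneq p r.+1) => ?;
   case: (eqVneq q r.+1) => ?; lia.
Qed.

(** The coordinates at the letters k+1 of the prefix are distinct, and each also occurs at a letter
    k of the prefix. Hence unordered sequences have no admissible points. *)
Lemma admissible_count s y t : (t <= size s)%N -> size y = size s ->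
  admissible s y -> (count_mem k1 (take t s) <= count_mem k0 (take t s))%N.
Proof.
move=> ts sy [inj match_].
have cE c : count_mem c (take t s) = size [seq nth t0 y p | p <- iota 0 t & nth k1 s p == c].
  by rewrite size_map size_filter -(map_nth_iota0 k1 ts) count_map.
rewrite !cE; apply: uniq_leq_size.
  rewrite map_inj_in_uniq ?filter_uniq ?iota_uniq // => p q.
  rewrite !mem_filter !mem_iota !add0n => /andP[/eqP pk pt] /andP[/eqP qk qt] E.
  apply/eqP/negPn/negP => /eqP pq.
  have lt x : (x < t)%N -> (x < size s)%N by move=> xt; apply: leq_trans xt ts.
  by apply: (inj p q (lt _ pt) (lt _ qt) pq E); rewrite pk qk.
move=> x /mapP[q]; rewrite mem_filter mem_iota add0n => /andP[/eqP qk qt] ->.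
have [p [pq pk E]] := match_ q (leq_trans qt ts) qk.
by apply/mapP; exists p => //; rewrite mem_filter pk eqxx mem_iota add0n (ltn_trans pq).
Qed.

Lemma admissible_blow i (z : seq T) : size z = size i -> uniq z ->
  admissible (phis k i) (blow k id id i z).
Proof.
have k01 := k0_neq_k1 k; have k10 : (k1 == k0) = false by rewrite eq_sym (negPf k01).
elim: i z => [|a i IH] [|x z] //= [sz] /andP[xz uz].
have memb (j : seq 'I_e) (v : seq T) u : u \in blow k id id j v -> u \in v.
  elim: j v => [|b j IHj] [|v0 v] //=.
  by case: ifP => _; rewrite !inE => /orP[->//|];
     [case/orP=> [->//|]|] => /IHj ->; rewrite orbT.
have [inj match_] := IH z sz uz.
have sb : size (blow k id id i z) = size (phis k i).
  by rewrite size_phis size_blow.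
have nx q : (q < size (phis k i))%N -> x <> nth t0 (blow k id id i z) q.
  rewrite -sb => qs E; case/negP: xz; rewrite E; apply: memb; exact: mem_nth.
rewrite phis_cons; case: (eqVneq a k) => [->|ak]; rewrite /admissible /=.
  rewrite beta_k; split.
    move=> [|[|p]] [|[|q]] //=; rewrite ?(negPf k01) ?eqxx //.
    - by move=> _ qs _ /(nx q qs).
    - by move=> _ qs _ /(nx q qs).
    - by move=> ps _ _ /esym /(nx p ps).
    - by move=> ps _ _ /esym /(nx p ps).
    by rewrite !ltnS => ps qs pq; apply: inj => // E; apply: pq; rewrite E.
  move=> [|[|q]] //=.
  - by move=> _ /eqP; rewrite (negPf k01).
  - by move=> _ _; exists 0%N.
  rewrite !ltnS => qs /(match_ q qs)[p [pq pk E]].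
  by exists p.+2; split.
split.
  move=> [|p] [|q] //=.
  - by move=> _ qs _ /(nx q qs).
  - by move=> ps _ _ /esym /(nx p ps).
  by rewrite !ltnS => ps qs pq; apply: inj => // E; apply: pq; rewrite E.
move=> [|q] //=; first by move=> _ /eqP; rewrite beta_neq_k1.
rewrite !ltnS => qs /(match_ q qs)[p [pq pk E]].
by exists p.+1; split.
Qed.

End Admissible.

Section Stable.
Variables (K : fieldType) (e : nat) (k : 'I_e) (alpha : 'I_e.+1 -> nat).
Local Notation k0 := (widen_ord (leqnSn e) k).
Local Notation k1 := (ordS k0).
Local Notation n := (weight alpha).
Local Notation h := (@cyclic_quiver e.+1).
Local Notation V := {ffun Iseq alpha -> {mpoly K[n]}}.

(** The kernel of [contract] says nothing about sequences that are not well-ordered, which the tau's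
    reach. This condition constrains the values over all sequences, and is stable under the
    operators. *)
Definition vanishing (F : V) : Prop :=
  forall (B : fieldType) (iota : {rmorphism K -> B}) i y, size i = n -> size y = n ->
    admissible k 0 i y -> evV iota F i y = 0.

Lemma vanishing_op_e w F : vanishing F -> vanishing (op_e w F).
Proof. by move=> vF B iota i y si sy /vF E; rewrite evV_e E ?if_same. Qed.

Lemma vanishing_op_poly p F : vanishing F -> vanishing (op_poly p F).
Proof. by move=> vF B iota i y si sy /vF E; rewrite evV_poly E ?mulr0. Qed.

Lemma vanishingD F G : vanishing F -> vanishing G -> vanishing (F + G).
Proof.
move=> vF vG B iota i y si sy ad.
by rewrite evVD (vF B iota i y si sy ad) (vG B iota i y si sy ad) addr0.
Qed.

Lemma vanishingZ c F : vanishing F -> vanishing (c *: F).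
Proof.
move=> vF; have -> : c *: F = op_poly c%:MP F by rewrite op_polyC.
exact: vanishing_op_poly.
Qed.

Lemma vanishing_op_t r F : vanishing F -> vanishing (op_t h r F).
Proof.
move=> vF B iota i y si sy ad.
have sr := sndp_subproof r.
have [i1 [a [b [i2 [Ei i1r]]]]] : exists i1 a b i2, i = i1 ++ a :: b :: i2 /\ size i1 = r.
  by apply: swapl_split; rewrite si.
have [y1 [x [x' [y2 [Ey y1r]]]]] : exists y1 x x' y2, y = y1 ++ x :: x' :: y2 /\ size y1 = r.
  by apply: swapl_split; rewrite sy.
have s12 : size i2 = size y2 /\ (size y1 + (size y2).+2)%N = n.
  have := congr1 size Ei; have := congr1 size Ey; rewrite !size_cat /= si sy => E1 E2.
  split; last by rewrite -E1.
  by apply/eqP; rewrite -(eqn_add2l (size i1).+2) !addSn -!addnS -E2 i1r -y1r E1.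
have ir : nth k1 i r = a by rewrite Ei nth_cat i1r ltnn subnn.
have ir1 : nth k1 i r.+1 = b by rewrite Ei nth_cat i1r (leq_gtF (leqnSn _)) subSnn.
have yr : y`_r = x by rewrite Ey nth_cat y1r ltnn subnn.
have yr1 : y`_r.+1 = x' by rewrite Ey nth_cat y1r (leq_gtF (leqnSn _)) subSnn.
have swi : swapl r i = i1 ++ b :: a :: i2 by rewrite Ei -i1r swapl_cat.
have swy : swapl r y = y1 ++ x' :: x :: y2 by rewrite Ey -y1r swapl_cat.
have ab_x : a == b -> x != x'.
  move=> /eqP ab; apply/negP => /eqP xx'; have [inj _] := ad.
  apply: (inj r r.+1); rewrite ?si ?(ltnW sr) //.
    by rewrite yr yr1.
  by rewrite ir ir1 ab.
rewrite Ei Ey evV_t ?s12.1 ?s12.2 // -Ei -Ey -swi -swy.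
(* The one swap that leaves the admissible points exchanges a k and a k+1 with equal coordinates;
   the arrow from k to k+1 then supplies the factor [x' - x], which is 0. *)
have [bad|nbad] := boolP [&& a == k0, b == k1 & x == x'].
  case/and3P: bad => /eqP a0 /eqP b1 /eqP xx'.
  rewrite a0 b1 (negPf (k0_neq_k1 k)) xx' subrr.
  by rewrite /cyclic_quiver eqxx expr1 mul0r.
have ad' : admissible k 0 (swapl r i) (swapl r y).
  apply: admissible_swap => //; rewrite ?si ?sy //.
  rewrite ir ir1 yr yr1 => -[/eqP a0 /eqP b1 /eqP xx'].
  by rewrite a0 b1 xx' in nbad.
have v' := vF B iota (swapl r i) (swapl r y) _ _ ad'.
rewrite !size_swapl in v'; have {}v' := v' si sy.
case: ifP => [/eqP ab|_]; last by rewrite v' mulr0.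
have swii : swapl r i = i by rewrite swi Ei ab.
by rewrite swii in v'; rewrite v' (vF B iota i y si sy ad) subrr mul0r.
Qed.

Lemma vanishing_unordered w (F : V) :
  (exists2 t : nat, (t <= n)%N &
    (count_mem k0 (take t (iword w)) < count_mem k1 (take t (iword w)))%N) ->
  vanishing (op_e w F).
Proof.
case=> t tn ct B iota i y si sy ad; rewrite evV_e; case: eqP => // iw.
have := @admissible_count _ k _ 0 i y t; rewrite si sy => /(_ tn erefl ad).
by rewrite iw leqNgt ct.
Qed.

End Stable.

(** * Contraction of the polynomial representation *)

Section QuiverBar.
Variables (e : nat) (e_gt1 : (1 < e)%N) (k : 'I_e).
Local Notation k0 := (widen_ord (leqnSn e) k).
Local Notation k1 := (ordS k0).
Local Notation beta := (lift k1).
Local Notation h := (@cyclic_quiver e).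
Local Notation hb := (@cyclic_quiver e.+1).

Lemma modnS_small i m : (i < m)%N -> (i.+1 %% m = if i.+1 == m then 0 else i.+1)%N.
Proof. by move=> im; case: eqP => [->|ne]; [exact: modnn | rewrite modn_small; lia]. Qed.

Lemma bump_modS (a b k' : nat) : (k' < e)%N -> (a < e)%N -> (b < e)%N -> a != k' ->
  (bump k'.+1 b == (bump k'.+1 a).+1 %% e.+1)%N = (b == a.+1 %% e)%N.
Proof.
rewrite /bump => ke ae be ak.
by case: (leqP k'.+1 a) => ?; case: (leqP k'.+1 b) => ?;
   rewrite !modnS_small ?add1n ?add0n; do ?case: ifP; lia.
Qed.

Lemma quiver_beta a b : a != k -> hb (beta a) (beta b) = h a b.
Proof.
rewrite /cyclic_quiver -!val_eqE /= (modn_small (ltn_ord (lift ord0 k))) => ak.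
by rewrite bump_modS.
Qed.

Lemma quiver_beta_k1 a : a != k -> hb (beta a) k1 = 0%N.
Proof.
move=> ak; rewrite /cyclic_quiver (inj_eq (@ordS_inj _)) eq_sym beta_eq_k0.
by rewrite (negPf ak).
Qed.

Lemma quiver_k0_beta b : hb k0 (beta b) = 0%N.
Proof. by rewrite /cyclic_quiver beta_neq_k1. Qed.

Lemma quiver_k1_beta b : b != k -> hb k1 (beta b) = h k b.
Proof.
have kE : (k.+1 %% e.+1 = k.+1)%N by rewrite modn_small // ltnS.
rewrite /cyclic_quiver -!val_eqE /= kE /bump.
have := ltn_ord b; have := ltn_ord k; move: (nat_of_ord k) (nat_of_ord b) => k' b' ke be bk.
congr nat_of_bool.
by case: (leqP k'.+1 b') => ?; rewrite !modnS_small ?add1n ?add0n; do ?case: ifP; lia.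
Qed.

Lemma quiver_k0_k1 : hb k0 k1 = 1%N.
Proof. by rewrite /cyclic_quiver eqxx. Qed.

(** Here [1 < e] matters: in the cyclic quiver of length 2 an arrow would lead from k+1 back to
    k. *)
Lemma quiver_k1_k0 : hb k1 k0 = 0%N.
Proof.
have kE : (k.+1 %% e.+1 = k.+1)%N by rewrite modn_small // ltnS.
have := ltn_ord k; rewrite /cyclic_quiver -!val_eqE /= kE => ke.
by rewrite modnS_small //; case: ifP; lia.
Qed.

End QuiverBar.

Section Evaluate.
Variables (K : fieldType) (I : finType) (h : I -> I -> nat) (alpha : I -> nat).
Local Notation n := (weight alpha).
Variables (B : fieldType) (iota : {rmorphism K -> B}).

Lemma evV_tn r (F : {ffun Iseq alpha -> {mpoly K[n]}}) i1 a b i2 z1 x y z2 :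
  size i1 = r -> size z1 = r -> size i2 = size z2 ->
  (size z1 + (size z2).+2)%N = n -> (a == b -> x != y) ->
  evV iota (op_tn h r F) (i1 ++ a :: b :: i2) (z1 ++ x :: y :: z2) =
  if a == b
  then (evV iota F (i1 ++ a :: b :: i2) (z1 ++ y :: x :: z2) -
        evV iota F (i1 ++ a :: b :: i2) (z1 ++ x :: y :: z2)) / (x - y)
  else (y - x) ^+ h a b * evV iota F (i1 ++ b :: a :: i2) (z1 ++ y :: x :: z2).
Proof.
move=> ir zr s2 sn xy.
have rn : (r.+1 < n)%N by rewrite -sn zr; lia.
move: rn ir zr => /ord_pred_weight[r' ->] ir zr.
by rewrite op_tnE evV_t.
Qed.

End Evaluate.

Section Contract.
Variables (K : fieldType) (e : nat) (e_gt1 : (1 < e)%N) (k : 'I_e) (d : 'I_e -> nat).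
Local Notation k0 := (widen_ord (leqnSn e) k).
Local Notation k1 := (ordS k0).
Local Notation beta := (lift k1).
Local Notation h := (@cyclic_quiver e).
Local Notation hb := (@cyclic_quiver e.+1).
Local Notation bar := (bar_dim k d).
Local Notation m := (weight d).
Local Notation n := (weight bar).
Local Notation V := {ffun Iseq d -> {mpoly K[m]}}.
Local Notation Vb := {ffun Iseq bar -> {mpoly K[n]}}.
Implicit Types (G : Vb) (w : Iseq d).

Local Notation vars m := [seq 'X_a | a : 'I_m].

(* Over the well-ordered sequence phi w only the values at points where the
   variables of each pair k, k+1 coincide are retained. *)
Definition contract_poly w : {mpoly K[n]} -> {mpoly K[m]} :=
  evp (@mpolyC m K) (blow k id id (iword w) (vars m)).

Definition contract G : V := [ffun w => contract_poly w (G (phi k w))].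

Lemma size_vars l : size (vars l : seq {mpoly K[l]}) = l.
Proof. by rewrite size_map size_enum_ord. Qed.

Lemma map_vars (B : fieldType) (iota : {rmorphism K -> B}) l (z : seq B) :
  size z = l -> map (evp iota z) (vars l) = z.
Proof.
move=> sz; apply: (@eq_from_nth _ 0); rewrite size_map size_vars ?sz // => i il.
rewrite (nth_map 0) ?size_vars // (nth_map (Ordinal il)) ?size_enum_ord //.
by rewrite evpX nth_enum_ord.
Qed.

Lemma bsize_iword w : bsize k (iword w) = n.
Proof. by rewrite -size_phis -iword_phi size_iword. Qed.

Lemma phis_not_iword i : (forall w, iword w != i) ->
  forall v : Iseq bar, iword v != phis k i.
Proof.
move=> ni v; apply/eqP => vi.
have [w wi] : {w : Iseq d | iword w = i}.
  apply: Iseq_of => a.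
  by rewrite -(count_beta_phis k) -vi count_iword bar_dim_beta.
by have := ni w; rewrite wi eqxx.
Qed.

(** Identifying the variables of each pair and then evaluating is evaluating at the point with these
    coordinates doubled. *)
Lemma evV_contract (B : fieldType) (iota : {rmorphism K -> B}) G i z :
  size i = m -> size z = m ->
  evV iota (contract G) i z = evV iota G (phis k i) (blow k id id i z).
Proof.
move=> si sz; case: (iwordP d i) => [w ->|ni].
  rewrite -iword_phi !evV_iword ffunE (evp_comp (iota' := iota)); last exact: evpC.
  by rewrite map_blow -[in RHS](map_vars iota sz) !blow_map.
by rewrite !evV_other //; apply: phis_not_iword.
Qed.

Lemma contract_lin (c : K) G1 G2 :
  contract (c *: G1 + G2) = c *: contract G1 + contract G2.
Proof. by apply/ffunP => w; rewrite !ffunE /contract_poly evpD evpZ mul_mpolyC. Qed.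

Lemma contractB G1 G2 : contract (G1 - G2) = contract G1 - contract G2.
Proof. by apply/ffunP => w; rewrite !ffunE /contract_poly evpB. Qed.

Lemma contractD G1 G2 : contract (G1 + G2) = contract G1 + contract G2.
Proof. by apply/ffunP => w; rewrite !ffunE /contract_poly evpD. Qed.

Lemma contract_e w G : contract (op_e (phi k w) G) = op_e w (contract G).
Proof.
apply/ffunP => v; rewrite !ffunE (inj_eq (@phi_inj _ _ _)); case: ifP => // _.
exact: rmorph0.
Qed.

(** A section of [contract_poly]: each variable goes to the variable at the start of the blow-up of
    its letter. *)
Definition blow_poly w : {mpoly K[m]} -> {mpoly K[n]} :=
  evp (@mpolyC n K) [seq (vars n)`_q | q <- poss k 0 (iword w)].

Lemma blow_polyK w p : contract_poly w (blow_poly w p) = p.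
Proof.
rewrite /contract_poly /blow_poly (evp_comp (iota' := @mpolyC m K)); last exact: evpC.
rewrite -[RHS]evp_id; congr evp; rewrite -map_comp.
apply: (@eq_from_nth _ 0); rewrite size_map size_poss size_iword ?size_vars // => q qm.
rewrite (nth_map 0%N) ?size_poss ?size_iword //=.
have sv : size (vars m : seq {mpoly K[m]}) = size (iword w).
  by rewrite size_vars size_iword.
have qi : (q < size (iword w))%N by rewrite size_iword.
have [E _] := @nth_poss_blow _ k _ _ 0 0 id id (iword w) _ 0%N sv q qi.
move: E; rewrite subn0 => E.
set j := nth 0%N _ _ in E *.
have [jn|nj] := ltnP j n; last first.
  by rewrite nth_default ?size_vars // rmorph0 -E nth_default // size_blow // bsize_iword.
by rewrite (nth_map (Ordinal jn)) ?size_enum_ord // evpX nth_enum_ord.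
Qed.

Lemma contract_poly_e w p G :
  contract (op_poly p (op_e (phi k w) G)) =
  op_poly (contract_poly w p) (op_e w (contract G)).
Proof.
apply/ffunP => v; rewrite !ffunE (inj_eq (@phi_inj _ _ _)); case: eqP => [->|_].
  by rewrite /contract_poly evpM.
by rewrite mulr0 [LHS](rmorph0 (evp _ _)) mulr0.
Qed.

End Contract.

Section EvaluateShifted.
Variables (K : fieldType) (I : finType) (h : I -> I -> nat) (alpha : I -> nat).
Local Notation n := (weight alpha).
Variables (B : fieldType) (iota : {rmorphism K -> B}).
Variables (i1 : seq I) (z1 : seq B) (i2 : seq I) (z2 : seq B) (p : nat).
Hypotheses (i1p : size i1 = p) (z1p : size z1 = p) (s2 : size i2 = size z2).
Local Notation ev F i z := (evV iota F (i1 ++ i) (z1 ++ z)).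

Lemma evV_tnS (F : {ffun Iseq alpha -> {mpoly K[n]}}) c a b u x y :
  (p + (size z2).+3)%N = n -> (a == b -> x != y) ->
  ev (op_tn h p.+1 F) (c :: a :: b :: i2) (u :: x :: y :: z2) =
  if a == b
  then (ev F (c :: a :: b :: i2) (u :: y :: x :: z2) -
        ev F (c :: a :: b :: i2) (u :: x :: y :: z2)) / (x - y)
  else (y - x) ^+ h a b * ev F (c :: b :: a :: i2) (u :: y :: x :: z2).
Proof.
move=> sn xy; rewrite -!(cat_rcons _ i1) -!(cat_rcons _ z1).
by apply: evV_tn; rewrite ?size_rcons ?i1p ?z1p // -sn !addnS.
Qed.

Lemma evV_tnSS (F : {ffun Iseq alpha -> {mpoly K[n]}}) c c' a b u u' x y :
  (p + (size z2).+4)%N = n -> (a == b -> x != y) ->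
  ev (op_tn h p.+2 F) (c :: c' :: a :: b :: i2) (u :: u' :: x :: y :: z2) =
  if a == b
  then (ev F (c :: c' :: a :: b :: i2) (u :: u' :: y :: x :: z2) -
        ev F (c :: c' :: a :: b :: i2) (u :: u' :: x :: y :: z2)) / (x - y)
  else (y - x) ^+ h a b * ev F (c :: c' :: b :: a :: i2) (u :: u' :: y :: x :: z2).
Proof.
move=> sn xy; rewrite -!(cat_rcons _ i1) -!(cat_rcons _ z1).
rewrite -!(cat_rcons _ (rcons i1 _)) -!(cat_rcons _ (rcons z1 _)).
by apply: evV_tn; rewrite ?size_rcons ?i1p ?z1p // -sn !addnS.
Qed.

End EvaluateShifted.

Section Block.
Variables (K : fieldType) (e : nat) (e_gt1 : (1 < e)%N) (k : 'I_e) (d : 'I_e -> nat).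
Local Notation k0 := (widen_ord (leqnSn e) k).
Local Notation k1 := (ordS k0).
Local Notation beta := (lift k1).
Local Notation h := (@cyclic_quiver e).
Local Notation hb := (@cyclic_quiver e.+1).
Local Notation bar := (bar_dim k d).
Local Notation m := (weight d).
Local Notation n := (weight bar).
Local Notation V := {ffun Iseq d -> {mpoly K[m]}}.
Local Notation Vb := {ffun Iseq bar -> {mpoly K[n]}}.
Implicit Types (G : Vb) (w : Iseq d).

(** In the long quiver, arrows into k from other vertices still end at k, while arrows out of k to
    them start at k+1. So when a pair k, k+1 crosses another letter, one of the two crossings
    carries the power for the short quiver and the other contributes 1. *)
Lemma evV_block (B : fieldType) (iota : {rmorphism K -> B}) G i1 a b i2 z1 x y z2 :
  size i1 = size z1 -> size i2 = size z2 -> (size z1 + (size z2).+2)%N = m -> x != y ->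
  evV iota (opw hb (blk k (size i1) (i1 ++ b :: a :: i2)) G)
    (phis k (i1 ++ a :: b :: i2)) (blow k id id (i1 ++ a :: b :: i2) (z1 ++ x :: y :: z2))
  = (-1) ^+ ((a == k) && (b == k)) *
    evV iota (op_tn h (size i1) (contract G)) (i1 ++ a :: b :: i2) (z1 ++ x :: y :: z2).
Proof.
move=> s1 s2 sm xy.
have si c c' : size (i1 ++ c :: c' :: i2) = m by rewrite size_cat /= s1 s2.
have sz u u' : size (z1 ++ u :: u' :: z2) = m by rewrite size_cat.
have [w Ew|ni] := iwordP d (i1 ++ [:: a, b & i2]); last first.
  by rewrite !evV_other ?mulr0 //; apply: phis_not_iword.
have sb : bsize k (i1 ++ [:: a, b & i2]) = n by rewrite Ew bsize_iword.
rewrite evV_tn ?s1 // !evV_contract ?si ?sz //.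
rewrite -s1 blk_cat !phis_cat !blow_cat //= !phis_cons /=.
set p := bsize k i1; set P := phis k i1; set Q := phis k i2.
set Y := blow k id id i1 z1; set Z := blow k id id i2 z2.
have sP : size P = p by rewrite size_phis.
have sY : size Y = p by rewrite size_blow.
have QZ : size Q = size Z by rewrite size_phis size_blow.
have {}sb : (p + (((a == k) + (b == k)) + (size Z).+2))%N = n.
  rewrite -sb -QZ /p /Q size_phis /bsize size_cat count_cat /=; clear; lia.
have xy0 : x - y != 0 by rewrite subr_eq0.
have k01 := k0_neq_k1 k; have k10 : (k1 == k0) = false by rewrite eq_sym (negPf (k0_neq_k1 k)).
have [ak|ak] := eqVneq a k; have [bk|bk] := eqVneq b k;
  rewrite ?ak ?bk ?eqxx ?beta_k /= in sb *.
  have {}sb : (p + (size Z).+4)%N = n := sb.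
  have T1 (F : Vb) u x' y' z' :
      evV iota (op_tn hb p.+1 F) (P ++ [:: k0, k0, k1, k1 & Q]) (Y ++ [:: u, x', y', z' & Z]) =
      (y' - x') * evV iota F (P ++ [:: k0, k1, k0, k1 & Q]) (Y ++ [:: u, y', x', z' & Z]).
    by rewrite (evV_tnS hb iota sP sY) ?(negPf k01) ?quiver_k0_k1 //= ?QZ ?expr1.
  have T2 (F : Vb) u v :
      evV iota (op_tn hb p.+2 F) (P ++ [:: k0, k0, k1, k1 & Q]) (Y ++ [:: u, v, x, y & Z]) =
      (evV iota F (P ++ [:: k0, k0, k1, k1 & Q]) (Y ++ [:: u, v, y, x & Z]) -
       evV iota F (P ++ [:: k0, k0, k1, k1 & Q]) (Y ++ [:: u, v, x, y & Z])) / (x - y).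
    by rewrite (evV_tnSS hb iota sP sY) // eqxx.
  rewrite (evV_tnS hb iota sP sY) ?k10 ?quiver_k1_k0 //= ?QZ // expr0 mul1r.
  rewrite (evV_tn hb iota _ sP sY) ?eqxx //= ?sY ?QZ //.
  move: (@op_tn K _ hb bar) (@evV K _ bar B iota) T1 T2 => t f T1 T2.
  (* Of the four terms two acquire a difference of equal coordinates and vanish. The other two give
     the values at x, x, y, y minus those at y, y, x, x, over x - y: the Demazure operator with the
     opposite sign. *)
  rewrite T2 T2 T1 T1 T1 T1 !subrr !mul0r sub0r subr0 expr1 !mulN1r.
  by field.
- rewrite (negPf bk) in sb.
  rewrite (evV_tnS hb iota sP sY) /= ?QZ ?[k1 == _]eq_sym ?beta_neq_k1 //.
  rewrite (evV_tn hb iota _ sP sY) /= ?sY ?QZ // ?[k0 == _]eq_sym ?beta_eq_k0 ?(negPf bk) //.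
  rewrite quiver_k0_beta (quiver_k1_beta e_gt1 bk) expr0 !mul1r.
  by rewrite eq_sym (negPf bk).
- rewrite (negPf ak) in sb.
  rewrite (evV_tn hb iota _ sP sY) /= ?sY ?QZ // ?beta_eq_k0 ?(negPf ak) //.
  rewrite (evV_tnS hb iota sP sY) /= ?QZ ?beta_neq_k1 //.
  rewrite (quiver_beta_k1 ak) -[X in hb _ X]beta_k (quiver_beta e_gt1 _ ak) expr0 !mul1r.
  by [].
rewrite (negPf ak) (negPf bk) in sb.
rewrite (evV_tn hb iota _ sP sY) /= ?sY ?QZ // (inj_eq lift_inj) (quiver_beta e_gt1 _ ak).
by rewrite mul1r.
Qed.

(* Crossing the blow-ups of two letters k acts as minus the Demazure operator. *)
Definition blk_sign (r : nat) (i : seq 'I_e) : bool :=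
  [&& (r.+1 < size i)%N, nth k i r == k & nth k i r.+1 == k].

Lemma actn_blk r w : actn (blk k r (iword w)) (phi k w) = phi k (swapn r w).
Proof.
apply: iword_inj; rewrite iword_actn !iword_phi iword_swapn.
have [rw|wr] := ltnP r.+1 (size (iword w)); last first.
  rewrite swapl_oob // /blk ltnNge wr /= swapl_oob // size_phis.
  by rewrite leqnSn.
have [i1 [a [b [i2 [Ew <-]]]]] := swapl_split rw.
by rewrite Ew swapl_cat; apply: actl_blk.
Qed.

Lemma contract_blk r w G :
  contract (opw hb (blk k r (iword w)) (op_e (phi k w) G)) =
  (-1) ^+ blk_sign r (iword w) *: op_tn h r (op_e w (contract G)).
Proof.
rewrite opw_e actn_blk contract_e op_tn_e -op_polyC.
apply: evV_ext => B iota i z si sz uz.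
rewrite evV_poly !evV_e; case: eqP => [{i si}->|_]; last by rewrite mulr0.
rewrite evpC rmorph_sign /blk_sign size_iword iword_swapn.
have [rm|mr] := ltnP r.+1 m; last first.
  rewrite op_tn_oob // evV0 mulr0 /blk size_iword ltnNge mr /= op_tn_oob; last first.
    by rewrite bsize_iword.
  by rewrite evV_contract ?evV0 ?size_swapl ?size_iword.
have [|i1 [b [a [i2 [Ew i1r]]]]] := @swapl_split _ r (iword w); first by rewrite size_iword.
have [|z1 [x [y [z2 [Ez z1r]]]]] := @swapl_split _ r z; first by rewrite sz.
have sE : size i1 = size z1 by rewrite i1r z1r.
have s2 : size i2 = size z2.
  have := congr1 size Ew; have := congr1 size Ez; rewrite !size_cat size_iword sz /= sE.
  by move=> -> /addnI [].
have sm : (size z1 + (size z2).+2)%N = m by rewrite -sz Ez size_cat.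
have xy : x != y.
  move: uz; rewrite Ez cat_uniq /= inE => /and3P[_ _ /andP[xz _]].
  by move: xz; case: eqVneq.
have Esw : swapl r (iword w) = i1 ++ a :: b :: i2 by rewrite Ew -i1r swapl_cat.
rewrite evV_contract ?size_swapl ?size_iword // Esw Ew Ez -i1r evV_block //.
by rewrite !nth_cat ltnn subnn (leq_gtF (leqnSn _)) subSnn andbC.
Qed.

(** The parity of the number of crossings of two letters k. *)
Fixpoint bword_sign (u : seq nat) (i : seq 'I_e) : bool :=
  if u is r :: u' then blk_sign r (actl u' i) (+) bword_sign u' i else false.

Lemma actn_bword u w : actn (bword k u (iword w)) (phi k w) = phi k (actn u w).
Proof. by elim: u => //= r u IH; rewrite actn_cat IH -iword_actn actn_blk. Qed.

Lemma contract_bword u w G :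
  contract (opw hb (bword k u (iword w)) (op_e (phi k w) G)) =
  (-1) ^+ bword_sign u (iword w) *: opw h u (op_e w (contract G)).
Proof.
elim: u => [|r u IH] /=; first by rewrite scale1r contract_e.
rewrite /opw foldr_cat -/(opw _ _ _) -/(opw _ _ _).
have E : opw hb (bword k u (iword w)) (op_e (phi k w) G) =
    op_e (phi k (actn u w)) (opw hb (bword k u (iword w)) G).
  by rewrite opw_e actn_bword.
rewrite E -iword_actn contract_blk -contract_e -E IH.
have := op_tn_lin h r ((-1) ^+ bword_sign u (iword w)) (opw h u (op_e w (contract G))) 0.
by rewrite addr0 [op_tn h r 0](@opw0 K _ h d [:: r]) addr0 => ->; rewrite scalerA signr_addb.
Qed.

End Block.

Lemma mem_blow (T U : eqType) e (k : 'I_e) (t0 : T) (f g : T -> U) i z y :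
  size z = size i -> y \in blow k f g i z ->
  exists2 q, (q < size i)%N & y = f (nth t0 z q) \/ (nth k i q = k /\ y = g (nth t0 z q)).
Proof.
elim: i z => [|a i IH] [|x z] //= [sz]; rewrite inE => /orP[/eqP ->|].
  by exists 0%N => //; left.
have tl : y \in blow k f g i z -> exists2 q, (q < (size i).+1)%N &
    y = f (nth t0 (x :: z) q) \/ (nth k (a :: i) q = k /\ y = g (nth t0 (x :: z) q)).
  by move=> /(IH z sz)[q qi E]; exists q.+1.
case: eqP => // ak; rewrite inE => /orP[/eqP ->|]; last exact: tl.
by exists 0%N => //; right.
Qed.

(** * Elements whose operators descend to the contraction *)

Section Shadow.
Variables (K : fieldType) (e : nat) (e_gt1 : (1 < e)%N) (k : 'I_e) (d : 'I_e -> nat).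
Local Notation k0 := (widen_ord (leqnSn e) k).
Local Notation k1 := (ordS k0).
Local Notation h := (@cyclic_quiver e).
Local Notation hb := (@cyclic_quiver e.+1).
Local Notation bar := (bar_dim k d).
Local Notation m := (weight d).
Local Notation n := (weight bar).
Local Notation V := {ffun Iseq d -> {mpoly K[m]}}.
Local Notation Vb := {ffun Iseq bar -> {mpoly K[n]}}.

Variables (A : kAlgType K) (ea : Iseq d -> A) (xa : 'I_m -> A) (ta : nat -> A).
Hypothesis sysa : klr_system ea xa ta.
Variable acta : A -> V -> V.
Hypothesis actaM : forall a b F, acta (a * b) F = acta a (acta b F).
Hypothesis actaB : forall a b F, acta (a - b) F = acta a F - acta b F.
Hypothesis actaS : forall c F, acta c%:S F = c *: F.
Hypothesis acta_e : forall w F, acta (ea w) F = op_e w F.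
Hypothesis acta_x : forall a F, acta (xa a) F = op_poly 'X_a F.
Hypothesis acta_t : forall r F, acta (ta r) F = op_tn h r F.

Variables (B : kAlgType K) (eb : Iseq bar -> B) (xb : 'I_n -> B) (tb : nat -> B).
Hypothesis sysb : klr_system eb xb tb.
Variable actb : B -> Vb -> Vb.
Hypothesis actbM : forall a b F, actb (a * b) F = actb a (actb b F).
Hypothesis actbB : forall a b F, actb (a - b) F = actb a F - actb b F.
Hypothesis actbS : forall c F, actb c%:S F = c *: F.
Hypothesis actb_e : forall w F, actb (eb w) F = op_e w F.
Hypothesis actb_x : forall a F, actb (xb a) F = op_poly 'X_a F.
Hypothesis actb_t : forall r F, actb (tb r) F = op_tn hb r F.

Implicit Types (U : B) (a : A).

(* The isomorphism sends a to the class of any U with shadow U a. *)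
Definition shadow U a := forall G, contract (actb U G) = acta a (contract G).

Lemma shadowB U U' a a' : shadow U a -> shadow U' a' -> shadow (U - U') (a - a').
Proof. by move=> Ua Ua' G; rewrite actbB actaB contractB Ua Ua'. Qed.

Lemma contract0 : contract (0 : Vb) = 0 :> V.
Proof. by rewrite -[0 in LHS](subrr 0) contractB subrr. Qed.

Lemma shadow0 : shadow 0 0.
Proof. by move=> G; rewrite (act0 actbB) (act0 actaB) contract0. Qed.

Lemma shadowD U U' a a' : shadow U a -> shadow U' a' -> shadow (U + U') (a + a').
Proof. by move=> Ua Ua' G; rewrite (actD actbB) (actD actaB) contractD Ua Ua'. Qed.

Lemma shadowM U U' a a' : shadow U a -> shadow U' a' -> shadow (U * U') (a * a').
Proof. by move=> Ua Ua' G; rewrite actbM actaM Ua Ua'. Qed.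

Lemma shadow_sum (J : Type) (r : seq J) (P : pred J) F f :
  (forall j, P j -> shadow (F j) (f j)) ->
  shadow (\sum_(j <- r | P j) F j) (\sum_(j <- r | P j) f j).
Proof.
move=> Ff; elim/big_rec2: _ => [|j a U Pj Ua]; first exact: shadow0.
exact: shadowD (Ff j Pj) Ua.
Qed.

Lemma shadowS c : shadow c%:S c%:S.
Proof. by move=> G; rewrite actbS actaS -[c *: G]addr0 contract_lin contract0 addr0. Qed.

Lemma shadow1 : shadow 1 1.
Proof. by rewrite -(rmorph1 (scal B)) -(rmorph1 (scal A)); exact: shadowS. Qed.

Definition wo_sum : B := \sum_(v | well_ordered v) eb v.

(** Only the values over the sequences [phi w] enter [contract], and these sequences are
    well-ordered; so cutting by the idempotent is invisible after contraction. *)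
Lemma shadow_wo_sum : shadow wo_sum 1.
Proof.
move=> G; rewrite (act1 actaS) /wo_sum (act_sum actbB); apply/ffunP => w.
rewrite !ffunE; congr contract_poly; rewrite sum_ffunE (bigD1 (phi k w)) ?phi_well_ordered //=.
rewrite actb_e ffunE eqxx big1 ?addr0 // => v /andP[_ vw].
by rewrite actb_e ffunE eq_sym (negPf vw).
Qed.

(** The scalar cancels the sign of [contract_bword], so that the shadow is exactly
    [nelt ea xa ta u p w]. *)
Definition blown u (p : {mpoly K[m]}) (w : Iseq d) : B :=
  nelt eb xb tb (bword k u (iword w))
    (blow_poly k w ((-1) ^+ bword_sign k u (iword w) *: p)) (phi k w).

Lemma op_poly_e (I : finType) (al : I -> nat) p w (F : {ffun Iseq al -> {mpoly K[weight al]}}) :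
  op_poly p (op_e w F) = op_e w (op_poly p F).
Proof. by apply/ffunP => v; rewrite !ffunE; case: ifP => _; rewrite ?mulr0. Qed.

Lemma shadow_blown u p w : shadow (blown u p w) (nelt ea xa ta u p w).
Proof.
move=> G; rewrite (act_nelt sysa actaM actaB actaS acta_e acta_x acta_t).
rewrite (act_nelt sysb actbM actbB actbS actb_e actb_x actb_t).
rewrite op_poly_e contract_bword // -contract_e -op_poly_e contract_poly_e blow_polyK.
set s := _ ^+ _; have ss : s * s = 1 by rewrite -expr2 sqrr_sign.
set F := op_e w _.
have -> : op_poly (s *: p) F = s *: op_poly p F + 0.
  by rewrite addr0; apply/ffunP => v; rewrite !ffunE -scalerAl.
by rewrite opw_lin opw0 addr0 scalerA ss scale1r.
Qed.

Lemma contract_surj (F : V) : exists G : Vb, @contract K e k d G = F.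
Proof.
exists [ffun v => \sum_(w | v == phi k w) blow_poly k w (F w)].
apply/ffunP => w; rewrite !ffunE (big_pred1 w) ?blow_polyK // => v.
by rewrite (inj_eq (@phi_inj _ _ _)) eq_sym.
Qed.

(** Since [contract] is onto, [U] determines the operator of its shadow, and faithfulness determines
    the element. *)
Lemma shadow_inj U a a' : shadow U a -> shadow U a' -> a = a'.
Proof.
move=> Ua Ua'; apply/eqP; rewrite -subr_eq0; apply/eqP.
apply: (act_faithful sysa actaM actaB actaS acta_e acta_x acta_t) => F.
by have [G <-] := contract_surj F; rewrite actaB -Ua -Ua' subrr.
Qed.

(** The two-sided ideal of the whole algebra, before cutting by the idempotent; its form matches
    [corner_ideal_pred]. *)
Definition through_unordered U := exists s : Iseq bar -> seq (B * B),
  U = \sum_(v | unordered v) \sum_(ab <- s v) ab.1 * eb v * ab.2.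

Lemma vanishing_act U (F : Vb) : vanishing k F -> vanishing k (actb U F).
Proof.
move=> vF.
apply: (sys_ind sysb (P := fun U => vanishing k (actb U F))) U => [|a b|c a|w a|i a|r a].
- by rewrite (act1 actbS).
- by move=> va vb; rewrite (actD actbB); apply: vanishingD.
- by move=> va; rewrite actbM actbS; apply: vanishingZ.
- by move=> va; rewrite actbM actb_e; apply: vanishing_op_e.
- by move=> va; rewrite actbM actb_x; apply: vanishing_op_poly.
move=> va; rewrite actbM actb_t /op_tn; case: insub => [r'|]; first exact: vanishing_op_t.
by move=> C iota j y _ _ _; apply: evV0.
Qed.

Lemma contract_vanishing F : vanishing k F -> @contract K e k d F = 0.
Proof.
move=> vF; apply: evV_ext => C iota i z si sz uz.
rewrite evV0 evV_contract //.
case: (iwordP d i) si => [w ->|ni] si; last by apply: evV_other; apply: phis_not_iword.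
apply: vF; last by apply: admissible_blow; rewrite ?sz.
  by rewrite size_phis bsize_iword.
by rewrite size_blow ?sz // bsize_iword.
Qed.

Lemma shadow_unordered U : through_unordered U -> shadow U 0.
Proof.
move=> [s ->] G; rewrite (act0 actaB); apply: contract_vanishing.
rewrite (act_sum actbB).
have v0 : vanishing k (0 : Vb) by move=> C iota j y _ _ _; apply: evV0.
elim/big_ind: _ => //; first exact: vanishingD.
move=> v uv; rewrite (act_sum actbB); elim/big_ind: _ => //; first exact: vanishingD.
move=> ab _; rewrite !actbM actb_e; apply: vanishing_act; apply: vanishing_unordered.
case/existsP: uv => t ct; exists t => //; by rewrite -ltnS.
Qed.

Lemma through_unordered_in (a b : B) v : unordered v -> through_unordered (a * eb v * b).
Proof.
move=> uv; exists (fun v' => if v' == v then [:: (a, b)] else [::]).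
rewrite (bigD1 v) //= eqxx big_seq1 big1 ?addr0 // => w /andP[_ /negPf->].
by rewrite big_nil.
Qed.

Lemma through_unorderedD U U' :
  through_unordered U -> through_unordered U' -> through_unordered (U + U').
Proof.
move=> [s ->] [s' ->]; exists (fun v => s v ++ s' v); rewrite -big_split.
by apply: eq_bigr => v _; rewrite big_cat.
Qed.

Lemma through_unordered0 : through_unordered 0.
Proof. by exists (fun=> [::]); rewrite big1 // => v _; rewrite big_nil. Qed.

Lemma through_unorderedMl (a : B) U : through_unordered U -> through_unordered (a * U).
Proof.
move=> [s ->]; exists (fun v => [seq (a * ab.1, ab.2) | ab <- s v]).
rewrite mulr_sumr; apply: eq_bigr => v _; rewrite mulr_sumr big_map.
by apply: eq_bigr => ab _; rewrite !mulrA.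
Qed.

Lemma through_unorderedMr (a : B) U : through_unordered U -> through_unordered (U * a).
Proof.
move=> [s ->]; exists (fun v => [seq (ab.1, ab.2 * a) | ab <- s v]).
rewrite mulr_suml; apply: eq_bigr => v _; rewrite mulr_suml big_map.
by apply: eq_bigr => ab _; rewrite !mulrA.
Qed.

End Shadow.

(** * Spanning modulo the ideal of unordered idempotents *)

Section SpanningModulo.
Variables (K : fieldType) (e : nat) (k : 'I_e) (d : 'I_e -> nat).
Local Notation k0 := (widen_ord (leqnSn e) k).
Local Notation k1 := (ordS k0).
Local Notation bar := (bar_dim k d).
Local Notation m := (weight d).
Local Notation n := (weight bar).
Implicit Types (w : Iseq d).

(** Position [c] is either the start of the blow-up of the letter [q], or the second place of a pair
    whose start is [c']. *)
Lemma contract_var (c : 'I_n) w : exists2 q : 'I_m,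
  contract_poly w 'X_c = 'X_q :> {mpoly K[m]} &
  blow_poly k w 'X_q = 'X_c :> {mpoly K[n]} \/
  exists c' : 'I_n, [/\ c = c'.+1 :> nat, blow_poly k w 'X_q = 'X_c' :> {mpoly K[n]} &
                     nth k1 (iword (phi k w)) c' = k0].
Proof.
have : nat_of_ord c \in blow k id S (iword w) (poss k 0 (iword w)).
  by rewrite -iota_blow bsize_iword mem_iota /= add0n.
case/(mem_blow 0%N); first by rewrite size_poss.
move=> q qi cE; have qm := qi; rewrite size_iword in qm.
have sv : size ([seq 'X_a | a : 'I_m] : seq {mpoly K[m]}) = size (iword w).
  by rewrite size_vars size_iword.
have [Eq Ek] := @nth_poss_blow _ k _ _ 0 0 id id (iword w) _ 0%N sv q qi.
have [Bq _] := @nth_poss_blow _ k _ _ k k1 (lift k1) (fun=> k1) (iword w) _ 0%N erefl q qi.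
rewrite subn0 in Eq Ek; rewrite subn0 in Bq.
have vq : [seq 'X_a | a : 'I_m]`_q = 'X_(Ordinal qm) :> {mpoly K[m]}.
  rewrite (nth_map (Ordinal qm)) ?size_enum_ord //; congr 'X_ _.
  by apply: val_inj; rewrite /= nth_enum_ord.
have bq (c' : 'I_n) : c' = nth 0%N (poss k 0 (iword w)) q :> nat ->
    blow_poly k w 'X_(Ordinal qm) = 'X_c' :> {mpoly K[n]}.
  move=> c'E; rewrite /blow_poly evpX (nth_map 0%N) ?size_poss //= -c'E.
  by rewrite (nth_map c') ?size_enum_ord // nth_ord_enum.
exists (Ordinal qm).
  rewrite /contract_poly evpX -vq; case: cE => [->|[/eqP ik ->]]; first exact: Eq.
  exact: Ek.
case: cE => [cE|[ik cE]]; first by left; apply: bq.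
right; have c'n : (nth 0%N (poss k 0 (iword w)) q < n)%N.
  by rewrite -ltnS -cE ltnS ltnW.
exists (Ordinal c'n); split; [exact: cE | exact: bq |].
by rewrite iword_phi [LHS]Bq ik beta_k.
Qed.

Variables (A : kAlgType K) (E : Iseq bar -> A) (x : 'I_n -> A) (t : nat -> A).
Hypothesis sys : klr_system E x t.
Hypothesis quadratic : forall w (a b : 'I_n), b = a.+1 :> nat ->
  nth k1 (iword (phi k w)) a = k0 -> nth k1 (iword (phi k w)) b = k1 ->
  t a * t a * E (phi k w) = (x b - x a) * E (phi k w).
Local Notation J := (through_unordered E).
Local Notation ww := (wo_sum E).

Lemma through_unordered_var (a b : 'I_n) w : b = a.+1 :> nat ->
  nth k1 (iword (phi k w)) a = k0 -> J ((x b - x a) * E (phi k w)).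
Proof.
move=> ba ak; have bk : nth k1 (iword (phi k w)) b = k1.
  by move: ak; rewrite iword_phi => /nth_phis[E1 _]; rewrite ba.
rewrite -(quadratic ba ak bk) -mulrA (sys_te sys) mulrA.
by apply: through_unordered_in; apply: swap_phi_unordered.
Qed.

Lemma through_unordered_mul (a a' b b' : A) v :
  J ((a - a') * E v) -> J ((b - b') * E v) -> b' * E v = E v * b' ->
  J ((a * b - a' * b') * E v).
Proof.
move=> Ja Jb bC.
have -> : (a * b - a' * b') * E v = a * ((b - b') * E v) + (a - a') * E v * b'.
  rewrite -[_ * E v * b']mulrA -bC !mulrA -mulrDl; congr (_ * _).
  by rewrite mulrBl mulrBr addrA addrNK.
by apply: through_unorderedD; [apply: through_unorderedMl | apply: through_unorderedMr].
Qed.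

(** Modulo the ideal the second variable of a pair equals the first; applying [contract_poly] and
    then [blow_poly] makes all these replacements. *)
Lemma through_unordered_poly q w :
  J ((poly_at x q - poly_at x (blow_poly k w (contract_poly w q))) * E (phi k w)).
Proof.
have xC := sys_xx sys.
have fixed p : blow_poly k w (contract_poly w p) = p ->
    J ((poly_at x p - poly_at x (blow_poly k w (contract_poly w p))) * E (phi k w)).
  by move=> ->; rewrite subrr mul0r; apply: through_unordered0.
elim/mpoly_ring_ind: q => [c|c|f g Jf Jg|f g Jf Jg].
- by apply: fixed; rewrite /contract_poly /blow_poly !evpC.
- have [q Eq [Bq|[c' [cc' Bq ck]]]] := contract_var c w.
    by apply: fixed; rewrite Eq.
  rewrite Eq Bq.
  by rewrite !poly_atXi; apply: through_unordered_var.
- have -> : blow_poly k w (contract_poly w (f + g)) =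
      blow_poly k w (contract_poly w f) + blow_poly k w (contract_poly w g) :> {mpoly K[n]}.
    by rewrite /contract_poly /blow_poly !evpD.
  move: (blow_poly _ _ _) (blow_poly _ _ _) Jf Jg => f' g' Jf Jg.
  by rewrite !poly_atD opprD addrACA mulrDl; apply: through_unorderedD.
have -> : blow_poly k w (contract_poly w (f * g)) =
    blow_poly k w (contract_poly w f) * blow_poly k w (contract_poly w g) :> {mpoly K[n]}.
  by rewrite /contract_poly /blow_poly !evpM.
rewrite !poly_atM //.
move: (blow_poly _ _ _) (blow_poly _ _ _) Jf Jg => f' g' Jf Jg.
apply: (through_unordered_mul Jf Jg); exact: (poly_at_e sys).
Qed.

Lemma wo_sumE v : ww * E v = if well_ordered v then E v else 0.
Proof.
rewrite /wo_sum mulr_suml; case: ifP => [wv|nv].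
  rewrite (bigD1 v) //= (sys_ee sys) eqxx big1 ?addr0 // => u /andP[_ uv].
  by rewrite (sys_ee sys) (negPf uv).
rewrite big1 // => u wu; rewrite (sys_ee sys); case: eqP => // uv.
by rewrite -uv wu in nv.
Qed.

Lemma E_wo_sum v : E v * ww = if well_ordered v then E v else 0.
Proof.
rewrite /wo_sum mulr_sumr; case: ifP => [wv|nv].
  rewrite (bigD1 v) //= (sys_ee sys) eqxx big1 ?addr0 // => u /andP[_ uv].
  by rewrite (sys_ee sys) eq_sym (negPf uv).
rewrite big1 // => u wu; rewrite (sys_ee sys); case: eqP => // uv.
by rewrite uv wu in nv.
Qed.

Local Notation normal p :=
  (\sum_w \sum_(L <- permutations (iota 0 m)) blown E x t (nf L) (p L w) w).

Definition spanned (U : A) := exists p : seq nat -> Iseq d -> {mpoly K[m]},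
  J (ww * U * ww - normal p).

Lemma blown_polyr u p w : blown E x t u p w =
  tword t (bword k u (iword w)) * E (phi k w) *
  poly_at x (blow_poly k w ((-1) ^+ bword_sign k u (iword w) *: p)).
Proof. exact: nelt_polyr sys _ _ _. Qed.

Lemma blownD u p q w : blown E x t u (p + q) w = blown E x t u p w + blown E x t u q w.
Proof.
rewrite !blown_polyr -mulrDr -poly_atD; congr (_ * poly_at x _).
by rewrite scalerDr /blow_poly evpD.
Qed.

Lemma blown0 u w : blown E x t u 0 w = 0.
Proof.
rewrite blown_polyr scaler0; have -> : blow_poly k w 0 = 0 :> {mpoly K[n]}.
  exact: rmorph0.
by rewrite poly_at0 mulr0.
Qed.

Lemma spanned0 : spanned 0.
Proof.
exists (fun _ _ => 0); rewrite mulr0 mul0r sub0r big1 ?oppr0; first exact: through_unordered0.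
by move=> w _; rewrite big1 // => L _; rewrite blown0.
Qed.

Lemma spannedD U U' : spanned U -> spanned U' -> spanned (U + U').
Proof.
move=> [p Jp] [p' Jp']; exists (fun L w => p L w + p' L w).
have step S S' : J (ww * U * ww - S) -> J (ww * U' * ww - S') ->
    J (ww * (U + U') * ww - (S + S')).
  by move=> JS JS'; rewrite mulrDr mulrDl opprD addrACA; apply: through_unorderedD.
have -> : normal (fun L w => p L w + p' L w) = normal p + normal p'.
  rewrite -big_split; apply: eq_bigr => w _; rewrite -big_split.
  by apply: eq_bigr => L _; rewrite blownD.
exact: step Jp Jp'.
Qed.

Lemma spannedJ U : J U -> spanned U.
Proof.
move=> JU; have [p Jp] := spanned0; exists p.
have step S : J (ww * 0 * ww - S) -> J (ww * U * ww - S).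
  rewrite mulr0 mul0r sub0r => JS; apply: through_unorderedD => //.
  by apply: through_unorderedMr; apply: through_unorderedMl.
exact: step Jp.
Qed.

Lemma spanned_cut U U' : spanned U' -> spanned (U - U') -> spanned U.
Proof. by move=> sU' sU; rewrite -(subrK U' U); apply: spannedD. Qed.

Lemma wo_nelt u q v : ww * nelt E x t u q v =
  if well_ordered (actn u v) then nelt E x t u q v else 0.
Proof.
have nE : nelt E x t u q v = E (actn u v) * nelt E x t u q v.
  by rewrite (e_nelt sys) eqxx.
by rewrite nE mulrA wo_sumE; case: ifP => _; rewrite ?mul0r.
Qed.

Lemma nelt_wo u q v : nelt E x t u q v * ww =
  if well_ordered v then nelt E x t u q v else 0.
Proof. by rewrite /nelt -!mulrA E_wo_sum; case: ifP => _; rewrite ?mulr0. Qed.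

Lemma wo_blown_wo u p w : ww * blown E x t u p w * ww = blown E x t u p w.
Proof.
by rewrite /blown wo_nelt actn_bword phi_well_ordered nelt_wo phi_well_ordered.
Qed.

Lemma spanned_blown L p w : perm_eq L (iota 0 m) -> spanned (blown E x t (nf L) p w).
Proof.
move=> pL; exists (fun L' v => if (L' == L) && (v == w) then p else 0).
rewrite wo_blown_wo (bigD1 w) //= (bigD1_seq L) ?permutations_uniq ?mem_permutations //=.
rewrite !eqxx /= !big1 ?addr0; last 2 first.
- by move=> v vw; rewrite big1 // => L' _; rewrite (negPf vw) andbF blown0.
- by move=> L' /negPf->; rewrite blown0.
by rewrite subrr; apply: through_unordered0.
Qed.

Lemma spanned_bword L q w : perm_eq L (iota 0 m) ->
  spanned (nelt E x t (bword k (nf L) (iword w)) q (phi k w)).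
Proof.
move=> pL; set s := (-1) ^+ bword_sign k (nf L) (iword w) : K.
apply: (spanned_cut (U' := blown E x t (nf L) (s *: contract_poly w q) w)).
  exact: spanned_blown.
rewrite /blown -/s scalerA (_ : s * s = 1) ?scale1r; last by rewrite -expr2 sqrr_sign.
apply: spannedJ; rewrite /nelt -!mulrA -mulrBr -mulrBl; apply: through_unorderedMl.
exact: through_unordered_poly.
Qed.

Theorem spanned_all U : spanned U.
Proof.
elim/(fil_induction sys): U => [|a b|u q v IH]; first exact: spanned0.
  exact: spannedD.
have [wv|nwv] := boolP (well_ordered v); last first.
  have [p Jp] := spanned0; exists p; move: Jp; congr (J (_ - _)).
  by rewrite mulr0 mul0r -mulrA nelt_wo (negPf nwv) mulr0.
have [wuv|nwuv] := boolP (well_ordered (actn u v)); last first.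
  have [p Jp] := spanned0; exists p; move: Jp; congr (J (_ - _)).
  by rewrite mulr0 mul0r wo_nelt (negPf nwuv) mul0r.
have [w vE] := well_orderedP wv; have [j jE] := well_orderedP wuv.
have IHr a : fil E x t (size u) a -> spanned (a * poly_at x q).
  by move=> fa; apply: IH; apply: (fil_polyr sys).
have nE u' : nelt E x t u' q v = tword t u' * E v * poly_at x q := nelt_polyr sys _ _ _.
(* With both ends well-ordered, the permutation of [u] carries one blow-up to another, as
   [balanced_or_desc] assumes. *)
have stE : map (nth k1 (phis k (iword w))) (st bar u) = phis k (iword j).
  rewrite -!iword_phi -vE -jE iword_actn (actlE k1 u (iword v)) size_iword.
  by [].
have pst : perm_eq (st bar u) (iota 0 (bsize k (iword w))).
  by rewrite bsize_iword; apply: perm_actl.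
rewrite nE; have [[p pk dp]|[L pL [stL jL]]] := balanced_or_desc pst stE.
  (* The descent lies inside a pair of the target: once its tau is at the front, the sequence just
     before this last crossing is unordered. *)
  have [fu|[u' [su stu' fu]]] := exchange sys v dp; first exact: IHr.
  rewrite -(subrK (tword t (p :: u') * E v) (tword t u * E v)) mulrDl.
  apply: spannedD; first exact: IHr.
  apply: spannedJ; apply: through_unorderedMr.
  have -> : tword t (p :: u') * E v = t p * E (actn u' v) * tword t u'.
    by rewrite /= -mulrA (tword_e sys) mulrA.
  apply: through_unordered_in.
  have -> : actn u' v = swapn p (phi k j).
    apply: iword_inj; rewrite iword_swapn -jE !iword_actn.
    rewrite -[swapl p _]/(actl (p :: u) (iword v)).
    by apply: actl_inj_nat (size_iword v) _; rewrite -/(st bar u') stu'.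
  by apply: swap_phi_unordered; rewrite iword_phi.
(* Otherwise the permutation is the block permutation of [L], and the blown-up normal form of [L] is
   a reduced word for it, to which [fil_reduce] compares [u]. *)
rewrite size_iword in pL; have [cL aL] := nfP pL.
have pL' : perm_eq L (iota 0 (size (iword w))) by rewrite size_iword.
have jw : actl (nf L) (iword w) = iword j.
  by rewrite jL (actlE k (nf L) (iword w)) size_iword actl_nf.
have aL' : actl (rev (nf L)) L = iota 0 (size (iword w)) by rewrite size_iword.
have [] := chain_bword k pL' cL aL'; rewrite jw -stL bsize_iword => cb ab.
have [fu|fu] := fil_reduce sys v cb ab; first exact: IHr.
rewrite -(subrK (tword t (bword k (nf L) (iword w)) * E v) (tword t u * E v)) mulrDl.
apply: spannedD; first exact: IHr.
by rewrite -nE vE; apply: spanned_bword.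
Qed.

End SpanningModulo.

(** * The isomorphism *)

Section Isomorphism.
Variables (K : fieldType) (e : nat) (e_gt1 : (1 < e)%N) (k : 'I_e) (d : 'I_e -> nat).
Local Notation k0 := (widen_ord (leqnSn e) k).
Local Notation k1 := (ordS k0).
Local Notation h := (@cyclic_quiver e).
Local Notation hb := (@cyclic_quiver e.+1).
Local Notation bar := (bar_dim k d).
Local Notation m := (weight d).
Local Notation n := (weight bar).
Local Notation V := {ffun Iseq d -> {mpoly K[m]}}.
Local Notation Vb := {ffun Iseq bar -> {mpoly K[n]}}.

Variables (A : kAlgType K) (ea : Iseq d -> A) (xa : 'I_m -> A) (ta : nat -> A).
Hypothesis sysa : klr_system ea xa ta.
Variable acta : A -> V -> V.
Hypothesis actaM : forall a b F, acta (a * b) F = acta a (acta b F).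
Hypothesis actaB : forall a b F, acta (a - b) F = acta a F - acta b F.
Hypothesis actaS : forall c F, acta c%:S F = c *: F.
Hypothesis acta_e : forall w F, acta (ea w) F = op_e w F.
Hypothesis acta_x : forall a F, acta (xa a) F = op_poly 'X_a F.
Hypothesis acta_t : forall r F, acta (ta r) F = op_tn h r F.

Variables (B : kAlgType K) (eb : Iseq bar -> B) (xb : 'I_n -> B) (tb : nat -> B).
Hypothesis sysb : klr_system eb xb tb.
Variable actb : B -> Vb -> Vb.
Hypothesis actbM : forall a b F, actb (a * b) F = actb a (actb b F).
Hypothesis actbB : forall a b F, actb (a - b) F = actb a F - actb b F.
Hypothesis actbS : forall c F, actb c%:S F = c *: F.
Hypothesis actb_e : forall w F, actb (eb w) F = op_e w F.
Hypothesis actb_x : forall a F, actb (xb a) F = op_poly 'X_a F.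
Hypothesis actb_t : forall r F, actb (tb r) F = op_tn hb r F.
Hypothesis quadratic : forall w (a b : 'I_n), b = a.+1 :> nat ->
  nth k1 (iword (phi k w)) a = k0 -> nth k1 (iword (phi k w)) b = k1 ->
  tb a * tb a * eb (phi k w) = (xb b - xb a) * eb (phi k w).

Local Notation shadow := (shadow acta actb).
Local Notation J := (through_unordered eb).
Local Notation ww := (wo_sum eb).
Local Notation normalb p :=
  (\sum_w \sum_(L <- permutations (iota 0 m)) blown eb xb tb (nf L) (p L w) w).
Local Notation normala p :=
  (\sum_w \sum_(L <- permutations (iota 0 m)) nelt ea xa ta (nf L) (p L w) w).

Let shadow_J U : J U -> shadow U 0 :=
  shadow_unordered actaB sysb actbM actbB actbS actb_e actb_x actb_t (U := U).

Lemma shadow_normal p : shadow (normalb p) (normala p).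
Proof.
apply: (shadow_sum actaB actbB) => w _; apply: (shadow_sum actaB actbB) => L _.
by apply: shadow_blown.
Qed.

Lemma shadow_exists a : exists U, shadow U a.
Proof. by have [p ->] := span_normal sysa a; exists (normalb p); apply: shadow_normal. Qed.

Lemma shadow_cut U a : shadow U a -> shadow (ww * U * ww) a.
Proof.
move=> Ua; have ww1 := shadow_wo_sum actaS actbB actb_e.
by rewrite -[a]mulr1 -[a]mul1r; do 2!apply: (shadowM actaM actbM) => //.
Qed.

(** Up to the ideal, whose shadow is 0, only blown normal forms remain after cutting, and their
    shadows are known. *)
Lemma shadow_total U : exists a, shadow (ww * U * ww) a.
Proof.
have [p Jp] := spanned_all sysb quadratic U; exists (normala p).
have := shadowD actaB actbB (shadow_J Jp) (shadow_normal p).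
have step S a : shadow (ww * U * ww - S + S) (0 + a) -> shadow (ww * U * ww) a.
  by rewrite subrK add0r.
exact: step.
Qed.

(** Modulo the ideal, [ww * U * ww] is a combination of blown normal forms. Its shadow is both 0 and
    the same combination of normal forms of [A]; as these are independent, every coefficient is
    0. *)
Lemma shadow_kernel U : shadow U 0 -> J (ww * U * ww).
Proof.
move=> /shadow_cut U0; have [p Jp] := spanned_all sysb quadratic U.
have J0 := shadow_J Jp.
have step S a : shadow (ww * U * ww) 0 -> shadow (ww * U * ww - S) 0 -> shadow S a -> a = 0.
  move=> S1 S2 S3; apply: (shadow_inj sysa actaM actaB actaS acta_e acta_x acta_t S3).
  have := shadowB actaB actbB S1 S2.
  by rewrite opprB addrCA subrr addr0 subr0.
have p0 : normala p = 0 by apply: step U0 J0 (shadow_normal p).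
have pL w L : perm_eq L (iota 0 m) -> p L w = 0.
  apply: (opw_free (h := h)) => F.
  rewrite -[RHS](act0 actaB F) -p0 (act_sum actaB); apply: eq_bigr => v _.
  rewrite (act_sum actaB); apply: eq_bigr => L' _.
  by rewrite (act_nelt sysa actaM actaB actaS acta_e acta_x acta_t).
have step' S : J (ww * U * ww - S) -> S = 0 -> J (ww * U * ww).
  by move=> JS S0; rewrite S0 subr0 in JS.
apply: step' Jp _; apply: big1 => w _; rewrite big_seq big1 // => L.
by rewrite mem_permutations => /pL->; apply: (blown0 sysb).
Qed.

Variable ie : idempotent B.
Hypothesis ieE : idem_val ie = ww.
Local Notation corner_ideal := (corner_ideal ie eb (@unordered e k d)).

Lemma ideal_shadow u : u \in (corner_ideal : {pred _}) -> shadow (val u) 0.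
Proof.
move=> /asboolP[s us]; apply: shadow_J.
exists (fun v => [seq (idem_val ie * ab.1, ab.2 * idem_val ie) | ab <- s v]).
rewrite us; apply: eq_bigr => v _; rewrite big_map; apply: eq_bigr => ab _ /=.
by rewrite !mulrA.
Qed.

Lemma shadow_ideal U : shadow U 0 -> corner_proj ie U \in (corner_ideal : {pred _}).
Proof.
move=> /shadow_kernel [s Us]; apply/asboolP; exists s.
have -> : val (corner_proj ie U) = idem_val ie * (ww * U * ww) * idem_val ie.
  rewrite val_corner_proj -ieE !mulrA idem_mul -[RHS]mulrA idem_mul.
  by [].
rewrite Us mulr_sumr mulr_suml; apply: eq_bigr => v _.
by rewrite mulr_sumr mulr_suml; apply: eq_bigr => ab _; rewrite !mulrA.
Qed.

Local Notation S := (quot_alg corner_ideal).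

Definition shadow_lift a : B := sval (cid (shadow_exists a)).

Lemma shadow_liftP a : shadow (shadow_lift a) a.
Proof. exact: svalP (cid (shadow_exists a)). Qed.

Definition iso a : S := quot_map corner_ideal (corner_proj ie (shadow_lift a)).

Lemma val_corner_projB U U' : corner_proj ie U - corner_proj ie U' = corner_proj ie (U - U').
Proof. by apply: val_inj; rewrite val_cornerB !val_corner_proj mulrBr mulrBl. Qed.

(** Two lifts of [a] differ by an element of shadow 0, whose cut lies in the ideal; so the choice in
    [shadow_lift] is immaterial. *)
Lemma isoE U a : shadow U a -> iso a = quot_map corner_ideal (corner_proj ie U).
Proof.
move=> Ua; apply/quot_mapP; rewrite val_corner_projB; apply: shadow_ideal.
by have := shadowB actaB actbB (shadow_liftP a) Ua; rewrite subrr.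
Qed.

Fact iso_zmod : zmod_morphism iso.
Proof.
move=> a b; rewrite (isoE (shadowB actaB actbB (shadow_liftP a) (shadow_liftP b))).
by rewrite -val_corner_projB raddfB.
Qed.

Fact iso_monoid : monoid_morphism iso.
Proof.
split=> [|a b]; first by rewrite (isoE (shadow1 actaS actbS)).
(* A product in the corner has the idempotent in its middle. As the idempotent has shadow 1, the
   product of the lifts with it inserted is still a lift of [a * b]. *)
have ww1 : shadow (idem_val ie) 1 by rewrite ieE; apply: (shadow_wo_sum actaS actbB actb_e).
have := shadowM actaM actbM (shadowM actaM actbM (shadow_liftP a) ww1) (shadow_liftP b).
rewrite mulr1 => /isoE ->; rewrite -rmorphM; congr quot_map.
apply: val_inj; rewrite val_cornerM !val_corner_proj.
by rewrite -[RHS]mulrA -!mulrA [X in _ = _ * (_ * X)]mulrA idem_mul !mulrA.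
Qed.

Lemma iso_inj : injective iso.
Proof.
move=> a b /quot_mapP; rewrite val_corner_projB => /ideal_shadow.
rewrite val_corner_proj ieE => ab0.
apply/eqP; rewrite -subr_eq0; apply/eqP.
apply: (shadow_inj sysa actaM actaB actaS acta_e acta_x acta_t _ ab0).
by apply: shadow_cut; apply: (shadowB actaB actbB); apply: shadow_liftP.
Qed.

Lemma iso_surj q : exists a, iso a = q.
Proof.
rewrite -[q]quot_mapK; set u := repr _.
have [a Ua] := shadow_total (val u); exists a; rewrite (isoE Ua); congr quot_map.
by apply: val_inj; rewrite val_corner_proj -ieE corner_mull corner_mulr corner_mull corner_mulr.
Qed.

Theorem balanced_isomorphism : exists f : {rmorphism A -> S}, alg_isomorphism f.
Proof.
pose f : {rmorphism A -> S} := HB.pack iso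
  (GRing.isZmodMorphism.Build A S iso iso_zmod)
  (GRing.isMonoidMorphism.Build A S iso iso_monoid).
exists f; split.
  by move=> c; rewrite [LHS](isoE (shadowS actaS actbS c)).
exists (fun q => sval (cid (iso_surj q))).
  by move=> a; apply: iso_inj; apply: (svalP (cid (iso_surj (iso a)))).
by move=> q; apply: (svalP (cid (iso_surj q))).
Qed.

End Isomorphism.

Section Quadratic.
Variables (K : fieldType) (e : nat) (e_gt1 : (1 < e)%N) (k : 'I_e) (alpha : 'I_e.+1 -> nat).
Local Notation k0 := (widen_ord (leqnSn e) k).
Local Notation k1 := (ordS k0).
Local Notation hb := (@cyclic_quiver e.+1).
Local Notation n := (weight alpha).
Variables (A : kAlgType K) (E : Iseq alpha -> A) (x : 'I_n -> A) (t : 'I_n.-1 -> A).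
Hypothesis rel : klr_relations hb E x t.

(** One arrow leads from k to k+1 and none back, so Q is the difference of the two variables. *)
Lemma quadratic_k0_k1 w (a b : 'I_n) : b = a.+1 :> nat ->
  nth k1 (iword w) a = k0 -> nth k1 (iword w) b = k1 ->
  extend_t t a * extend_t t a * E w = (x b - x a) * E w.
Proof.
move=> ba ak bk; have an : (a.+1 < n)%N by rewrite -ba.
have [r ar] := ord_pred_weight an.
have -> : a = fstp r by apply: val_inj; rewrite /= -ar.
have -> : b = sndp r by apply: val_inj; rewrite /= -ar ba.
rewrite [nat_of_ord (fstp r)]/= extend_tE -expr2 (rel_t2 rel).
have -> : entry w (fstp r) = k0 by rewrite (entryE k1) /= -ar.
have -> : entry w (sndp r) = k1 by rewrite (entryE k1) /= -ar -ba.
by rewrite /klrQ (negPf (k0_neq_k1 k)) quiver_k0_k1 quiver_k1_k0 // expr0 mulr1.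
Qed.

End Quadratic.

Theorem theorem1p2 (K : fieldType) (e : nat) (e_gt1 : (1 < e)%N)
    (k : 'I_e) (d : 'I_e -> nat) :
  exists f : {rmorphism klr K (@cyclic_quiver e) d -> balanced_klr K k d},
    alg_isomorphism f.
Proof.
exact: (balanced_isomorphism e_gt1
  (klr_klr_system K (@cyclic_quiver e) d)
  (@klr_actM K _ (@cyclic_quiver e) d) (@klr_actB K _ (@cyclic_quiver e) d)
  (@klr_act_scal K _ (@cyclic_quiver e) d) (@klr_act_e K _ (@cyclic_quiver e) d)
  (@klr_act_x K _ (@cyclic_quiver e) d) (@klr_act_tn K _ (@cyclic_quiver e) d)
  (klr_klr_system K (@cyclic_quiver e.+1) (bar_dim k d))
  (@klr_actM K _ (@cyclic_quiver e.+1) (bar_dim k d))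
  (@klr_actB K _ (@cyclic_quiver e.+1) (bar_dim k d))
  (@klr_act_scal K _ (@cyclic_quiver e.+1) (bar_dim k d))
  (@klr_act_e K _ (@cyclic_quiver e.+1) (bar_dim k d))
  (@klr_act_x K _ (@cyclic_quiver e.+1) (bar_dim k d))
  (@klr_act_tn K _ (@cyclic_quiver e.+1) (bar_dim k d))
  (fun w => quadratic_k0_k1 e_gt1
     (klr_klr_relations K (@cyclic_quiver e.+1) (bar_dim k d)) (w := phi k w))
  (ie := klr_idem K (@cyclic_quiver e.+1) (@well_ordered e k d)) erefl).
Qed.
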